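(* Let $L$ be a compact group with a countable base of topology and $K\subset L$ a closed subgroup. Then any $*$-representation $\tau$ of the algebra $\mathcal{C}(L/\!\!/K)$ has the form $\mathcal{R}es_{L/\!\!/K}(\rho)$: there is a unitary representation $\rho$ of $L$, whose subspace of $K$-fixed vectors is cyclic, such that $\tau$ is equivalent to $\mathcal{R}es_{L/\!\!/K}(\rho)$.
   Context: Hilbert spaces are separable; unitary representations are (strongly) continuous. $\mathcal{C}(L)$ is the algebra of continuous complex-valued functions on $L$ with convolution with respect to the probability Haar measure $\lambda$ and involution $f^\star(g)=\overline{f(g^{-1})}$. $\mathcal{C}(L/\!\!/K)$ is the $*$-subalgebra of functions with $f(k_1gk_2)=f(g)$ for all $k_1,k_2\in K$. A $*$-representation of $\mathcal{C}(L/\!\!/K)$ in a Hilbert space $V$ is a $*$-homomorphism to the algebra of bounded operators on $V$. For a unitary representation $\rho$ of $L$ in $H$ put $\rho(f)=\int_L f(g)\rho(g)\,d\lambda(g)$. Let $H^K$ be the subspace of $K$-fixed vectors; it is cyclic if the linear combinations of vectors $\rho(g)\eta$, $g\in L$, $\eta\in H^K$, are dense in $H$. For $f\in\mathcal{C}(L/\!\!/K)$ the operator $\rho(f)$ preserves $H^K$ and vanishes on $(H^K)^\perp$; $\mathcal{R}es_{L/\!\!/K}(\rho)$ denotes the $*$-representation $f\mapsto\rho(f)|_{H^K}$ in $H^K$.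
   Formalization: The *-representation τ is assumed nondegenerate (τ(f)v=0 for all f implies v=0); without this the claim fails, e.g. for the zero representation on a nonzero space, and every Res(ρ) is nondegenerate. *)

(* Defs.v *)
From HB Require Import structures.
From mathcomp Require Import all_boot all_order all_algebra.
From mathcomp Require Import complex.
From mathcomp Require Import all_classical all_reals all_analysis.

Set Implicit Arguments.
Unset Strict Implicit.
Unset Printing Implicit Defensive.

Import Order.TTheory GRing.Theory Num.Theory.
Import numFieldNormedType.Exports.

Local Open Scope classical_set_scope.
Local Open Scope complex_scope.
Local Open Scope ring_scope.

(* [PointedTopological] rather than [Topological]: the library's generated
   sigma-algebras are only defined on pointed types. *)
HB.mixin Record isTopologicalGroup L & PointedTopological L & Group L := {
  mulg_continuous : continuous (fun p : L * L => (p.1 * p.2)%g);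
  invg_continuous : continuous (fun x : L => (x^-1)%g)
}.

#[short(type="topGroupType")]
HB.structure Definition TopologicalGroup :=
  {L of isTopologicalGroup L & PointedTopological L & Group L}.

Definition is_closed_subgroup (L : topGroupType) (K : set L) : Prop :=
  [/\ closed K, K 1%g, (forall x y, K x -> K y -> K (x * y)%g)
    & forall x, K x -> K (x^-1)%g].

Definition borel (L : topGroupType) := g_sigma_algebraType (@open L).

(* Left invariance suffices: on a compact group it implies right invariance. *)
Definition is_haar (R : realType) (L : topGroupType)
    (lambda : probability (borel L) R) : Prop :=
  forall (g : L) (A : set (borel L)), measurable A ->
    lambda [set (g * x)%g | x in A] = lambda A.

(* Separable complex Hilbert spaces.  The inner product is linear in the first
   argument and conjugate-linear in the second. *)
Record hilbert (R : realType) := Hilbert {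
  hilbert_sort :> completeNormedModType R[i];
  hdot : {dot hilbert_sort for Num.conj};
  hdot_norm : forall x : hilbert_sort, hdot x x = `|x| ^+ 2;
  hilbert_separable : exists D : set hilbert_sort, countable D /\ dense D
}.

Section algebra.
Variables (R : realType) (L : topGroupType) (lambda : probability (borel L) R).
Implicit Types (f : L -> R[i]) (K : set L).

Definition cintegral f : R[i] :=
  (\int[lambda]_x complex.Re (f x)) +i* (\int[lambda]_x complex.Im (f x)).

Definition convolution f1 f2 : L -> R[i] :=
  fun g => cintegral (fun h => f1 h * f2 (h^-1 * g)%g).

Definition involution f : L -> R[i] := fun g => Num.conj (f (g^-1)%g).

(* The underlying set of the algebra C(L//K). *)
Definition hecke K : set (L -> R[i]) :=
  [set f | continuous (f : L -> R[i]^o) /\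
     forall k1 k2 g, K k1 -> K k2 -> f (k1 * g * k2)%g = f g].

(* The values of [tau] outside C(L//K) are irrelevant. *)
Record is_star_rep K (V : hilbert R) (tau : (L -> R[i]) -> {linear V -> V}) :
    Prop := IsStarRep {
  (* continuous = bounded, for a linear map *)
  star_rep_bounded : forall f, hecke K f -> continuous (tau f);
  star_rep_linear : forall (a : R[i]) f1 f2, hecke K f1 -> hecke K f2 ->
    forall v, tau (fun g => a * f1 g + f2 g) v = a *: tau f1 v + tau f2 v;
  star_rep_mul : forall f1 f2, hecke K f1 -> hecke K f2 ->
    forall v, tau (convolution f1 f2) v = tau f1 (tau f2 v);
  star_rep_star : forall f, hecke K f ->
    forall v w, hdot V (tau (involution f) v) w = hdot V v (tau f w)
}.

(* [Res_{L//K}(rho)] always has this property, because C(L//K) acts on [H^K]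
   with an approximate unit, while the zero representation on [V != 0] lacks
   it. *)
Definition nondegenerate_rep K (V : hilbert R)
    (tau : (L -> R[i]) -> {linear V -> V}) : Prop :=
  forall v, (forall f, hecke K f -> tau f v = 0) -> v = 0.

End algebra.

Section unitary_representations.
Variables (R : realType) (L : topGroupType) (lambda : probability (borel L) R).
Variable (H : hilbert R).
Implicit Types (rho : L -> {linear H -> H}) (K : set L).

Record is_unitary_rep rho : Prop := IsUnitaryRep {
  unitary_rep1 : forall v, rho 1%g v = v;
  unitary_repM : forall g h v, rho (g * h)%g v = rho g (rho h v);
  unitary_rep_dot : forall g v w, hdot H (rho g v) (rho g w) = hdot H v w;
  unitary_rep_continuous : forall v, continuous (fun g => rho g v)
}.

Definition fixed_vectors rho K : set H :=
  [set v | forall k, K k -> rho k v = v].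

Definition linear_span (S : set H) : set H :=
  [set x | exists n (c : 'I_n -> R[i]) (s : 'I_n -> H),
     (forall i, S (s i)) /\ x = \sum_(i < n) c i *: s i].

Definition cyclic_fixed_vectors rho K : Prop :=
  dense (linear_span
    [set rho g eta | g in [set: L] & eta in fixed_vectors rho K]).

(* [rho(f) v], as a weak integral: the vector [u] with
   [<u, w> = \int f(g) <rho(g) v, w> dlambda(g)] for all [w]. *)
Definition is_int_rep rho (f : L -> R[i]) (v u : H) : Prop :=
  forall w, hdot H u w = cintegral lambda (fun g => f g * hdot H (rho g v) w).

Definition int_rep rho (f : L -> R[i]) (v : H) : H :=
  get (is_int_rep rho f v).

Lemma int_repE rho f v u : is_int_rep rho f v u -> int_rep rho f v = u.
Proof.
move=> uP; have iP : is_int_rep rho f v (int_rep rho f v).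
  exact: (getPex (ex_intro _ u uP)).
apply/eqP; rewrite -subr_eq0 -(dnorm_eq0 (hdot H)).
by rewrite linearBl /= iP uP subrr.
Qed.

End unitary_representations.

(* [tau] is equivalent to [f |-> rho(f)|_{H^K}] through a unitary operator
   from [V] onto [H^K]. *)
Definition equiv_Res (R : realType) (L : topGroupType)
    (lambda : probability (borel L) R) (K : set L) (V H : hilbert R)
    (tau : (L -> R[i]) -> {linear V -> V}) (rho : L -> {linear H -> H}) :
    Prop :=
  exists U : {linear V -> H},
    [/\ forall v w, hdot H (U v) (U w) = hdot V v w,
        range U = fixed_vectors rho K
      & forall f, hecke K f ->
          forall v, U (tau f v) = int_rep lambda rho f (U v)].

(* Main.v *)
Require Import Defs.
From HB Require Import structures.
From mathcomp Require Import all_boot all_order all_algebra.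
From mathcomp Require Import complex.
From mathcomp Require Import all_classical all_reals all_analysis.
From mathcomp Require Import measurable_realfun.
From mathcomp Require Import ring lra.
Import Order.TTheory GRing.Theory Num.Theory.
Import numFieldNormedType.Exports.
Set Implicit Arguments.
Unset Strict Implicit.
Unset Printing Implicit Defensive.
Local Open Scope classical_set_scope.
Local Open Scope complex_scope.
Local Open Scope ring_scope.

(** Let [H] be the space of [rho] to be found and [V] its subspace of fixed
    vectors.  As [V] is cyclic, [H] is spanned by the vectors [rho(f) v] with [v] in
    [V] and [f] a continuous function, which may be taken right invariant under [K].
    Their inner products are forced:
      [<rho(f) v, rho(g) w> = <rho(g^* f) v, w> = <tau(g^* f) v, w>],
    because [g^* f] is bi-invariant.  Conversely [H] is defined as the Hilbert space
    generated by symbols [rho(f) v] with these inner products, on which [L] acts by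
    translating [f].  It is realized as a reproducing kernel space
    ([kernel_hilbert]).

    The point of the proof is that these inner products are positive, that is, that
    the operator [T] on [V^n] with matrix [tau(f_j^* f_i)] is positive
    ([matrix_positivity]).  This is not formal, since the [f_i] are not in the
    algebra.  It is enough to invert [T + eps] for [eps > 0], by the lemma on
    numerical ranges ([numerical_range_ge]).  The inverse can be written down once
    the equations [d w_i + eps w_i = f_i] are solved in continuous functions, where
    [d] is the sum of the [f_i f_i^*]; and they can be solved because convolution
    with [d] is a positive operator on L2 which maps L2 to continuous functions
    ([resolvent]).  The same argument with [- f^* f] in place of [f^* f] gives
    [<tau(f^* f) v, v> <= |f|^2 |v|^2] for the L2 norm ([tau_inner_le]).  Hence
    [rho(f) v] depends continuously on [f], which makes [rho] strongly continuous
    and [H] separable ([induction_separable]).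

    It remains to recover [tau] ([induced_representation]).  As [tau] is
    nondegenerate, [tau(f) v |-> rho(f) v] extends to an isometry [U] of [V] into the
    fixed vectors of [H], which intertwines [tau] with [rho].  It is onto because a
    fixed vector is the limit of its averages against bi-invariant functions
    concentrated where [rho] hardly moves it.  Fixed vectors are cyclic because
    [rho(f) tau(h) v = rho(f) rho(h) v] is an average of translates of the fixed
    vector [rho(h) v]. *)

(** * Complex numbers and real-valued norms *)

Section complex_numbers.
Variable R : realType.
Local Notation C := R[i].
Implicit Types z w : C.

Lemma leC_Re z w : z <= w -> complex.Re z <= complex.Re w.
Proof. by rewrite lecE => /andP[]. Qed.

Lemma leC_real (x y : R) : (x%:C <= y%:C) = (x <= y).
Proof. exact: lecR. Qed.

Lemma ReD z w : complex.Re (z + w) = complex.Re z + complex.Re w.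
Proof. by case: z w => ? ? []. Qed.
Lemma ImD z w : complex.Im (z + w) = complex.Im z + complex.Im w.
Proof. by case: z w => ? ? []. Qed.
Lemma ReN z : complex.Re (- z) = - complex.Re z.
Proof. by case: z. Qed.
Lemma ImN z : complex.Im (- z) = - complex.Im z.
Proof. by case: z. Qed.
Lemma ReM z w : complex.Re (z * w) =
  complex.Re z * complex.Re w - complex.Im z * complex.Im w.
Proof. by case: z w => ? ? []. Qed.
Lemma ImM z w : complex.Im (z * w) =
  complex.Re z * complex.Im w + complex.Im z * complex.Re w.
Proof. by case: z w => ? ? []. Qed.
Lemma ReZ (x : R) z : complex.Re (x%:C * z) = x * complex.Re z.
Proof. by rewrite ReM /= mul0r subr0. Qed.
Lemma Re_conj z : complex.Re (Num.conj z) = complex.Re z.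
Proof. by case: z. Qed.
Lemma Im_conj z : complex.Im (Num.conj z) = - complex.Im z.
Proof. by case: z. Qed.
Lemma conjC_realc (x : R) : Num.conj x%:C = x%:C.
Proof. by apply/eqP; rewrite eq_complex /= oppr0 !eqxx. Qed.
Lemma complexP z w :
  complex.Re z = complex.Re w -> complex.Im z = complex.Im w -> z = w.
Proof. by case: z w => ? ? [? ?] /= -> ->. Qed.
Lemma Re_sum I (r : seq I) (F : I -> C) :
  complex.Re (\sum_(i <- r) F i) = \sum_(i <- r) complex.Re (F i).
Proof. by elim: r => [|i r IH]; rewrite ?big_nil ?big_cons ?ReD ?IH. Qed.

Section rnorm.
Variable V : normedZmodType C.
Implicit Types x y : V.

(** The norms of complex spaces take values in [R[i]], which is only partially
    ordered; all estimates are carried out on this real-valued copy. *)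
Definition rnorm x : R := complex.Re `|x|.

Lemma rnormE x : `|x| = (rnorm x)%:C.
Proof.
apply: complexP => //=; apply/eqP.
by have := normr_ge0 x; rewrite lecE /= => /andP[].
Qed.
Lemma rnorm_ge0 x : 0 <= rnorm x.
Proof. by rewrite -ler0c -rnormE normr_ge0. Qed.
Lemma rnormD x y : rnorm (x + y) <= rnorm x + rnorm y.
Proof. by have := ler_normD x y; rewrite !rnormE -rmorphD /= leC_real. Qed.
Lemma rnormN x : rnorm (- x) = rnorm x.
Proof. by rewrite /rnorm normrN. Qed.
Lemma rnormB x y : rnorm (x - y) = rnorm (y - x).
Proof. by rewrite -rnormN opprB. Qed.
Lemma rnorm0 : rnorm 0 = 0.
Proof. by rewrite /rnorm normr0. Qed.
Lemma rnorm_eq0 x : rnorm x <= 0 -> x = 0.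
Proof.
move=> x0; apply: normr0_eq0; rewrite rnormE.
by have -> : rnorm x = 0 by apply/eqP; rewrite eq_le x0 rnorm_ge0.
Qed.
Lemma rnorm_distD y x (z : V) : rnorm (x - z) <= rnorm (x - y) + rnorm (y - z).
Proof. by rewrite -(addrNK y x) -addrA (le_trans (rnormD _ _))// addrNK. Qed.
Lemma rnorm_leD x y : rnorm x <= rnorm y + rnorm (x - y).
Proof. by rewrite addrC (le_trans _ (rnormD _ _))// subrK. Qed.
Lemma rnorm_sum I (r : seq I) (F : I -> V) :
  rnorm (\sum_(i <- r) F i) <= \sum_(i <- r) rnorm (F i).
Proof.
elim/big_rec2: _ => [|i y x _ h]; first by rewrite rnorm0.
by rewrite (le_trans (rnormD _ _))// lerD2l.
Qed.

End rnorm.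

Lemma rnormM z w : rnorm (z * w) = rnorm z * rnorm w.
Proof.
by apply: complexI; rewrite rmorphM /= -!rnormE normrM.
Qed.
Lemma rnorm_conj z : rnorm (Num.conj z) = rnorm z.
Proof. by rewrite /rnorm norm_conjC. Qed.
Lemma rnorm1 : rnorm (1 : C) = 1.
Proof. by rewrite /rnorm normr1. Qed.
Lemma rnorm_sqr z : rnorm z ^+ 2 = complex.Re z ^+ 2 + complex.Im z ^+ 2.
Proof. by apply: complexI; rewrite rmorphXn /= -rnormE add_Re2_Im2. Qed.
Lemma rnorm_mulJ z : z * Num.conj z = (rnorm z ^+ 2)%:C.
Proof. by rewrite -normCK rnormE rmorphXn. Qed.
Lemma rnorm_real (x : R) : rnorm x%:C = `|x|.
Proof.
apply/eqP; rewrite -(@eqrXn2 _ 2)// ?rnorm_ge0//.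
by rewrite rnorm_sqr /= expr0n addr0 real_normK// num_real.
Qed.
Lemma rnorm_Re z : `|complex.Re z| <= rnorm z.
Proof.
rewrite -(@ler_pXn2r _ 2)// ?nnegrE ?rnorm_ge0// real_normK ?num_real//.
by rewrite rnorm_sqr lerDl sqr_ge0.
Qed.
Lemma rnorm_Im z : `|complex.Im z| <= rnorm z.
Proof.
rewrite -(@ler_pXn2r _ 2)// ?nnegrE ?rnorm_ge0// real_normK ?num_real//.
by rewrite rnorm_sqr lerDr sqr_ge0.
Qed.
Lemma rnorm_le_ReIm z : rnorm z <= `|complex.Re z| + `|complex.Im z|.
Proof.
rewrite -(@ler_pXn2r _ 2)// ?nnegrE ?rnorm_ge0 ?addr_ge0//.
rewrite rnorm_sqr sqrrD !real_normK ?num_real//.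
have : 0 <= `|complex.Re z| * `|complex.Im z| by rewrite mulr_ge0.
by lra.
Qed.
Lemma ge0_Re z : 0 <= z -> z = (complex.Re z)%:C.
Proof. by rewrite lecE => /andP[/eqP z0 _]; apply: complexP. Qed.
Lemma rnorm_ge0E z : 0 <= z -> rnorm z = complex.Re z.
Proof. by move=> z0; rewrite /rnorm ger0_norm. Qed.

(** Completeness in the form used for all limits of complex numbers: the [z j] are
    approximations with known error bounds [r j], and the limit inherits these
    bounds.  No sequence has to be extracted.  The coordinates of the limit are
    the suprema of the left ends of the intervals that the discs project to. *)
Lemma disc_completeness J (z : J -> C) (r : J -> R) :
  (forall i j, rnorm (z i - z j) <= r i + r j) ->
  (forall e, 0 < e -> exists j, r j <= e) ->
  exists z0, forall j, rnorm (z0 - z j) <= r j.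
Proof.
move=> zr r0.
have [j0 _] := r0 1 ltr01.
have lim (p : C -> R) : (forall z w, p (z - w) = p z - p w) ->
    (forall z, `|p z| <= rnorm z) ->
    exists x, forall j, `|x - p (z j)| <= r j.
  move=> pB ple; pose S := [set p (z j) - r j | j in [set: J]].
  have zle i j : p (z i) - r i <= p (z j) + r j.
    rewrite lerBlDr -addrA [r j + _]addrC -lerBlDl -pB.
    exact: (le_trans (ler_norm _) (le_trans (ple _) (zr _ _))).
  have Ssup : has_sup S.
    split; first by exists (p (z j0) - r j0); exists j0.
    by exists (p (z j0) + r j0) => _ [i _ <-].
  exists (sup S) => j; rewrite ler_distl; apply/andP; split.
    by apply: sup_upper_bound => //; exists j.
  by apply: ge_sup => [|_ [i _ <-] //]; case: Ssup.
have [x xP] := lim (@complex.Re R) (fun z w => etrans (ReD _ _) (congr1 _ (ReN _)))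
  rnorm_Re.
have [y yP] := lim (@complex.Im R) (fun z w => etrans (ImD _ _) (congr1 _ (ImN _)))
  rnorm_Im.
have z0P j : rnorm (x +i* y - z j) <= 2 * r j.
  rewrite (le_trans (rnorm_le_ReIm _))// mulr_natl mulr2n.
  by rewrite lerD// ?ReD ?ReN ?ImD ?ImN //=.
exists (x +i* y) => j; apply/ler_addgt0Pr => e e0.
have [|i ri] := r0 (e / 3); first by rewrite divr_gt0.
have := rnorm_distD (z i) (x +i* y) (z j); have := z0P i; have := zr i j.
by lra.
Qed.

(** The discriminant argument behind every Cauchy-Schwarz inequality below. *)
Lemma discriminant (a b : R) z : 0 <= b ->
  (forall c : C, 0 <= a + 2 * complex.Re (c * z) + rnorm c ^+ 2 * b) ->
  rnorm z ^+ 2 <= a * b.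
Proof.
move=> b0 h.
have hx (x : R) : 0 <= a - 2 * x * rnorm z ^+ 2 + x ^+ 2 * rnorm z ^+ 2 * b.
  have := h (- x%:C * Num.conj z).
  have -> : - x%:C * Num.conj z * z = (- (x * rnorm z ^+ 2))%:C.
    by rewrite -mulrA [X in - x%:C * X]mulrC rnorm_mulJ mulNr -rmorphM rmorphN.
  rewrite rnormM rnormN rnorm_conj rnorm_real exprMn real_normK ?num_real//=.
  by lra.
have z2 : 0 <= rnorm z ^+ 2 by rewrite sqr_ge0.
case: (ltrgtP b 0) => [|b0'|b00]; first by lra.
  have := hx b^-1.
  have -> : a - 2 * b^-1 * rnorm z ^+ 2 + b^-1 ^+ 2 * rnorm z ^+ 2 * b =
      (a * b - rnorm z ^+ 2) / b by field; rewrite gt_eqF.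
  by rewrite pmulr_lge0 ?invr_gt0// subr_ge0.
rewrite b00 mulr0; have := hx 0; have := hx ((a + 1) / (2 * rnorm z ^+ 2)).
rewrite b00 !mulr0 !addr0.
have [->//|z20] := eqVneq (rnorm z ^+ 2) 0.
have z0 : rnorm z != 0 by move: z20; rewrite sqrf_eq0.
have -> : 2 * ((a + 1) / (2 * rnorm z ^+ 2)) * rnorm z ^+ 2 = a + 1 by field.
by lra.
Qed.

End complex_numbers.

(** * Positive definite kernels *)

Section formal_combinations.
Variables (R : realType) (X : Type).
Local Notation C := R[i].
Implicit Types (s t : seq (C * X)) (a : C).

(** Lists of coefficients and points stand for formal linear combinations of
    points of [X]. *)
Definition comb (V : lmodType C) (f : X -> V) s : V := \sum_(p <- s) p.1 *: f p.2.

Definition scalec a s : seq (C * X) := [seq (a * p.1, p.2) | p <- s].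

Lemma comb_cat (V : lmodType C) (f : X -> V) s t :
  comb f (s ++ t) = comb f s + comb f t.
Proof. by rewrite /comb big_cat. Qed.

Lemma comb_scale (V : lmodType C) (f : X -> V) a s :
  comb f (scalec a s) = a *: comb f s.
Proof.
by rewrite /comb big_map scaler_sumr; apply: eq_bigr => p _; rewrite scalerA.
Qed.

Lemma comb1 (V : lmodType C) (f : X -> V) a x : comb f [:: (a, x)] = a *: f x.
Proof. by rewrite /comb big_seq1. Qed.

End formal_combinations.

Record psd_kernel (R : realType) (X : Type) := PsdKernel {
  kernel_fun :> X -> X -> R[i];
  kernel_herm : forall x y, kernel_fun x y = Num.conj (kernel_fun y x);
  kernel_psd : forall s : seq (R[i] * X),
    0 <= \sum_(p <- s) \sum_(q <- s)
           p.1 * Num.conj q.1 * kernel_fun p.2 q.2 }.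

Section gram.
Variables (R : realType) (X : Type) (K : psd_kernel R X).
Local Notation C := R[i].
Implicit Types (s t u : seq (C * X)) (a : C) (f : X -> C^o).

Definition gram s t : C :=
  \sum_(p <- s) \sum_(q <- t) p.1 * Num.conj q.1 * K p.2 q.2.

Definition gnorm s : R := Num.sqrt (complex.Re (gram s s)).

Lemma gramDl s s' t : gram (s ++ s') t = gram s t + gram s' t.
Proof. by rewrite /gram big_cat. Qed.

Lemma gramZl a s t : gram (scalec a s) t = a * gram s t.
Proof.
rewrite /gram big_map mulr_sumr; apply: eq_bigr => p _.
by rewrite mulr_sumr; apply: eq_bigr => q _; rewrite !mulrA.
Qed.

Lemma gramC s t : gram s t = Num.conj (gram t s).
Proof.
rewrite /gram rmorph_sum exchange_big /=; apply: eq_bigr => q _.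
rewrite rmorph_sum /=; apply: eq_bigr => p _.
by rewrite !rmorphM /= conjCK -kernel_herm [_ * p.1]mulrC.
Qed.

Lemma gramDr s t t' : gram s (t ++ t') = gram s t + gram s t'.
Proof. by rewrite gramC gramDl rmorphD /= -!gramC. Qed.

Lemma gramZr a s t : gram s (scalec a t) = Num.conj a * gram s t.
Proof. by rewrite gramC gramZl rmorphM /= -gramC. Qed.

Lemma gram_ge0 s : 0 <= gram s s.
Proof. exact: kernel_psd. Qed.

Lemma gnorm_ge0 s : 0 <= gnorm s.
Proof. exact: sqrtr_ge0. Qed.

Lemma gnorm_sqr s : gnorm s ^+ 2 = complex.Re (gram s s).
Proof. by rewrite sqr_sqrtr// -ler0c -ge0_Re ?gram_ge0. Qed.

Lemma gramDD s t : complex.Re (gram (s ++ t) (s ++ t)) =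
  complex.Re (gram s s) + 2 * complex.Re (gram s t) + complex.Re (gram t t).
Proof.
rewrite gramDl !gramDr !ReD (gramC t s) Re_conj; lra.
Qed.

Lemma gram_CS s t : rnorm (gram s t) <= gnorm s * gnorm t.
Proof.
rewrite -(@ler_pXn2r _ 2)// ?nnegrE ?rnorm_ge0 ?mulr_ge0 ?gnorm_ge0//.
rewrite exprMn !gnorm_sqr; apply: discriminant => [|c].
  by rewrite -ler0c -ge0_Re ?gram_ge0.
have := gram_ge0 (s ++ scalec (Num.conj c) t); rewrite lecE => /andP[_] /=.
rewrite gramDD gramZl !gramZr conjCK !mulrA [_^* * _]mulrC rnorm_mulJ.
by rewrite [X in _ + X]ReM /= mul0r subr0.
Qed.

(** If [f x] is the inner product of a vector with the vector attached to [x],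
    this is the inner product of the former with the combination [t] of the
    latter, hence conjugate-linear in [t]. *)
Definition pairing f t : C := \sum_(q <- t) Num.conj q.1 * f q.2.

Definition functional_bound f (M : R) :=
  forall t, rnorm (pairing f t) <= M * gnorm t.

Definition section s : X -> C^o := fun x => \sum_(p <- s) p.1 * K p.2 x.

Lemma pairing_section s t : pairing (section s) t = gram s t.
Proof.
rewrite /gram /pairing exchange_big /=; apply: eq_bigr => q _.
rewrite mulr_sumr; apply: eq_bigr => p _.
by rewrite mulrA [_^* * _]mulrC.
Qed.

Lemma pairingD f g t : pairing (f + g) t = pairing f t + pairing g t.
Proof.
by rewrite /pairing -big_split; apply: eq_bigr => q _; rewrite mulrDr.
Qed.
Lemma pairingZ a f t : pairing (a *: f) t = a * pairing f t.
Proof.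
by rewrite /pairing mulr_sumr; apply: eq_bigr => q _; rewrite mulrCA.
Qed.
Lemma pairingN f t : pairing (- f) t = - pairing f t.
Proof. by rewrite -scaleN1r pairingZ mulN1r. Qed.
Lemma pairing0 t : pairing 0 t = 0.
Proof. by rewrite /pairing big1 // => q _; rewrite mulr0. Qed.
Lemma pairing_cat f s t : pairing f (s ++ t) = pairing f s + pairing f t.
Proof. by rewrite /pairing big_cat. Qed.
Lemma pairing_scale a f t : pairing f (scalec a t) = Num.conj a * pairing f t.
Proof.
rewrite /pairing big_map mulr_sumr; apply: eq_bigr => q _ /=.
by rewrite rmorphM mulrA.
Qed.

Lemma functional_boundD f g M N :
  functional_bound f M -> functional_bound g N -> functional_bound (f + g) (M + N).
Proof.
move=> fM gN t; rewrite pairingD mulrDl (le_trans (rnormD _ _))//.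
by rewrite lerD.
Qed.
Lemma functional_boundZ a f M :
  functional_bound f M -> functional_bound (a *: f) (rnorm a * M).
Proof.
by move=> fM t; rewrite pairingZ rnormM -mulrA ler_wpM2l ?rnorm_ge0.
Qed.
Lemma functional_bound_section s : functional_bound (section s) (gnorm s).
Proof. by move=> t; rewrite pairing_section gram_CS. Qed.
Lemma functional_bound_le f M N :
  M <= N -> functional_bound f M -> functional_bound f N.
Proof.
by move=> MN fM t; rewrite (le_trans (fM t))// ler_wpM2r ?gnorm_ge0.
Qed.
Lemma functional_bound0 : functional_bound 0 0.
Proof. by move=> t; rewrite pairing0 rnorm0 mul0r. Qed.

Lemma section_cat s t : section (s ++ t) = section s + section t.
Proof. by apply/funext => x; rewrite /section big_cat. Qed.
Lemma section_scale a s : section (scalec a s) = a *: section s.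
Proof.
apply/funext => x; rewrite /section big_map /=.
rewrite -[RHS]/(a * _) mulr_sumr.
by apply: eq_bigr => p _; rewrite mulrA.
Qed.

(** The completion of the formal combinations for the semi-norm [gnorm],
    realized inside the functions on [X]: limits of sections of the kernel for
    the norm of functionals on combinations.  Elements of the completion are
    thus functions, and null vectors disappear without a quotient. *)
Definition rkhs_pred : {pred X -> C^o} :=
  fun f => `[< forall e, 0 < e -> exists s, functional_bound (f - section s) e >].

Lemma rkhs_predP f : reflect
  (forall e, 0 < e -> exists s, functional_bound (f - section s) e)
  (f \in rkhs_pred).
Proof. exact: asboolP. Qed.

Lemma rkhs_submod_closed : submod_closed rkhs_pred.
Proof.
split.
  apply/rkhs_predP => e e0; exists [::] => t.
  rewrite pairingD pairing0 pairingN pairing_section /gram big_nil subrr rnorm0.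
  by rewrite mulr_ge0 ?gnorm_ge0// ltW.
move=> a f g /rkhs_predP hf /rkhs_predP hg; apply/rkhs_predP => e e0.
have [|s sP] := hf (e / 2 / (rnorm a + 1)).
  by rewrite !divr_gt0// ltr_pwDr// rnorm_ge0.
have [|t tP] := hg (e / 2); first by rewrite divr_gt0.
exists (scalec a s ++ t).
rewrite section_cat section_scale opprD addrACA -scalerBr.
apply: (functional_bound_le _ (functional_boundD (functional_boundZ a sP) tP)).
rewrite [leRHS](splitr e) lerD2r mulrCA -[leRHS]mulr1 ler_wpM2l//.
  by rewrite divr_ge0// ltW.
by rewrite ler_pdivrMr ?mul1r ?lerDl// ltr_pwDr// rnorm_ge0.
Qed.
HB.instance Definition _ :=
  GRing.isSubmodClosed.Build C (X -> C^o) rkhs_pred rkhs_submod_closed.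

Record rkhs := Rkhs { rkhs_fun :> X -> C^o; rkhs_funP : rkhs_fun \in rkhs_pred }.
HB.instance Definition _ := [isSub for rkhs_fun].
HB.instance Definition _ := [Choice of rkhs by <:].
HB.instance Definition _ := [SubChoice_isSubLmodule of rkhs by <:].

End gram.

Lemma ler_small (R : realType) (x y : R) (c : R) :
  (forall e, 0 < e -> x <= y + c * e) -> x <= y.
Proof.
move=> h; apply/ler_addgt0Pr => e e0.
have c0 : 0 < `|c| + 1 by rewrite ltr_pwDr.
have := h (e / (`|c| + 1)); rewrite divr_gt0// => /(_ isT) /le_trans; apply.
rewrite lerD2l mulrCA -[leRHS]mulr1 ler_pM2l//.
by rewrite ler_pdivrMr// mul1r (le_trans (ler_norm _))// lerDl.
Qed.

(** * The reproducing kernel Hilbert space *)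

Section rkhs_dot.
Variables (R : realType) (X : Type) (K : psd_kernel R X).
Local Notation C := R[i].
Implicit Types (s t u : seq (C * X)) (a : C) (f g h : rkhs K) (x : X).

Lemma gnorm_le_bound u (M : R) : 0 <= M ->
  functional_bound K (section K u) M -> gnorm K u <= M.
Proof.
move=> M0 /(_ u); rewrite pairing_section rnorm_ge0E ?gram_ge0// -gnorm_sqr.
have [->//|u0] := eqVneq (gnorm K u) 0.
by rewrite expr2 ler_pM2r// lt_def u0 gnorm_ge0.
Qed.

Lemma gnorm_near (f : X -> C^o) t (M d : R) : 0 <= M -> 0 <= d ->
  functional_bound K f M -> functional_bound K (f - section K t) d ->
  gnorm K t <= M + d.
Proof.
move=> M0 d0 fM ftd; apply: gnorm_le_bound; first by rewrite addr_ge0.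
have -> : section K t = f + -1 *: (f - section K t).
  by rewrite scaleN1r opprB addrC subrK.
apply: functional_boundD => //.
by have := functional_boundZ (-1) ftd; rewrite rnormN rnorm1 mul1r.
Qed.

Lemma rkhs_bounded f : exists2 M, 0 < M & functional_bound K f M.
Proof.
have /rkhs_predP /(_ _ ltr01) [s sP] := rkhs_funP f.
exists (1 + gnorm K s); first by rewrite ltr_pwDl// gnorm_ge0.
rewrite -(subrK (section K s) (f : X -> C^o)).
exact: functional_boundD sP (functional_bound_section _ _).
Qed.

Lemma rkhs_approx f e : 0 < e ->
  exists s, functional_bound K ((f : X -> C^o) - section K s) e.
Proof. by have /rkhs_predP := rkhs_funP f; apply. Qed.

Let dot_spec f g (z : C) (M : R) := forall t d, 0 <= d ->
  functional_bound K ((g : X -> C^o) - section K t) d ->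
  rnorm (z - pairing f t) <= M * d.

(** The limit of [pairing f t] as [section K t] tends to [g]: as [f] is bounded
    on combinations, its values at combinations close to [g] are close to each
    other. *)
Definition rdot f g : C := xget 0 [set z | forall M, 0 <= M ->
  functional_bound K f M -> dot_spec f g z M].

Lemma rdotP f g M : 0 <= M -> functional_bound K f M -> dot_spec f g (rdot f g) M.
Proof.
suff : exists z, forall M, 0 <= M -> functional_bound K f M -> dot_spec f g z M.
  by move=> /(xgetPex 0); apply.
clear M.
pose J := {j : R * seq (C * X) * R | [/\ 0 <= j.1.1, 0 <= j.2,
  functional_bound K f j.1.1 &
  functional_bound K ((g : X -> C^o) - section K j.1.2) j.2]}.
have [||z zP] := @disc_completeness R J (fun j => pairing f (sval j).1.2)
   (fun j => (sval j).1.1 * (sval j).2).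
- move=> [[[M1 t1] d1] /= [M10 d10 fM1 gt1]] [[[M2 t2] d2] /= [M20 d20 fM2 gt2]].
  have nt : gnorm K (t1 ++ scalec (-1) t2) <= d1 + d2.
    apply: gnorm_le_bound; first by rewrite addr_ge0.
    rewrite section_cat section_scale scaleN1r.
    have -> : section K t1 - section K t2 =
        -1 *: ((g : X -> C^o) - section K t1) + ((g : X -> C^o) - section K t2).
      by rewrite scaleN1r opprB addrA subrK.
    apply: functional_boundD => //.
    have := functional_boundZ (-1) gt1.
    by rewrite rnormN rnorm1 mul1r.
  have -> : pairing f t1 - pairing f t2 = pairing f (t1 ++ scalec (-1) t2).
    by rewrite pairing_cat pairing_scale rmorphN rmorph1 mulN1r.
  have := fM1 (t1 ++ scalec (-1) t2); have := fM2 (t1 ++ scalec (-1) t2).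
  case: (leP M1 M2) => [M12|/ltW M21].
    have := ler_wpM2l M10 nt; have := ler_wpM2r d20 M12; lra.
  have := ler_wpM2l M20 nt; have := ler_wpM2r d10 M21; lra.
- move=> e e0; have [M M0 fM] := rkhs_bounded f.
  have [|t tP] := @rkhs_approx g (e / M); first by rewrite divr_gt0.
  have p : [/\ 0 <= M, 0 <= e / M, functional_bound K f M &
      functional_bound K ((g : X -> C^o) - section K t) (e / M)].
    by split=> //; rewrite ?divr_ge0// ltW.
  exists (exist _ (M, t, e / M) p) => /=.
  by rewrite mulrC divfK// gt_eqF.
- exists z => M M0 fM t d d0 td.
  have p : [/\ 0 <= M, 0 <= d, functional_bound K f M &
      functional_bound K ((g : X -> C^o) - section K t) d] by split.
  exact: (zP (exist _ (M, t, d) p)).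
Qed.

Lemma rdot_unique f g z M : dot_spec f g z M -> z = rdot f g.
Proof.
move=> zM; apply/eqP; rewrite -subr_eq0; apply/eqP/rnorm_eq0.
have [N N0 fN] := rkhs_bounded f.
apply: (@ler_small _ _ _ (M + N)) => e e0; rewrite add0r.
have [t te] := rkhs_approx g e0.
have := zM t e (ltW e0) te; have := rdotP (ltW N0) fN (ltW e0) te.
have := rnorm_distD (pairing f t) z (rdot f g).
by rewrite [rnorm (pairing f t - _)]rnormB; lra.
Qed.

Lemma rdot_linear a f f' g : rdot (a *: f + f') g = a * rdot f g + rdot f' g.
Proof.
have [M M0 fM] := rkhs_bounded f; have [M' M0' fM'] := rkhs_bounded f'.
symmetry; apply: (@rdot_unique _ _ _ (rnorm a * M + M')) => t d d0 td.
have -> : pairing (a *: f + f' : rkhs K) t = a * pairing f t + pairing f' t.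
  by rewrite -pairingZ -pairingD.
rewrite opprD addrACA -mulrBr mulrDl.
rewrite (le_trans (rnormD _ _))// rnormM -mulrA lerD ?ler_wpM2l ?rnorm_ge0//.
  exact: (rdotP (ltW M0) fM).
exact: (rdotP (ltW M0') fM').
Qed.

Lemma rdotC f g : rdot f g = Num.conj (rdot g f).
Proof.
have [M M0 fM] := rkhs_bounded f; have [N N0 gN] := rkhs_bounded g.
apply/eqP; rewrite -subr_eq0; apply/eqP/rnorm_eq0.
apply/ler_addgt0Pr => e0 e00; rewrite add0r.
pose e := Num.min 1 (e0 / (2 * M + 2 * N + 2)).
have D0 : 0 < 2 * M + 2 * N + 2 by lra.
have e_gt0 : 0 < e by rewrite lt_min ltr01 divr_gt0.
have e1 : e <= 1 by rewrite ge_min lexx.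
have eE : e * (2 * M + 2 * N + 2) <= e0.
  by rewrite -ler_pdivlMr// ge_min lexx orbT.
have [s se] := rkhs_approx f e_gt0; have [t te] := rkhs_approx g e_gt0.
have sM : gnorm K s <= M + e := gnorm_near (ltW M0) (ltW e_gt0) fM se.
have tN : gnorm K t <= N + e := gnorm_near (ltW N0) (ltW e_gt0) gN te.
have h1 := rdotP (ltW M0) fM (ltW e_gt0) te.
have h2 := rdotP (ltW N0) gN (ltW e_gt0) se.
have h3 := se t; rewrite pairingD pairingN pairing_section in h3.
have h4 := te s; rewrite pairingD pairingN pairing_section in h4.
have : rnorm (rdot f g - gram K s t) <= M * e + e * gnorm K t.
  by rewrite (le_trans (rnorm_distD (pairing f t) _ _))// lerD.
have : rnorm (gram K s t - Num.conj (rdot g f)) <= N * e + e * gnorm K s.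
  rewrite gramC -rmorphB rnorm_conj rnormB.
  by rewrite (le_trans (rnorm_distD (pairing g s) _ _))// lerD.
have := rnorm_distD (gram K s t) (rdot f g) (Num.conj (rdot g f)).
nra.
Qed.

Lemma rkhs_section_subproof s : section K s \in rkhs_pred K.
Proof.
apply/rkhs_predP => e e0; exists s; rewrite subrr.
exact: functional_bound_le (ltW e0) (functional_bound0 _).
Qed.

Definition rkhs_section s : rkhs K := Rkhs (rkhs_section_subproof s).

Lemma rdot_section f t : rdot f (rkhs_section t) = pairing f t.
Proof.
symmetry; have [M M0 fM] := rkhs_bounded f.
apply: (@rdot_unique _ _ _ M) => u d d0 ud.
have -> : pairing f t - pairing f u = pairing f (t ++ scalec (-1) u).
  by rewrite pairing_cat pairing_scale rmorphN rmorph1 mulN1r.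
rewrite (le_trans (fM _))// ler_pM2l//; apply: gnorm_le_bound => //.
by rewrite section_cat section_scale scaleN1r.
Qed.

Lemma rdot_ge0 f : 0 <= rdot f f.
Proof.
have im0 : complex.Im (rdot f f) = 0.
  by have := congr1 (@complex.Im R) (rdotC f f); rewrite Im_conj; lra.
rewrite lecE im0 eqxx /= -oppr_le0.
have [M M0 fM] := rkhs_bounded f.
apply/ler_addgt0Pr => e0 e00; rewrite add0r.
pose e := Num.min 1 (e0 / (2 * M + 1)).
have D0 : 0 < 2 * M + 1 by lra.
have e_gt0 : 0 < e by rewrite lt_min ltr01 divr_gt0.
have e1 : e <= 1 by rewrite ge_min lexx.
have eE : e * (2 * M + 1) <= e0 by rewrite -ler_pdivlMr// ge_min lexx orbT.
have [t te] := rkhs_approx f e_gt0.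
have tM : gnorm K t <= M + e := gnorm_near (ltW M0) (ltW e_gt0) fM te.
have h1 := rdotP (ltW M0) fM (ltW e_gt0) te.
have h3 := te t; rewrite pairingD pairingN pairing_section in h3.
have h : rnorm (rdot f f - gram K t t) <= M * e + e * gnorm K t.
  by rewrite (le_trans (rnorm_distD (pairing f t) _ _))// lerD.
have := le_trans (rnorm_Re _) h; rewrite ReD ReN.
have := gram_ge0 K t; rewrite lecE => /andP[_] /=.
rewrite ler_norml => ? /andP[? _]; nra.
Qed.

Definition rkhs_norm f : R := Num.sqrt (complex.Re (rdot f f)).

Lemma rkhs_norm_sqr f : rkhs_norm f ^+ 2 = complex.Re (rdot f f).
Proof. by rewrite sqr_sqrtr// -ler0c -ge0_Re ?rdot_ge0. Qed.

Lemma rkhs_norm_ge0 f : 0 <= rkhs_norm f.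
Proof. exact: sqrtr_ge0. Qed.

Lemma rdotDl f f' g : rdot (f + f') g = rdot f g + rdot f' g.
Proof. by rewrite -[f in f + _]scale1r rdot_linear mul1r. Qed.
Lemma rdot0l g : rdot 0 g = 0.
Proof. by have := rdotDl 0 0 g; rewrite addr0 => /eqP; rewrite -subr_eq subrr => /eqP. Qed.
Lemma rdotZl a f g : rdot (a *: f) g = a * rdot f g.
Proof. by rewrite -[a *: f]addr0 rdot_linear rdot0l addr0. Qed.
Lemma rdotDr f g g' : rdot f (g + g') = rdot f g + rdot f g'.
Proof. by rewrite rdotC rdotDl rmorphD /= -!rdotC. Qed.
Lemma rdotZr a f g : rdot f (a *: g) = Num.conj a * rdot f g.
Proof. by rewrite rdotC rdotZl rmorphM /= -rdotC. Qed.

Lemma rdotDD f g : complex.Re (rdot (f + g) (f + g)) =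
  complex.Re (rdot f f) + 2 * complex.Re (rdot f g) + complex.Re (rdot g g).
Proof. by rewrite rdotDl !rdotDr !ReD (rdotC g f) Re_conj; lra. Qed.

Lemma rdot_CS f g : rnorm (rdot f g) <= rkhs_norm f * rkhs_norm g.
Proof.
rewrite -(@ler_pXn2r _ 2)// ?nnegrE ?rnorm_ge0 ?mulr_ge0 ?rkhs_norm_ge0//.
rewrite exprMn !rkhs_norm_sqr; apply: discriminant => [|c].
  by rewrite -ler0c -ge0_Re ?rdot_ge0.
have := rdot_ge0 (f + Num.conj c *: g); rewrite lecE => /andP[_] /=.
rewrite rdotDD rdotZl !rdotZr conjCK !mulrA [_^* * _]mulrC rnorm_mulJ.
by rewrite [X in _ + X]ReM /= mul0r subr0.
Qed.

Lemma rkhs_normD f g : rkhs_norm (f + g) <= rkhs_norm f + rkhs_norm g.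
Proof.
rewrite -(@ler_pXn2r _ 2)// ?nnegrE ?addr_ge0 ?rkhs_norm_ge0//.
rewrite rkhs_norm_sqr rdotDD sqrrD !rkhs_norm_sqr.
have := ler_norm (complex.Re (rdot f g)).
have := rnorm_Re (rdot f g); have := rdot_CS f g; lra.
Qed.

Lemma rkhs_normZ a f : rkhs_norm (a *: f) = rnorm a * rkhs_norm f.
Proof.
apply/eqP; rewrite -(@eqrXn2 _ 2)// ?mulr_ge0 ?rnorm_ge0 ?rkhs_norm_ge0//.
rewrite exprMn !rkhs_norm_sqr rdotZl rdotZr mulrA rnorm_mulJ.
by rewrite ReM /= mul0r subr0.
Qed.

Lemma rkhs_evalE f x : f x = rdot f (rkhs_section [:: (1, x)]).
Proof. by rewrite rdot_section /pairing big_seq1 rmorph1 mul1r. Qed.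

Lemma rkhs_norm_eq0 f : rkhs_norm f = 0 -> f = 0.
Proof.
move=> f0; apply/val_inj/funext => x /=; rewrite rkhs_evalE.
by apply: rnorm_eq0; rewrite (le_trans (rdot_CS _ _))// f0 mul0r.
Qed.

Definition rkhs_cnorm f : C := (rkhs_norm f)%:C.

Lemma rkhs_cnormD f g : rkhs_cnorm (f + g) <= rkhs_cnorm f + rkhs_cnorm g.
Proof. by rewrite -rmorphD /= leC_real rkhs_normD. Qed.
Lemma rkhs_cnormZ a f : rkhs_cnorm (a *: f) = `|a| * rkhs_cnorm f.
Proof. by rewrite rnormE -rmorphM /= /rkhs_cnorm rkhs_normZ. Qed.
Lemma rkhs_cnorm_eq0 f : rkhs_cnorm f = 0 -> f = 0.
Proof. by move=> [/rkhs_norm_eq0]. Qed.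

HB.instance Definition _ := Lmodule_isNormed.Build C (rkhs K)
  rkhs_cnormD rkhs_cnormZ rkhs_cnorm_eq0.

Lemma rkhs_rnormE f : rnorm f = rkhs_norm f.
Proof. by []. Qed.

Lemma rdot_bilinear : bilinear_for *%R (Num.conj \; *%R) rdot.
Proof.
split => [g a f f'|f a g g']; first exact: rdot_linear.
by rewrite rdotDr rdotZr.
Qed.
HB.instance Definition _ := bilinear_isBilinear.Build C (rkhs K) (rkhs K) C
  *%R (Num.conj \; *%R) rdot rdot_bilinear.

Lemma rdot_hermitian f g : rdot f g = (-1) ^+ false * Num.conj (rdot g f).
Proof. by rewrite mul1r -rdotC. Qed.
HB.instance Definition _ := isHermitianSesquilinear.Build C (rkhs K) false
  Num.conj rdot rdot_hermitian.

Lemma rdot_gt0 f : f != 0 -> 0 < rdot f f.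
Proof.
move=> f0; rewrite lt_def rdot_ge0 andbT; apply: contra_neq f0 => f0.
by apply: rkhs_norm_eq0; rewrite /rkhs_norm f0 sqrtr0.
Qed.
HB.instance Definition _ := isDotProduct.Build C (rkhs K) rdot rdot_gt0.

Definition rkhs_dot : {dot rkhs K for Num.conj} := rdot.

Lemma rdot_norm f : rkhs_dot f f = `|f| ^+ 2.
Proof.
by rewrite rnormE -rmorphXn /= rkhs_rnormE rkhs_norm_sqr -ge0_Re// rdot_ge0.
Qed.

Lemma rkhs_bound f : functional_bound K f (rnorm f).
Proof.
move=> t; rewrite -rdot_section (le_trans (rdot_CS _ _))//.
rewrite ler_wpM2l ?rkhs_norm_ge0//.
by rewrite /rkhs_norm rdot_section pairing_section.
Qed.

Lemma rkhs_norm_le f M : 0 <= M -> functional_bound K f M -> rnorm f <= M.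
Proof.
move=> M0 fM; have [->//|f0] := eqVneq (rnorm f) 0.
have f_gt0 : 0 < rnorm f by rewrite lt_def f0 rnorm_ge0.
have [N N0 fN] := rkhs_bounded f.
rewrite -(ler_pM2r f_gt0) -expr2 rkhs_rnormE rkhs_norm_sqr.
apply/ler_addgt0Pr => e e0.
pose d := Num.min (rnorm f) (e / (3 * M + 1)).
have D0 : 0 < 3 * M + 1 by lra.
have d_gt0 : 0 < d by rewrite lt_min f_gt0 divr_gt0.
have dE : d * (3 * M + 1) <= e by rewrite -ler_pdivlMr// ge_min lexx orbT.
have [t te] := rkhs_approx f d_gt0.
have h1 := rdotP M0 fM (ltW d_gt0) te; have h2 := fM t.
have h0 := le_trans (ler_norm _) (rnorm_Re (rdot f f)).
have h3 := rnorm_leD (rdot f f) (pairing f t).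
have h4 : gnorm K t <= rkhs_norm f + d :=
  gnorm_near (rkhs_norm_ge0 f) (ltW d_gt0) (@rkhs_bound f) te.
have := ler_wpM2l M0 h4; lra.
Qed.

Lemma rkhs_approx_section f e : 0 < e -> exists s, rnorm (f - rkhs_section s) <= e.
Proof.
move=> e0; have [s se] := rkhs_approx f e0; exists s.
by apply: rkhs_norm_le; rewrite ?ltW.
Qed.

End rkhs_dot.

Section topology_of_complex_norms.
Variable R : realType.
Local Notation C := R[i].

Lemma gt0_Re (e : C) : 0 < e -> 0 < complex.Re e /\ e = (complex.Re e)%:C.
Proof.
move=> e0; have eE := ge0_Re (ltW e0); split=> //.
by rewrite -ltcR -eE.
Qed.

Lemma rnormZ (V : normedModType C) (a : C) (v : V) : rnorm (a *: v) = rnorm a * rnorm v.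
Proof. by apply: complexI; rewrite rmorphM /= -!rnormE normrZ. Qed.

Lemma cvg_rnormP (V : normedModType C) (F : set_system V) {FF : Filter F} (y : V) :
  F --> y <-> forall e : R, 0 < e -> \forall x \near F, rnorm (y - x) < e.
Proof.
split=> [/fcvgrPdist_lt h e e0|h].
  by apply: filterS (h e%:C _) => [x|]; rewrite ?ltcR// rnormE ltcR.
apply/fcvgrPdist_lt => e /gt0_Re[e0 ->].
by apply: filterS (h _ e0) => x; rewrite rnormE ltcR.
Qed.

Lemma cvgf_rnormP (V : normedModType C) T (F : set_system T) {FF : Filter F}
    (f : T -> V) (y : V) :
  f @ F --> y <-> forall e : R, 0 < e -> \forall x \near F, rnorm (y - f x) < e.
Proof. exact: cvg_rnormP. Qed.

Lemma dense_rnormP (V : normedModType C) (S : set V) :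
  dense S <-> forall x (e : R), 0 < e -> exists2 s, S s & rnorm (x - s) < e.
Proof.
split=> [dS x e e0|h O [x Ox] Oo].
  have [|y [By Sy]] := dS (ball x e%:C) _ (ball_open _ _).
    by exists x; apply: ballxx; rewrite ltcR.
  by exists y => //; move: By; rewrite -ball_normE /ball_ /= rnormE ltcR.
have /nbhs_ballP[e /gt0_Re[e0 eE] eO] := open_nbhs_nbhs (conj Oo Ox).
have [s Ss se] := h x _ e0; exists s; split => //; apply: eO.
by rewrite -ball_normE /ball_ /= eE rnormE ltcR.
Qed.

End topology_of_complex_norms.

Section rkhs_complete.
Variables (R : realType) (X : Type) (K : psd_kernel R X).
Local Notation C := R[i].

(** A Cauchy filter converges pointwise, because evaluations are bounded; the
    bounds on functionals pass to the pointwise limit. *)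
Lemma rkhs_complete (F : set_system (rkhs K)) :
  ProperFilter F -> cauchy F -> cvg F.
Proof.
move=> FF /cauchyP Fc.
pose small (j : rkhs K * R) := 0 < j.2 /\ F [set h | rnorm (j.1 - h) < j.2].
have smallP (e : R) : 0 < e -> exists g, small (g, e).
  move=> e0; have [|g gP] := Fc e%:C; first by rewrite ltcR.
  exists g; split=> //; apply: filterS gP => h.
  by rewrite -ball_normE /ball_ /= rnormE ltcR.
have small2 i j : small i -> small j -> rnorm (i.1 - j.1) <= i.2 + j.2.
  move=> [_ hi] [_ hj]; have [h [/= ih jh]] := filter_ex (filterI hi hj).
  rewrite (le_trans (rnorm_distD h _ _))// lerD ?(ltW ih)//.
  by rewrite rnormB ltW.
pose c x := gnorm K [:: (1, x)].
have evalB (f g : rkhs K) x : rnorm (f x - g x) <= rnorm (f - g) * c x.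
  have := rkhs_bound (f - g) [:: (1, x)].
  by rewrite /pairing big_seq1 /= rmorph1 mul1r.
have /choice [Phi PhiP] : forall x, exists z : C^o, forall j, small j ->
    rnorm (z - j.1 x) <= j.2 * c x.
  move=> x.
  have [||z zP] := @disc_completeness R {j | small j} (fun j => (sval j).1 x)
     (fun j => (sval j).2 * c x).
  - move=> [i /= si] [j /= sj]; rewrite (le_trans (evalB _ _ _))// -mulrDl.
    by rewrite ler_wpM2r ?gnorm_ge0// small2.
  - move=> e e0; have c0 : 0 < c x + 1 by rewrite ltr_pwDr ?gnorm_ge0.
    have [|g sg] := smallP (e / (c x + 1)); first by rewrite divr_gt0.
    exists (exist _ (g, e / (c x + 1)) sg) => /=.
    by rewrite mulrAC ler_pdivrMr// ler_pM2l// lerDl.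
  - by exists z => j sj; exact: (zP (exist _ j sj)).
have PhiB j : small j -> functional_bound K (Phi - (j.1 : X -> C^o)) j.2.
  move=> sj t.
  apply: (@ler_small _ _ _ (\sum_(q <- t) rnorm q.1 * c q.2 + gnorm K t)) => e e0.
  have [g sg] := smallP e e0.
  have -> : Phi - (j.1 : X -> C^o) =
      (Phi - (g : X -> C^o)) + ((g - j.1 : rkhs K) : X -> C^o).
    by rewrite addrA subrK.
  rewrite pairingD (le_trans (rnormD _ _))//.
  have h1 : rnorm (pairing (Phi - (g : X -> C^o)) t) <=
      (\sum_(q <- t) rnorm q.1 * c q.2) * e.
    rewrite /pairing (le_trans (rnorm_sum _ _))// mulr_suml ler_sum// => q _.
    rewrite rnormM rnorm_conj -mulrA ler_wpM2l ?rnorm_ge0//.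
    by rewrite mulrC; exact: (PhiP _ _ sg).
  have h2 := rkhs_bound (g - j.1) t.
  have := ler_wpM2r (gnorm_ge0 K t) (small2 _ _ sg sj) => /=; lra.
have Phi_in : Phi \in rkhs_pred K.
  apply/rkhs_predP => e e0.
  have [|g sg] := smallP (e / 2); first by rewrite divr_gt0.
  have [|s se] := @rkhs_approx _ _ _ g (e / 2); first by rewrite divr_gt0.
  exists s; rewrite [e in functional_bound _ _ e]splitr.
  have -> : Phi - section K s = (Phi - (g : X -> C^o)) + ((g : X -> C^o) - section K s).
    by rewrite addrA subrK.
  by apply: functional_boundD => //; exact: (PhiB _ sg).
apply/cvg_ex; exists (Rkhs Phi_in); apply/cvg_rnormP => e e0.
have [|g sg] := smallP (e / 2); first by rewrite divr_gt0.
have [_ gF] := sg; apply: filterS gF => h /= gh.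
rewrite (le_lt_trans (rnorm_distD g _ _))// [e]splitr ler_ltD//.
by apply: rkhs_norm_le; [rewrite divr_ge0// ltW|exact: (PhiB _ sg)].
Qed.

HB.instance Definition _ := Uniform_isComplete.Build (rkhs K) rkhs_complete.

End rkhs_complete.

Lemma rat_approx (R : realType) (z : R[i]) (e : R) : 0 < e ->
  exists q : rat * rat, rnorm (z - (ratr q.1 +i* ratr q.2)) < e.
Proof.
move=> e0.
have app (x : R) : exists q : rat, `|x - ratr q| < e / 2.
  have [|q] := @rat_in_itvoo R (x - e / 2) (x + e / 2); first by lra.
  rewrite in_itv /= => /andP[q1 q2]; exists q.
  by rewrite ltr_norml; apply/andP; split; lra.
have [p pP] := app (complex.Re z); have [q qP] := app (complex.Im z).
exists (p, q) => /=; rewrite (le_lt_trans (rnorm_le_ReIm _))// [e]splitr.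
by rewrite ReD ImD ReN ImN /= ltrD.
Qed.

Section kernel_hilbert.
Variables (R : realType) (X : Type) (K : psd_kernel R X) (D : nat -> X).
Local Notation C := R[i].
Hypothesis D_dense : forall x (e : R), 0 < e -> exists n,
  complex.Re (K x x - K x (D n) - K (D n) x + K (D n) (D n)) <= e.

Let kappa (x : X) : rkhs K := rkhs_section K [:: (1, x)].

Let kappa_dot x y : rdot (kappa x) (kappa y) = K x y.
Proof.
by rewrite rdot_section pairing_section /gram !big_seq1 rmorph1 !mul1r.
Qed.

Let comb_section s : rkhs_section K s = comb kappa s.
Proof.
apply/val_inj => /=; elim: s => [|[a x] s IH].
  by rewrite /comb big_nil; apply/funext => x; rewrite /section big_nil.
rewrite -cat1s comb_cat section_cat IH; congr (_ + _).
by rewrite comb1 -[RHS]/(a *: section K [:: (1, x)]) -section_scale /scalec /= mulr1.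
Qed.

Let kappa_approx x (e : R) : 0 < e -> exists n, rnorm (kappa x - kappa (D n)) <= e.
Proof.
move=> e0; have [|n nP] := D_dense x (e := e ^+ 2); first by rewrite exprn_gt0.
exists n; rewrite -(@ler_pXn2r _ 2)// ?nnegrE ?rnorm_ge0 ?(ltW e0)//.
rewrite (le_trans _ nP)// rkhs_rnormE rkhs_norm_sqr.
rewrite -(scaleN1r (kappa (D n))) rdotDl !rdotDr !rdotZl !rdotZr !kappa_dot.
rewrite rmorphN rmorph1 !mulN1r opprK.
by rewrite addrA.
Qed.

Let rational_combination (l : seq (rat * rat * nat)) : seq (C * X) :=
  [seq (ratr p.1.1 +i* ratr p.1.2, D p.2) | p <- l].

Let rational_approx s (e : R) : 0 < e -> exists l,
  rnorm (comb kappa s - comb kappa (rational_combination l)) <= e.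
Proof.
elim: s e => [|[a x] s IH] e e0.
  by exists [::]; rewrite subrr rnorm0 ltW.
have [|l lP] := IH (e / 2); first by rewrite divr_gt0.
have x0 : 0 < rnorm (kappa x) + 1 by rewrite ltr_pwDr ?rnorm_ge0.
have [|q qP] := @rat_approx R a (e / 4 / (rnorm (kappa x) + 1)).
  by rewrite !divr_gt0.
set b := _ +i* _ in qP.
have b0 : 0 < rnorm b + 1 by rewrite ltr_pwDr ?rnorm_ge0.
have [|n nP] := @kappa_approx x (e / 4 / (rnorm b + 1)).
  by rewrite !divr_gt0.
exists ((q, n) :: l).
have -> : comb kappa ((a, x) :: s) = a *: kappa x + comb kappa s.
  by rewrite -comb1 -comb_cat.
have -> : comb kappa (rational_combination ((q, n) :: l)) =
    b *: kappa (D n) + comb kappa (rational_combination l).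
  by rewrite -comb1 -comb_cat.
rewrite opprD addrACA (le_trans (rnormD _ _))//.
have -> : a *: kappa x - b *: kappa (D n) =
    (a - b) *: kappa x + b *: (kappa x - kappa (D n)).
  by rewrite scalerBl scalerBr addrA subrK.
have h1 : rnorm ((a - b) *: kappa x) <= e / 4.
  rewrite rnormZ (le_trans (ler_wpM2r (rnorm_ge0 _) (ltW qP)))//.
  by rewrite mulrAC ler_pdivrMr// ler_pM2l ?divr_gt0// lerDl.
have h2 : rnorm (b *: (kappa x - kappa (D n))) <= e / 4.
  rewrite rnormZ (le_trans (ler_wpM2l (rnorm_ge0 _) nP))//.
  by rewrite mulrC mulrAC ler_pdivrMr// ler_pM2l ?divr_gt0// lerDl.
have := rnormD ((a - b) *: kappa x) (b *: (kappa x - kappa (D n))).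
lra.
Qed.

Let separable : exists S : set (rkhs K), countable S /\ dense S.
Proof.
exists (range (fun l => comb kappa (rational_combination l))); split.
  exact: card_le_trans (card_image_le _ _) (countableP _).
apply/dense_rnormP => f e e0.
have [|s sP] := @rkhs_approx_section _ _ K f (e / 3); first by rewrite divr_gt0.
have [|l lP] := @rational_approx s (e / 3); first by rewrite divr_gt0.
exists (comb kappa (rational_combination l)); first by exists l.
rewrite (le_lt_trans (rnorm_distD (rkhs_section K s) _ _))//.
rewrite [X in _ + rnorm (X - _)]comb_section.
rewrite [e]splitr.
have : e / 3 < e / 2 by lra.
by move=> e32; rewrite ltrD// (le_lt_trans _ e32).
Qed.

(** The vector [k x] is the section of the kernel at [x] in the reproducing
    kernel space.  The hypothesis on [D] says, in terms of the kernel alone,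
    that the [k (D n)] approximate every [k x]; their combinations with rational
    coefficients are then dense. *)
Theorem kernel_hilbert : exists (H : hilbert R) (k : X -> H),
  (forall x y, hdot H (k x) (k y) = K x y) /\
  (forall (h : H) (e : R), 0 < e -> exists s, rnorm (h - comb k s) <= e).
Proof.
exists (@Hilbert R (rkhs K) (rkhs_dot K) (@rdot_norm _ _ K) separable), kappa.
split=> [x y|h e e0]; first exact: kappa_dot.
have [s sP] := @rkhs_approx_section _ _ K h e e0.
by exists s; rewrite -comb_section.
Qed.

End kernel_hilbert.

(** * Continuous complex-valued functions *)

(** Locked, so that unification does not descend to the filters of [R[i]]. *)
HB.lock Definition ccont (R : realType) (T : topologicalType) (f : T -> R[i]) : Prop :=
  continuous (f : T -> R[i]^o).

Section continuous_complex_functions.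
Variables (R : realType) (T : topologicalType).
Local Notation C := R[i].
Implicit Types (f g : T -> C).

Lemma ccontE f : ccont f <-> continuous (f : T -> C^o).
Proof. by rewrite ccont.unlock. Qed.

Lemma ccontP f : ccont f <->
  forall x (e : R), 0 < e -> \forall y \near x, rnorm (f x - f y) < e.
Proof.
rewrite ccontE; split=> [cf x e e0|h x].
  by have /cvgf_rnormP := cf x; apply.
by apply/cvgf_rnormP => e e0; exact: h.
Qed.

Lemma ccont_lipschitz f g (c : R) : ccont f ->
  (forall x y, rnorm (g x - g y) <= c * rnorm (f x - f y)) -> ccont g.
Proof.
move=> /ccontP cf gf; apply/ccontP => x e e0.
have c0 : 0 < `|c| + 1 by rewrite ltr_pwDr.
apply: filterS (cf x (e / (`|c| + 1)) _) => [y fxy|]; last by rewrite divr_gt0.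
rewrite (le_lt_trans (gf _ _))//.
rewrite (@le_lt_trans _ _ ((`|c| + 1) * rnorm (f x - f y)))//.
  by rewrite ler_wpM2r ?rnorm_ge0// (le_trans (ler_norm _))// lerDl.
by rewrite mulrC -ltr_pdivlMr.
Qed.

Lemma ccont_cst (a : C) : ccont (fun _ : T => a).
Proof. rewrite ccontE; exact: cst_continuous. Qed.
Lemma ccontD f g : ccont f -> ccont g -> ccont (fun x => f x + g x).
Proof. by rewrite !ccontE => cf cg x; apply: cvgD; [exact: cf|exact: cg]. Qed.
Lemma ccontM f g : ccont f -> ccont g -> ccont (fun x => f x * g x).
Proof. by rewrite !ccontE => cf cg x; apply: cvgM; [exact: cf|exact: cg]. Qed.
Lemma ccontZ (a : C) f : ccont f -> ccont (fun x => a * f x).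
Proof. move=> cf; have h := ccontM (ccont_cst a) cf; exact h. Qed.
Lemma ccont_lin (a : C) f g : ccont f -> ccont g -> ccont (fun x => a * f x + g x).
Proof. move=> cf cg; have h := ccontD (ccontZ a cf) cg; exact h. Qed.
Lemma ccontB f g : ccont f -> ccont g -> ccont (fun x => f x - g x).
Proof. by rewrite !ccontE => cf cg x; apply: cvgB; [exact: cf|exact: cg]. Qed.
Lemma ccont_conj f : ccont f -> ccont (fun x => Num.conj (f x)).
Proof.
move=> cf; apply: (@ccont_lipschitz f _ 1) => // x y.
by rewrite -rmorphB rnorm_conj mul1r.
Qed.
Lemma ccont_sum I (r : seq I) (F : I -> T -> C) :
  (forall i, ccont (F i)) -> ccont (fun x => \sum_(i <- r) F i x).
Proof.
move=> cF; elim: r => [|i r IH].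
  under eq_fun do rewrite big_nil; exact: ccont_cst.
under eq_fun do rewrite big_cons; exact: (ccontD (cF i) IH).
Qed.

Lemma continuous_Re f : ccont f -> continuous (fun x => complex.Re (f x)).
Proof.
move=> /ccontP cf x; apply/cvgrPdist_lt => e e0.
apply: filterS (cf x e e0) => y; apply: le_lt_trans.
by rewrite -ReN -ReD rnorm_Re.
Qed.
Lemma continuous_Im f : ccont f -> continuous (fun x => complex.Im (f x)).
Proof.
move=> /ccontP cf x; apply/cvgrPdist_lt => e e0.
apply: filterS (cf x e e0) => y; apply: le_lt_trans.
by rewrite -ImN -ImD rnorm_Im.
Qed.
Lemma ccont_real (h : T -> R) : continuous h -> ccont (fun x => (h x)%:C).
Proof.
move=> ch; apply/ccontP => x e e0.
have /cvgrPdist_lt /(_ e e0) := ch x; apply: filterS => y.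
by rewrite -rmorphB rnorm_real.
Qed.

End continuous_complex_functions.

Arguments ccont_cst {R T} a.
Arguments ccontZ {R T} a {f}.

Lemma ccont_comp (R : realType) (S T : topologicalType) (f : T -> R[i]) (h : S -> T) :
  ccont f -> continuous h -> ccont (fun x => f (h x)).
Proof. by rewrite !ccontE => cf ch x; apply: continuous_comp; [exact: ch|exact: cf]. Qed.

Section compact_space.
Variables (R : realType) (L : ptopologicalType).
Hypothesis compact_L : compact [set: L].
Local Notation C := R[i].

Lemma compact_finite_cover (N : L -> set L) : (forall x, nbhs x (N x)) ->
  exists s : seq L, forall y, exists2 x, x \in s & (N x) y.
Proof.
move=> Nx; move: compact_L; rewrite compact_cover.
move=> /(_ L setT (fun x => interior (N x)))[].
- by move=> x _; exact: open_interior.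
- by move=> x _; exists x => //; exact: Nx.
- move=> D _ Dcov; exists (finmap.enum_fset D) => y.
  by have [x /= xD /interior_subset Nxy] := Dcov y I; exists x.
Qed.

Lemma ccont_bounded (f : L -> C) : ccont f ->
  exists2 M : R, 0 < M & forall x, rnorm (f x) <= M.
Proof.
move=> /ccontP cf.
have [s sP] := compact_finite_cover (fun x => cf x 1 ltr01).
exists (1 + \sum_(x <- s) rnorm (f x)).
  by rewrite ltr_pwDl// sumr_ge0// => x _; exact: rnorm_ge0.
move=> y; have [x xs /ltW fxy] := sP y.
have -> : f y = - (f x - f y) + f x by rewrite opprB subrK.
rewrite (le_trans (rnormD _ _))// rnormN lerD//.
rewrite (big_rem x)//= lerDl sumr_ge0// => z _; exact: rnorm_ge0.
Qed.

(** The tube lemma: each point of the compact factor has a neighbourhood on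
    which the estimate holds, and finitely many of them suffice. *)
Lemma ccont_uniform (T : topologicalType) (F : T -> L -> C) :
  ccont (fun p : T * L => F p.1 p.2) ->
  forall x (e : R), 0 < e -> \forall x' \near x, forall y, rnorm (F x y - F x' y) < e.
Proof.
move=> /ccontP cF x e e0.
have := (compact_near_coveringP [set: L]).1 compact_L T (nbhs x)
  (fun x' y => rnorm (F x y - F x' y) < e) (nbhs_filter x).
have h y : [set: L] y -> \forall y' \near y & x' \near x,
    rnorm (F x y' - F x' y') < e.
  move=> _; have e2 : 0 < e / 2 by rewrite divr_gt0.
  have [[A B] /= [xA yB] AB] := cF (x, y) (e / 2) e2.
  exists (B, A) => // -[y' x'] /= [By' Ax'].
  rewrite (le_lt_trans (rnorm_distD (F x y) _ _))// [e]splitr ltrD//.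
    by rewrite rnormB; apply: (AB (x, y')); split => //=; exact: nbhs_singleton.
  exact: (AB (x', y')).
by move=> /(_ h); apply: filterS => x' h' y; exact: h'.
Qed.

End compact_space.

(** * Integration of continuous functions on a compact group *)

Section integration.
Variables (R : realType) (L : topGroupType).
Variable lambda : probability (borel L) R.
Hypothesis compact_L : compact [set: L].
Local Notation C := R[i].
Local Notation cint := (cintegral lambda).
Implicit Types (f g u v : L -> C) (A B : set (borel L)).

Lemma open_measurable_borel (U : set L) : open U -> measurable (U : set (borel L)).
Proof. by move=> oU; exact: sub_sigma_algebra. Qed.

Lemma continuous_measurable_borel (h : L -> R) A :
  continuous h -> measurable_fun A (h : borel L -> R).
Proof.
move=> ch; apply: (@measurable_funS _ _ _ _ setT) => //.
apply: (measurability _ (measurable_realfun.RGenOInfty.measurableE R)) => _ [_ [x ->] <-].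
rewrite setTI; apply: open_measurable_borel.
by apply: (@open_comp _ _ h) => [y _|]; [exact: ch|exact: rray_open].
Qed.

Lemma continuous_integrable_borel (h : L -> R) A : measurable A ->
  continuous h -> lambda.-integrable A (EFin \o (h : borel L -> R)).
Proof.
move=> mA ch; apply: measurable_bounded_integrable => //.
- by rewrite (le_lt_trans (probability_le1 _ _))// ltry.
- exact: continuous_measurable_borel.
- have [M M0 hM] := ccont_bounded compact_L (ccont_real ch).
  exists M; split; first exact: num_real.
  by move=> N MN x _ /=; rewrite -rnorm_real (le_trans (hM x))// ltW.
Qed.

Let lambdaT : lambda [set: borel L] = 1%E.
Proof. exact: probability_setT. Qed.

Definition cint_on A f : C :=
  (\int[lambda]_(x in A) complex.Re (f x)) +i*
  (\int[lambda]_(x in A) complex.Im (f x)).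

Let intRe A f : measurable A -> ccont f ->
  lambda.-integrable A (EFin \o ((fun x => complex.Re (f x)) : borel L -> R)).
Proof.
by move=> mA cf; apply: continuous_integrable_borel => //; exact: continuous_Re.
Qed.
Let intIm A f : measurable A -> ccont f ->
  lambda.-integrable A (EFin \o ((fun x => complex.Im (f x)) : borel L -> R)).
Proof.
by move=> mA cf; apply: continuous_integrable_borel => //; exact: continuous_Im.
Qed.

Lemma cint_onD A f g : measurable A -> ccont f -> ccont g ->
  cint_on A (fun x => f x + g x) = cint_on A f + cint_on A g.
Proof.
move=> mA cf cg; apply: complexP; rewrite ?ReD ?ImD /=.
  by under eq_Rintegral do rewrite ReD; rewrite RintegralD//; exact: intRe.
by under eq_Rintegral do rewrite ImD; rewrite RintegralD//; exact: intIm.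
Qed.

Lemma cint_onZ A (a : C) f : measurable A -> ccont f ->
  cint_on A (fun x => a * f x) = a * cint_on A f.
Proof.
move=> mA cf; apply: complexP; rewrite ?ReM ?ImM /=.
  under eq_Rintegral do rewrite ReM.
  have h1 := intRe mA cf; have h2 := intIm mA cf.
  rewrite RintegralB//=; last 2 first.
  - by have := integrableZl mA (complex.Re a) h1.
  - by have := integrableZl mA (complex.Im a) h2.
  by rewrite !RintegralZl.
under eq_Rintegral do rewrite ImM.
have h1 := intRe mA cf; have h2 := intIm mA cf.
rewrite RintegralD//=; last 2 first.
- by have := integrableZl mA (complex.Re a) h2.
- by have := integrableZl mA (complex.Im a) h1.
by rewrite !RintegralZl.
Qed.

Lemma cintD f g : ccont f -> ccont g ->
  cint (fun x => f x + g x) = cint f + cint g.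
Proof. exact: cint_onD. Qed.

Lemma cintZ (a : C) f : ccont f -> cint (fun x => a * f x) = a * cint f.
Proof. exact: cint_onZ. Qed.

Lemma cint_lin (a : C) f g : ccont f -> ccont g ->
  cint (fun x => a * f x + g x) = a * cint f + cint g.
Proof. by move=> cf cg; rewrite (cintD (ccontZ a cf) cg) (cintZ a cf). Qed.

Lemma cint_cst (a : C) : cint (fun=> a) = a.
Proof.
rewrite /cintegral !Rintegral_cst//.
by apply: complexP => /=; rewrite -[RHS]mulr1; congr (_ * _); exact: (congr1 fine lambdaT).
Qed.

Lemma cint_sum I (r : seq I) (F : I -> L -> C) : (forall i, ccont (F i)) ->
  cint (fun x => \sum_(i <- r) F i x) = \sum_(i <- r) cint (F i).
Proof.
move=> cF; elim: r => [|i r IH].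
  transitivity (cint (fun=> 0)); last by rewrite cint_cst big_nil.
  by congr cintegral; apply/funext => x; rewrite big_nil.
rewrite big_cons -IH -cintD//; last exact: ccont_sum.
by congr cintegral; apply/funext => x; rewrite big_cons.
Qed.

Lemma cint_conj f : ccont f -> cint (fun x => Num.conj (f x)) = Num.conj (cint f).
Proof.
move=> cf; apply: complexP; rewrite ?Re_conj ?Im_conj /=.
  by apply: eq_Rintegral => x _; rewrite Re_conj.
under eq_Rintegral do rewrite Im_conj.
rewrite -mulN1r -RintegralZl//; last exact: intIm.
by apply: eq_Rintegral => x _; rewrite mulN1r.
Qed.

(** The real and the imaginary part are estimated separately, whence the
    factor 2. *)
Lemma cint_on_le A f (c : R) : measurable A -> ccont f -> 0 <= c ->
  (forall x, A x -> rnorm (f x) <= c) ->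
  rnorm (cint_on A f) <= 2 * c * fine (lambda A).
Proof.
move=> mA cf c0 fc; rewrite (le_trans (rnorm_le_ReIm _))//= -mulrA mulr_natl mulr2n.
have ic : lambda.-integrable A (EFin \o (fun=> c : R)).
  by apply: continuous_integrable_borel => //; exact: cst_continuous.
have le (h : L -> R) : continuous h -> (forall x, A x -> `|h x| <= c) ->
    `|\int[lambda]_(x in A) h x| <= c * fine (lambda A).
  move=> ch hc; have ih := continuous_integrable_borel mA ch.
  rewrite (le_trans (le_normr_Rintegral mA ih))// -Rintegral_cst//.
  apply: le_Rintegral => //.
  by have := integrable_norm ih.
by apply: lerD; apply: le; [exact: continuous_Re|
  move=> x Ax; exact: le_trans (rnorm_Re _) (fc x Ax)|exact: continuous_Im|
  move=> x Ax; exact: le_trans (rnorm_Im _) (fc x Ax)].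
Qed.

Lemma cint_le f (c : R) : ccont f -> 0 <= c ->
  (forall x, rnorm (f x) <= c) -> rnorm (cint f) <= 2 * c.
Proof.
move=> cf c0 fc; have := @cint_on_le setT f c measurableT cf c0 (fun x _ => fc x).
by rewrite [fine _](congr1 fine lambdaT) /= mulr1.
Qed.

Lemma cint_ge0 f : (forall x, 0 <= f x) -> 0 <= cint f.
Proof.
move=> f0; rewrite lecE /=; apply/andP; split.
  rewrite (@eq_Rintegral _ _ _ _ _ (fun=> 0)) ?Rintegral_cst ?mul0r//.
  by move=> x _; rewrite (ge0_Re (f0 x)).
by apply: Rintegral_ge0 => x _; rewrite (leC_Re (f0 x)).
Qed.

Lemma cint_on_setU A B f : measurable A -> measurable B -> ccont f ->
  [disjoint A & B] -> cint_on (A `|` B) f = cint_on A f + cint_on B f.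
Proof.
move=> mA mB cf AB; have mU := measurableU _ _ mA mB.
by apply: complexP; rewrite ?ReD ?ImD /=; apply: Rintegral_setU => //;
  [exact: intRe|exact: intIm].
Qed.

Let riemann_sum_on f (M : R) (N : L -> set L) (ps : seq L) :
  ccont f -> 0 <= M -> (forall x, rnorm (f x) <= M) -> (forall x, open (N x)) ->
  forall A, measurable A -> (forall y, A y -> exists2 x, x \in ps & N x y) ->
  exists s : seq (C * L), forall F (e : R), ccont F -> 0 <= e ->
    (forall x y, N x y -> rnorm (F y - F x) <= e) ->
    rnorm (cint_on A (fun x => f x * F x) - \sum_(p <- s) p.1 * F p.2)
      <= 2 * (M * e) * fine (lambda A).
Proof.
move=> cf M0 fM oN; elim: ps => [|x0 ps IH] A mA Aps.
  exists [::] => F e cF e0 FN; rewrite big_nil subr0; apply: cint_on_le => //.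
  - exact: ccontM.
  - by rewrite mulr_ge0.
  - by move=> x /Aps [].
have mN := open_measurable_borel (oN x0).
have [|y|s sP] := IH (A `\` N x0); first exact: measurableD.
  by move=> [/Aps[x]]; rewrite inE => /predU1P[-> //|xs Nxy] _; exists x.
have mAN : measurable (A `&` N x0) by exact: measurableI.
have mAD : measurable (A `\` N x0) by exact: measurableD.
exists ((cint_on (A `&` N x0) f, x0) :: s) => F e cF e0 FN.
have cfF : ccont (fun x => f x * F x) by exact: ccontM.
have disj : [disjoint A `&` N x0 & A `\` N x0].
  apply/disj_setPS => x /= [[_ Nx] [_]]; exact.
have -> : cint_on A (fun x => f x * F x) =
    cint_on (A `&` N x0) (fun x => f x * F x) +
    cint_on (A `\` N x0) (fun x => f x * F x).
  by rewrite -cint_on_setU// setUIDK.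
have -> : fine (lambda A) =
    fine (lambda (A `&` N x0)) + fine (lambda (A `\` N x0)).
  rewrite -[in LHS](setUIDK A (N x0)) measureU//; last exact/disj_set2P.
  by rewrite fineD// fin_num_measure.
rewrite big_cons /= opprD addrACA (le_trans (rnormD _ _))// mulrDr lerD//; last exact: sP.
have -> : cint_on (A `&` N x0) (fun x => f x * F x) - cint_on (A `&` N x0) f * F x0 =
    cint_on (A `&` N x0) (fun x => - F x0 * f x + f x * F x).
  rewrite cint_onD//; last exact: ccontZ.
  by rewrite cint_onZ// mulNr mulrC addrC.
apply: cint_on_le => //.
- by apply: ccontD => //; exact: ccontZ.
- by rewrite mulr_ge0.
- move=> x [_ Nx]; rewrite mulNr mulrC addrC -mulrBr rnormM ler_pM ?rnorm_ge0//.
  exact: FN.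
Qed.

(** The space is cut into pieces, each inside one of the neighbourhoods [N x],
    and the weights are the integrals of [f] over the pieces.  Weights and nodes
    serve all integrands with the given modulus of continuity at once. *)
Lemma riemann_sum f : ccont f -> exists2 M : R, 0 < M &
  forall N : L -> set L, (forall x, nbhs x (N x)) ->
  exists s : seq (C * L), forall F (e : R), ccont F -> 0 <= e ->
    (forall x y, N x y -> rnorm (F y - F x) <= e) ->
    rnorm (cint (fun x => f x * F x) - \sum_(p <- s) p.1 * F p.2) <= M * e.
Proof.
move=> cf; have [M M0 fM] := ccont_bounded compact_L cf.
exists (2 * M); first by rewrite mulr_gt0.
move=> N Nx.
have [ps psP] := @compact_finite_cover L compact_L (fun x => interior (N x))
  (fun x => nbhs_interior (Nx x)).
have [y _|s sP] := @riemann_sum_on f M _ ps cf (ltW M0) fM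
    (fun x => @open_interior _ (N x)) setT measurableT; first exact: psP.
exists s => F e cF e0 FN.
have := sP F e cF e0 (fun x y Nxy => FN x y (interior_subset Nxy)).
by rewrite [fine _](congr1 fine lambdaT) /= mulr1 mulrA.
Qed.

(** A functional [eta] that is bounded for the uniform norm passes through the
    integral because it passes through Riemann sums, and these converge
    uniformly in [y].  The space [S] is the one on which [eta] is linear. *)
Lemma integral_exchange f (F : L -> L -> C) (S : set (L -> C))
    (eta : (L -> C) -> C) (M : R) :
  ccont f -> ccont (fun p : L * L => F p.1 p.2) ->
  (forall x, S (F x)) -> S (fun y => cint (fun x => f x * F x y)) ->
  (forall (a : C) u v, S u -> S v -> S (fun y => a * u y + v y)) ->
  (forall (a : C) u v, S u -> S v ->
     eta (fun y => a * u y + v y) = a * eta u + eta v) ->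
  0 <= M -> (forall u (c : R), S u -> 0 <= c -> (forall y, rnorm (u y) <= c) ->
    rnorm (eta u) <= M * c) ->
  cint (fun x => f x * eta (F x)) = eta (fun y => cint (fun x => f x * F x y)).
Proof.
move=> cf cF SF Sint Slin eta_lin M0 etaM.
have Fy y : ccont (F^~ y).
  apply: (@ccont_comp _ _ _ (fun p : L * L => F p.1 p.2) (fun x => (x, y))) => //.
  by move=> x; apply: cvg_pair => //; exact: cvg_cst.
have SB u v : S u -> S v -> S (fun y => u y - v y).
  move=> Su Sv; have := Slin (-1) v u Sv Su.
  by congr S; apply/funext => y; rewrite mulN1r addrC.
have etaB u v : S u -> S v -> eta u - eta v = eta (fun y => u y - v y).
  move=> Su Sv; have := eta_lin (-1) v u Sv Su.
  rewrite mulN1r addrC => <-; congr eta; apply/funext => y.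
  by rewrite mulN1r addrC.
have S0 : S (fun=> 0).
  have := SB _ _ (SF 1%g) (SF 1%g); congr S; apply/funext => y; exact: subrr.
have eta0 : eta (fun=> 0) = 0.
  apply: rnorm_eq0; have := etaM (fun=> 0) 0 S0 (lexx _).
  by rewrite mulr0; apply => y; rewrite rnorm0.
have Ssum (s : seq (C * L)) : S (fun y => \sum_(p <- s) p.1 * F p.2 y) /\
    eta (fun y => \sum_(p <- s) p.1 * F p.2 y) = \sum_(p <- s) p.1 * eta (F p.2).
  elim: s => [|p s [IH1 IH2]].
    have -> : (fun y => \sum_(p <- [::]) p.1 * F p.2 y) = (fun=> 0).
      by apply/funext => y; rewrite big_nil.
    by rewrite big_nil.
  have -> : (fun y => \sum_(q <- p :: s) q.1 * F q.2 y) =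
      (fun y => p.1 * F p.2 y + \sum_(q <- s) q.1 * F q.2 y).
    by apply/funext => y; rewrite big_cons.
  by rewrite big_cons -IH2 -eta_lin//; split => //; exact: Slin.
have ceta : ccont (fun x => eta (F x)).
  apply/ccontP => x e e0; have M1 : 0 < M + 1 by rewrite ltr_pwDr.
  have e1 : 0 < e / (M + 1) by rewrite divr_gt0.
  apply: filterS (ccont_uniform compact_L cF x e1) => x' h.
  rewrite etaB// (le_lt_trans (etaM _ _ (SB _ _ (SF x) (SF x')) (ltW e1) _))//.
    by move=> y; exact/ltW/h.
  by rewrite mulrCA -[ltRHS]mulr1 ltr_pM2l// ltr_pdivrMr// mul1r ltrDl.
have [M' M'0 sums] := riemann_sum cf.
apply/eqP; rewrite -subr_eq0; apply/eqP/rnorm_eq0.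
apply: (@ler_small _ _ _ (2 * M * M')) => e e0; rewrite add0r.
have [s sP] := sums _ (fun x => ccont_uniform compact_L cF x e0).
have [Ss etas] := Ssum s.
have h1 : rnorm (cint (fun x => f x * eta (F x)) -
    \sum_(p <- s) p.1 * eta (F p.2)) <= M' * (M * e).
  apply: (sP (fun x => eta (F x))) => //; first by rewrite mulr_ge0// ltW.
  move=> x y Nxy; rewrite etaB//; apply: etaM; [exact: SB|exact: ltW|].
  by move=> z; rewrite rnormB ltW.
have h2 : rnorm (eta (fun y => cint (fun x => f x * F x y)) -
    \sum_(p <- s) p.1 * eta (F p.2)) <= M * (M' * e).
  rewrite -etas etaB//; apply: etaM; [exact: SB|by rewrite mulr_ge0// ltW|].
  move=> z; apply: (sP (F^~ z)) => //; first exact: ltW.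
  by move=> x y Nxy; rewrite rnormB ltW.
rewrite (le_trans (rnorm_distD (\sum_(p <- s) p.1 * eta (F p.2)) _ _))//.
by rewrite [rnorm (\sum_(_ <- _) _ - _)]rnormB; lra.
Qed.

Lemma ccont_cint (T : topologicalType) (F : T -> L -> C) :
  ccont (fun p : T * L => F p.1 p.2) -> ccont (fun x => cint (F x)).
Proof.
move=> cF; apply/ccontP => x e e0; have e3 : 0 < e / 3 by rewrite divr_gt0.
have Fx z : ccont (F z).
  apply: (@ccont_comp _ _ _ (fun p : T * L => F p.1 p.2) (fun y => (z, y))) => //.
  by move=> y; apply: cvg_pair => //; exact: cvg_cst.
apply: filterS (ccont_uniform compact_L cF x e3) => x' h.
have -> : cint (F x) - cint (F x') = cint (fun y => -1 * F x' y + F x y).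
  by rewrite cint_lin// mulN1r addrC.
rewrite (@le_lt_trans _ _ (2 * (e / 3)))//; last by lra.
apply: cint_le; [exact: ccont_lin|exact: ltW|move=> y].
by rewrite mulN1r addrC ltW.
Qed.

(** The iterated integral is the case where the functional to be exchanged with
    the integral is itself an integral. *)
Lemma fubini (F : L -> L -> C) : ccont (fun p : L * L => F p.1 p.2) ->
  cint (fun x => cint (F x)) = cint (fun y => cint (F^~ y)).
Proof.
move=> cF.
have Fx z : ccont (F z).
  apply: (@ccont_comp _ _ _ (fun p : L * L => F p.1 p.2) (fun y => (z, y))) => //.
  by move=> y; apply: cvg_pair => //; exact: cvg_cst.
have cF' : ccont (fun p : L * L => F p.2 p.1).
  apply: (@ccont_comp _ _ _ (fun p : L * L => F p.1 p.2) (fun p => (p.2, p.1))) => //.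
  exact: swap_continuous.
have := @integral_exchange (fun=> 1) F (@ccont R L) cint 2 (ccont_cst 1) cF Fx.
have -> : (fun x => 1 * cint (F x)) = (fun x => cint (F x)).
  by apply/funext => x; rewrite mul1r.
have -> : (fun y => cint (fun x => 1 * F x y)) = (fun y => cint (F^~ y)).
  by apply/funext => y; congr cintegral; apply/funext => x; rewrite mul1r.
apply => //.
- exact: (@ccont_cint _ (fun y x => F x y)).
- by move=> a u v cu cv; exact: ccont_lin.
- by move=> a u v cu cv; exact: cint_lin.
- by move=> u c cu c0 uc; exact: cint_le.
Qed.

Hypothesis haar_lambda : is_haar lambda.

Lemma mulg_continuousl (g : L) : continuous (fun x : L => (g * x)%g).
Proof.
move=> x; apply: (@continuous_comp _ _ _ (fun x => (g, x)) (fun p : L * L => (p.1 * p.2)%g)).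
  by apply: cvg_pair => //; exact: cvg_cst.
exact: mulg_continuous.
Qed.

Lemma mulg_continuousr (g : L) : continuous (fun x : L => (x * g)%g).
Proof.
move=> x; apply: (@continuous_comp _ _ _ (fun x => (x, g)) (fun p : L * L => (p.1 * p.2)%g)).
  by apply: cvg_pair => //; exact: cvg_cst.
exact: mulg_continuous.
Qed.

Let translation_measurable (g : L) :
  measurable_fun setT ((fun x => (g * x)%g) : borel L -> borel L).
Proof.
apply: (@measurability _ _ (borel L) (borel L) setT _ (@open L)) => // _ [U oU <-].
rewrite setTI; apply: open_measurable_borel.
by apply: open_comp => // x _; exact: mulg_continuousl.
Qed.

Let Rintegral_translate (h : L -> R) (g : L) : continuous h ->
  \int[lambda]_x h (g * x)%g = \int[lambda]_x h x.
Proof.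
move=> ch; rewrite /Rintegral; congr fine.
have mh := (measurable_EFinP _ _).2 (@continuous_measurable_borel h setT ch).
pose phi : borel L -> borel L := fun x => (g * x)%g.
have ih : lambda.-integrable (phi @^-1` setT) ((EFin \o (h : borel L -> R)) \o phi).
  apply: (@continuous_integrable_borel (fun x => h (g * x)%g)).
    by rewrite preimage_setT.
  by move=> x; apply: continuous_comp; [exact: mulg_continuousl|exact: ch].
have := integral_pushforward (translation_measurable g) mh ih measurableT.
rewrite preimage_setT => <-.
apply: eq_measure_integral => A mA _.
transitivity (lambda (phi @^-1` A)); first by [].
rewrite -(@haar_lambda g (phi @^-1` A)); last first.
  by rewrite -[X in measurable X]setTI; exact: translation_measurable.
congr (lambda _); apply/seteqP; split => [_ [x Ax <-] //|x Ax].
have gx : (g * (g^-1 * (x : L)))%g = x by rewrite mulgA mulgV mul1g.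
exists (g^-1 * (x : L))%g => //.
by rewrite /phi /preimage /= gx.
Qed.

Lemma cint_left (g : L) f : ccont f -> cint (fun x => f (g * x)%g) = cint f.
Proof.
move=> cf; apply: complexP => /=.
  by apply: (Rintegral_translate (h := fun x => complex.Re (f x))); exact: continuous_Re.
by apply: (Rintegral_translate (h := fun x => complex.Im (f x))); exact: continuous_Im.
Qed.

(** Averaging [f (y^-1 x)] over [x] gives the integral of [f], while averaging
    it over [y] gives the integral of [f] composed with the inversion. *)
Lemma cint_inv f : ccont f -> cint (fun x => f (x^-1)%g) = cint f.
Proof.
move=> cf.
have cfV : ccont (fun x : L => f (x^-1)%g) := ccont_comp cf (@invg_continuous L).
have cF : ccont (fun p : L * L => f (p.1^-1 * p.2)%g).
  apply: (ccont_comp cf) => p.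
  apply: (@continuous_comp _ _ _ (fun p : L * L => (p.1^-1, p.2)%g)
     (fun p : L * L => (p.1 * p.2)%g)); last exact: mulg_continuous.
  apply: cvg_pair; last exact: cvg_snd.
  by apply: continuous_comp; [exact: cvg_fst|exact: invg_continuous].
have := fubini (F := fun y x => f (y^-1 * x)%g) cF.
have -> : (fun y => cint (fun x => f (y^-1 * x)%g)) = (fun=> cint f).
  by apply/funext => y; rewrite cint_left.
have -> : (fun x => cint (fun y => f (y^-1 * x)%g)) =
    (fun=> cint (fun x => f (x^-1)%g)).
  apply/funext => x; rewrite -(cint_left x^-1%g cfV); congr cintegral.
  by apply/funext => y; rewrite invgM invgK.
by rewrite !cint_cst.
Qed.

Lemma cint_right (g : L) f : ccont f -> cint (fun x => f (x * g)%g) = cint f.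
Proof.
move=> cf.
have cfV : ccont (fun x : L => f (x^-1)%g) := ccont_comp cf (@invg_continuous L).
have cfg : ccont (fun x => f (x * g)%g) := ccont_comp cf (@mulg_continuousr g).
rewrite -(cint_inv cfg) -(cint_inv cf) -(cint_left g^-1%g cfV); congr cintegral.
by apply/funext => x; rewrite invgM invgK.
Qed.

End integration.

(** * Convolution of continuous functions *)

Section convolution_algebra.
Variables (R : realType) (L : topGroupType).
Variable lambda : probability (borel L) R.
Hypotheses (compact_L : compact [set: L]) (haar_lambda : is_haar lambda).
Local Notation C := R[i].
Local Notation cint := (cintegral lambda).
Local Notation conv := (convolution lambda).
Local Notation inv := (@involution R L).
Implicit Types (f g u v w d : L -> C).

Lemma continuous_pairing (S T1 T2 : topologicalType) (h1 : S -> T1) (h2 : S -> T2) :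
  continuous h1 -> continuous h2 -> continuous (fun x => (h1 x, h2 x)).
Proof. by move=> c1 c2 x; apply: cvg_pair; [exact: c1|exact: c2]. Qed.

Lemma continuous_mulg (S : topologicalType) (h1 h2 : S -> L) :
  continuous h1 -> continuous h2 -> continuous (fun x => (h1 x * h2 x)%g).
Proof.
move=> c1 c2 x; apply: (@continuous_comp _ _ _ (fun x => (h1 x, h2 x))
  (fun p : L * L => (p.1 * p.2)%g)); last exact: mulg_continuous.
exact: continuous_pairing.
Qed.

Lemma continuous_invg (S : topologicalType) (h : S -> L) :
  continuous h -> continuous (fun x => (h x)^-1%g).
Proof.
by move=> c x; apply: continuous_comp; [exact: c|exact: invg_continuous].
Qed.

Let fst_cont (S T : topologicalType) : continuous (@fst S T).
Proof. by move=> x; exact: cvg_fst. Qed.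
Let snd_cont (S T : topologicalType) : continuous (@snd S T).
Proof. by move=> x; exact: cvg_snd. Qed.
Let id_cont (S : topologicalType) : continuous (fun x : S => x).
Proof. by move=> x; exact: cvg_id. Qed.
Let cst_cont (S T : topologicalType) (t : T) : continuous (fun _ : S => t).
Proof. by move=> x; exact: cvg_cst. Qed.

Lemma ccont_mulVg u : ccont u -> ccont (fun p : L * L => u (p.1^-1 * p.2)%g).
Proof.
move=> cu; apply: (ccont_comp cu); apply: continuous_mulg.
  by apply: continuous_invg; exact: fst_cont.
exact: snd_cont.
Qed.

Let conv_integrand f u x : ccont f -> ccont u ->
  ccont (fun h => f h * u (h^-1 * x)%g).
Proof.
move=> cf cu; apply: ccontM => //; apply: (ccont_comp cu).
apply: continuous_mulg; last exact: cst_cont.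
by apply: continuous_invg; exact: id_cont.
Qed.

Lemma ccont_conv f u : ccont f -> ccont u -> ccont (conv f u).
Proof.
move=> cf cu.
apply: (@ccont_cint _ _ lambda compact_L _ (fun x h => f h * u (h^-1 * x)%g)).
apply: ccontM; first by apply: (ccont_comp cf); exact: snd_cont.
apply: (ccont_comp cu); apply: continuous_mulg; last exact: fst_cont.
by apply: continuous_invg; exact: snd_cont.
Qed.

Lemma ccont_inv f : ccont f -> ccont (inv f).
Proof.
by move=> cf; apply: ccont_conj; apply: (ccont_comp cf); exact: invg_continuous.
Qed.

Lemma invK : involutive inv.
Proof. by move=> f; apply/funext => x; rewrite /involution invgK conjCK. Qed.

Lemma conv_linr f (a : C) u v : ccont f -> ccont u -> ccont v ->
  conv f (fun x => a * u x + v x) = (fun x => a * conv f u x + conv f v x).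
Proof.
move=> cf cu cv; apply/funext => x; rewrite /convolution.
have c1 := conv_integrand x cf cu; have c2 := conv_integrand x cf cv.
rewrite -cint_lin//; congr cintegral; apply/funext => h.
by rewrite mulrDr mulrCA.
Qed.

Lemma conv_linl (a : C) f g u : ccont f -> ccont g -> ccont u ->
  conv (fun x => a * f x + g x) u = (fun x => a * conv f u x + conv g u x).
Proof.
move=> cf cg cu; apply/funext => x; rewrite /convolution.
have c1 := conv_integrand x cf cu; have c2 := conv_integrand x cg cu.
rewrite -cint_lin//; congr cintegral; apply/funext => h.
by rewrite mulrDl mulrA.
Qed.

Lemma convA f u v : ccont f -> ccont u -> ccont v ->
  conv (conv f u) v = conv f (conv u v).
Proof.
move=> cf cu cv; apply/funext => x; rewrite /convolution.
pose F h k := f k * u (k^-1 * h)%g * v (h^-1 * x)%g.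
have cF : ccont (fun p : L * L => F p.1 p.2).
  apply: ccontM; first apply: ccontM.
  - by apply: (ccont_comp cf); exact: snd_cont.
  - apply: (ccont_comp cu); apply: continuous_mulg; last exact: fst_cont.
    by apply: continuous_invg; exact: snd_cont.
  - apply: (ccont_comp cv); apply: continuous_mulg; last exact: cst_cont.
    by apply: continuous_invg; exact: fst_cont.
transitivity (cint (fun h => cint (F h))).
  congr cintegral; apply/funext => h.
  rewrite mulrC -cintZ//; last exact: conv_integrand.
  by congr cintegral; apply/funext => k; rewrite mulrC.
rewrite (fubini lambda compact_L cF); congr cintegral; apply/funext => k.
rewrite -cintZ//; last exact: conv_integrand.
have cFk : ccont (F^~ k).
  apply: (@ccont_comp _ _ _ (fun p : L * L => F p.1 p.2) (fun h => (h, k)) cF).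
  by apply: continuous_pairing; [exact: id_cont|exact: cst_cont].
rewrite -(cint_left compact_L haar_lambda k cFk); congr cintegral.
by apply/funext => h; rewrite /F invgM !mulgA mulVg mul1g mulrA.
Qed.

Lemma inv_conv f u : ccont f -> ccont u -> inv (conv f u) = conv (inv u) (inv f).
Proof.
move=> cf cu; apply/funext => x.
rewrite /(involution (convolution _ _ _)) /convolution.
have ci := conv_integrand x (ccont_inv cu) (ccont_inv cf).
rewrite -cint_conj//; last exact: conv_integrand.
rewrite -(cint_left compact_L haar_lambda x ci); congr cintegral.
apply/funext => h; rewrite /involution rmorphM mulrC; congr (_ * _).
  by congr (Num.conj (u _)); rewrite invgM.
by congr (Num.conj (f _)); rewrite invgM invgK mulgA mulVg mul1g.
Qed.

Definition l2dot u v : C := cint (fun x => u x * Num.conj (v x)).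
Definition l2norm u : R := Num.sqrt (complex.Re (l2dot u u)).

Let l2_integrand u v : ccont u -> ccont v -> ccont (fun x => u x * Num.conj (v x)).
Proof. by move=> cu cv; apply: ccontM => //; exact: ccont_conj. Qed.

Lemma l2dotE u v : ccont u -> ccont v -> l2dot u v = conv (inv v) u 1%g.
Proof.
move=> cu cv; rewrite /convolution /involution.
have ci := l2_integrand cu cv.
rewrite /l2dot -(cint_inv compact_L haar_lambda ci); congr cintegral.
by apply/funext => x; rewrite mulg1 mulrC.
Qed.

Lemma l2dot_linl (a : C) u v w : ccont u -> ccont v -> ccont w ->
  l2dot (fun x => a * u x + v x) w = a * l2dot u w + l2dot v w.
Proof.
move=> cu cv cw; rewrite -cint_lin//; try exact: l2_integrand.
by congr cintegral; apply/funext => x; rewrite mulrDl mulrA.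
Qed.

Lemma l2dotC u v : ccont u -> ccont v -> l2dot u v = Num.conj (l2dot v u).
Proof.
move=> cu cv; rewrite -cint_conj//; last exact: l2_integrand.
by congr cintegral; apply/funext => x; rewrite rmorphM /= conjCK mulrC.
Qed.

Lemma l2dot_linr (a : C) u v w : ccont u -> ccont v -> ccont w ->
  l2dot w (fun x => a * u x + v x) = Num.conj a * l2dot w u + l2dot w v.
Proof.
move=> cu cv cw; have cl := ccont_lin a cu cv.
by rewrite l2dotC// l2dot_linl// rmorphD rmorphM /= -!l2dotC.
Qed.

Lemma l2dot_ge0 u : 0 <= l2dot u u.
Proof. by apply: cint_ge0 => x; rewrite -normCK exprn_ge0. Qed.

Lemma l2norm_ge0 u : 0 <= l2norm u.
Proof. exact: sqrtr_ge0. Qed.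

Lemma l2norm_sqr u : l2norm u ^+ 2 = complex.Re (l2dot u u).
Proof. by rewrite sqr_sqrtr// -ler0c -ge0_Re ?l2dot_ge0. Qed.

Lemma l2norm_lin (a : C) u v : ccont u -> ccont v ->
  l2norm (fun x => a * u x + v x) ^+ 2 =
  rnorm a ^+ 2 * l2norm u ^+ 2 + 2 * complex.Re (a * l2dot u v) + l2norm v ^+ 2.
Proof.
move=> cu cv; have cl := ccont_lin a cu cv.
rewrite !l2norm_sqr l2dot_linl// !l2dot_linr// (l2dotC cv cu).
move: (l2dot u u) (l2dot u v) (l2dot v v) => U Z W; rewrite rnorm_sqr.
by rewrite !(ReD, ReM, ImD, ImM, Re_conj, Im_conj); ring.
Qed.

Lemma l2_CS u v : ccont u -> ccont v ->
  rnorm (l2dot u v) <= l2norm u * l2norm v.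
Proof.
move=> cu cv.
rewrite -(@ler_pXn2r _ 2)// ?nnegrE ?rnorm_ge0 ?mulr_ge0 ?l2norm_ge0//.
rewrite exprMn mulrC; apply: discriminant => [|c]; first exact: sqr_ge0.
have := sqr_ge0 (l2norm (fun x => c * u x + v x)).
by rewrite l2norm_lin//; lra.
Qed.

(** The total mass is 1. *)
Lemma l2norm_le_sup u (c : R) : ccont u -> 0 <= c ->
  (forall x, rnorm (u x) <= c) -> l2norm u <= c.
Proof.
move=> cu c0 uc.
rewrite -(@ler_pXn2r _ 2)// ?nnegrE ?l2norm_ge0// l2norm_sqr.
have : 0 <= cint (fun x => -1 * (u x * Num.conj (u x)) + (c ^+ 2)%:C).
  apply: cint_ge0 => x; rewrite rnorm_mulJ mulN1r addrC -rmorphB /= ler0c.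
  by rewrite subr_ge0 ler_pXn2r ?nnegrE ?rnorm_ge0.
rewrite cint_lin//; [|exact: l2_integrand|exact: ccont_cst].
rewrite cint_cst => /leC_Re; rewrite mulN1r ReD ReN addrC.
by rewrite -[complex.Re 0]/0 subr_ge0.
Qed.

Lemma l2norm_inv u : ccont u -> l2norm (inv u) = l2norm u.
Proof.
move=> cu; rewrite /l2norm; congr (Num.sqrt (complex.Re _)).
rewrite /l2dot -(cint_inv compact_L haar_lambda (l2_integrand cu cu)).
by congr cintegral; apply/funext => x; rewrite /involution conjCK mulrC.
Qed.

Lemma l2norm_translate u (x : L) : ccont u -> l2norm (fun y => u (x * y)%g) = l2norm u.
Proof.
move=> cu; rewrite /l2norm; congr (Num.sqrt (complex.Re _)).
exact: (cint_left compact_L haar_lambda x (l2_integrand cu cu)).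
Qed.

Lemma conv_sup f u x : ccont f -> ccont u -> rnorm (conv f u x) <= l2norm f * l2norm u.
Proof.
move=> cf cu.
pose v h := Num.conj (u (h^-1 * x)%g).
have cv : ccont v.
  apply: ccont_conj; apply: (ccont_comp cu); apply: continuous_mulg; last exact: cst_cont.
  by apply: continuous_invg; exact: id_cont.
have -> : conv f u x = l2dot f v.
  by congr cintegral; apply/funext => h; rewrite /v conjCK.
have -> : l2norm u = l2norm v; last exact: l2_CS.
rewrite -(l2norm_inv cu) -(l2norm_translate x^-1%g (ccont_inv cu)).
rewrite /l2norm; congr (Num.sqrt (complex.Re (cint _))); apply/funext => y.
by rewrite /v /involution invgM invgK.
Qed.

Lemma l2norm_conv f u : ccont f -> ccont u -> l2norm (conv f u) <= l2norm f * l2norm u.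
Proof.
move=> cf cu; apply: l2norm_le_sup; first exact: ccont_conv.
  by rewrite mulr_ge0 ?l2norm_ge0.
by move=> x; exact: conv_sup.
Qed.

Lemma l2dot_adj f u w : ccont f -> ccont u -> ccont w ->
  l2dot (conv f u) w = l2dot u (conv (inv f) w).
Proof.
move=> cf cu cw; have cif := ccont_inv cf; have ciw := ccont_inv cw.
rewrite !l2dotE//; try exact: ccont_conv.
by rewrite inv_conv// invK convA.
Qed.

Lemma conv_sum I (r : seq I) (F : I -> L -> C) u : (forall i, ccont (F i)) -> ccont u ->
  conv (fun x => \sum_(i <- r) F i x) u = (fun x => \sum_(i <- r) conv (F i) u x).
Proof.
move=> cF cu; apply/funext => x; rewrite /convolution.
rewrite -cint_sum//; last by move=> i; exact: conv_integrand.
by congr cintegral; apply/funext => h; rewrite mulr_suml.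
Qed.

Lemma conv_sumr I (r : seq I) (F : I -> L -> C) f : (forall i, ccont (F i)) -> ccont f ->
  conv f (fun x => \sum_(i <- r) F i x) = (fun x => \sum_(i <- r) conv f (F i) x).
Proof.
move=> cF cf; apply/funext => x; rewrite /convolution.
rewrite -cint_sum//; last by move=> i; exact: conv_integrand.
by congr cintegral; apply/funext => h; rewrite mulr_sumr.
Qed.

Section invariance.
Variable K : set L.
Hypothesis subgroup_K : is_closed_subgroup K.

(** The space of continuous functions on [L/K]. *)
Definition right_invariant u := ccont u /\ forall x k, K k -> u (x * k)%g = u x.

Lemma right_invariant_conv f u : ccont f -> right_invariant u ->
  right_invariant (conv f u).
Proof.
move=> cf [cu uK]; split=> [|x k Kk]; first exact: ccont_conv.
by congr cintegral; apply/funext => h; rewrite mulgA uK.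
Qed.

Lemma right_invariant_lin (a : C) u v : right_invariant u -> right_invariant v ->
  right_invariant (fun x => a * u x + v x).
Proof.
move=> [cu uK] [cv vK]; split=> [|x k Kk]; first exact: ccont_lin.
by rewrite uK// vK.
Qed.

Lemma heckeE f : hecke K f <-> right_invariant f /\ forall k x, K k -> f (k * x)%g = f x.
Proof.
have [_ K1 _ _] := subgroup_K.
rewrite /hecke /= -ccontE; split=> [[cf fK]|[[cf fr] fl]].
  split; last by move=> k x Kk; rewrite -(fK k 1%g x Kk K1) mulg1.
  by split=> // x k Kk; rewrite -(fK 1%g k x K1 Kk) mul1g.
by split=> // k1 k2 x Kk1 Kk2; rewrite fr// fl.
Qed.

Lemma hecke_right f : hecke K f -> right_invariant f.
Proof. by move=> /heckeE[]. Qed.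

Lemma hecke_ccont f : hecke K f -> ccont f.
Proof. by move=> /heckeE[[]]. Qed.

Lemma hecke_conv_left f u : ccont f -> (forall k x, K k -> f (k * x)%g = f x) ->
  right_invariant u -> hecke K (conv f u).
Proof.
move=> cf fK uE; apply/heckeE; split; first exact: right_invariant_conv.
move=> k x Kk; rewrite /convolution.
have [cu _] := uE.
rewrite -(cint_left compact_L haar_lambda k (conv_integrand _ cf cu)).
congr cintegral; apply/funext => h; rewrite fK//.
by rewrite invgM -!mulgA; congr (_ * u (_ * _)%g); rewrite mulgA mulVg mul1g.
Qed.

(** Right invariance of [f] makes [inv f] left invariant, and convolution keeps
    the left invariance of its first factor and the right invariance of its
    second one. *)
Lemma hecke_inner f u : right_invariant f -> right_invariant u ->
  hecke K (conv (inv f) u).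
Proof.
move=> [cf fK]; apply: hecke_conv_left; first exact: ccont_inv.
have [_ _ _ KV] := subgroup_K.
by move=> k x Kk; rewrite /involution invgM fK//; exact: KV.
Qed.

Lemma hecke_mul f u : hecke K f -> right_invariant u -> hecke K (conv f u).
Proof.
by move=> /heckeE[[cf _] fK]; exact: hecke_conv_left.
Qed.

Lemma hecke_lin (a : C) f u : hecke K f -> hecke K u ->
  hecke K (fun x => a * f x + u x).
Proof.
move=> /heckeE[fr fl] /heckeE[ur ul]; apply/heckeE.
split; first exact: right_invariant_lin.
by move=> k x Kk; rewrite fl// ul.
Qed.

Lemma hecke_inv f : hecke K f -> hecke K (inv f).
Proof.
have [_ _ _ KV] := subgroup_K.
move=> /heckeE[[cf fr] fl]; apply/heckeE; split; first split.
- exact: ccont_inv.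
- by move=> x k Kk; rewrite /involution invgM fl//; exact: KV.
- by move=> k x Kk; rewrite /involution invgM fr//; exact: KV.
Qed.

End invariance.

End convolution_algebra.

(** * Resolvents of convolution operators *)

Lemma expr_small (R : realType) (q c e : R) : 0 <= q < 1 -> 0 < e ->
  exists n, c * q ^+ n <= e.
Proof.
move=> /andP[q0 q1] e0.
have : (fun n => c * q ^+ n) @ \oo --> c * 0.
  by apply: cvgMr => //; apply: cvg_expr; rewrite ger0_norm.
rewrite mulr0 => /cvgrPdist_le /(_ e e0) [n _ /(_ n (leqnn n))].
by rewrite sub0r normrN => h; exists n; rewrite (le_trans (ler_norm _)).
Qed.

Section resolvent.
Variables (R : realType) (L : topGroupType).
Variable lambda : probability (borel L) R.
Hypotheses (compact_L : compact [set: L]) (haar_lambda : is_haar lambda).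
Local Notation C := R[i].
Local Notation conv := (convolution lambda).
Local Notation l2norm := (l2norm lambda).
Local Notation l2dot := (l2dot lambda).
Implicit Types (f g u v w d : L -> C).
Variable K : set L.
Hypothesis subgroup_K : is_closed_subgroup K.

Lemma right_invariant_limit (w : nat -> L -> C) (r : nat -> R) :
  (forall n, right_invariant K (w n)) ->
  (forall m n x, rnorm (w m x - w n x) <= r m + r n) ->
  (forall e, 0 < e -> exists n, r n <= e) ->
  exists2 u, right_invariant K u & forall n x, rnorm (u x - w n x) <= r n.
Proof.
move=> wK wr r0.
have /choice[u uP] x : exists z : C, forall n, rnorm (z - w n x) <= r n.
  by apply: disc_completeness => // m n; exact: wr.
exists u; last by move=> n x; exact: uP.
split.
  apply/ccontP => x e e0; have [|n nP] := r0 (e / 3); first by rewrite divr_gt0.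
  have [/ccontP cw _] := wK n.
  have e3 : 0 < e / 3 by rewrite divr_gt0.
  apply: filterS (cw x _ e3) => y xy.
  have := rnorm_distD (w n x) (u x) (u y); have := rnorm_distD (w n y) (w n x) (u y).
  have := uP x n; have := uP y n; rewrite [rnorm (u y - _)]rnormB; lra.
move=> x k Kk; apply/eqP; rewrite -subr_eq0; apply/eqP/rnorm_eq0.
apply: (@ler_small _ _ _ 2) => e e0; rewrite add0r.
have [n nP] := r0 e e0; have [_ wn] := wK n.
have := rnorm_distD (w n x) (u (x * k)%g) (u x).
have := uP x n; have := uP (x * k)%g n; rewrite wn// [rnorm (u x - _)]rnormB; lra.
Qed.

(** With [A w = d * w + eps w] and a small [t > 0], the map [T = 1 - t A] is a
    contraction for the L2 norm, since [Re <A u, u>] is at least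
    [(eps - mu) |u|^2]; the solution is the Neumann series of [T] at [t f].
    It has to be continuous, so that the series must converge uniformly: this
    follows as convolution with [d] is bounded from L2 to the uniform norm. *)
Lemma resolvent d (mu eps : R) f : ccont d -> 0 <= mu -> mu < eps ->
  (forall u, ccont u ->
     0 <= complex.Re (l2dot (conv d u) u) + mu * l2norm u ^+ 2) ->
  right_invariant K f ->
  exists2 w, right_invariant K w & forall x, conv d w x + eps%:C * w x = f x.
Proof.
move=> cd mu0 mueps dpos fE.
pose e := eps - mu; pose D := l2norm d; pose B := D + eps + e + 1.
have e0 : 0 < e by rewrite subr_gt0.
have D0 : 0 <= D := l2norm_ge0 lambda d.
have B0 : 0 < B by rewrite /B; lra.
(* With this step, [|T u|^2 <= (1 - 2 t e + t^2 B^2) |u|^2 = (1 - t e) |u|^2]. *)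
pose t := e / B ^+ 2.
have B20 : 0 < B ^+ 2 by rewrite exprn_gt0.
have t0 : 0 < t by rewrite divr_gt0.
have teq : t * B ^+ 2 = e by rewrite divfK// gt_eqF.
have te1 : t * e < 1.
  rewrite -(ltr_pM2r B20) mulrAC teq mul1r; have : e < B by rewrite /B; lra.
  move=> eB; rewrite expr2 ltr_pM// ltW//.
have teps1 : t * eps < 1.
  rewrite -(ltr_pM2r B20) mulrAC teq mul1r.
  have : e < B by rewrite /B; lra.
  have : eps < B by rewrite /B; lra.
  move=> h1 h2; rewrite expr2 ltr_pM// ltW//; lra.
pose q := Num.sqrt (1 - t * e).
have q2 : q ^+ 2 = 1 - t * e by rewrite sqr_sqrtr// subr_ge0 ltW.
have q0 : 0 < q by rewrite sqrtr_gt0 subr_gt0.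
have q1 : q < 1.
  rewrite -(@ltr_pXn2r _ 2)// ?nnegrE ?(ltW q0)// q2 expr1n ltrBlDr ltrDl.
  by rewrite mulr_gt0.
pose A u x := conv d u x + eps%:C * u x.
pose T u x := (- t)%:C * A u x + u x.
have AE u : right_invariant K u -> right_invariant K (A u).
  move=> uE; have := right_invariant_lin eps%:C uE (right_invariant_conv lambda compact_L cd uE).
  by congr right_invariant; apply/funext => x; rewrite addrC.
have TE u : right_invariant K u -> right_invariant K (T u).
  by move=> uE; apply: right_invariant_lin => //; exact: AE.
have cA u : ccont u -> ccont (A u).
  by move=> cu; apply: ccontD; [exact: ccont_conv|exact: ccontZ].
have A_sqr u : ccont u -> l2norm (A u) <= B * l2norm u.
  move=> cu; have ccd := ccont_conv lambda compact_L cd cu.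
  rewrite -(@ler_pXn2r _ 2)// ?nnegrE ?mulr_ge0 ?l2norm_ge0 ?(ltW B0)//.
  have -> : A u = (fun x => eps%:C * u x + conv d u x).
    by apply/funext => x; rewrite addrC.
  rewrite l2norm_lin// rnorm_real ger0_norm; last by lra.
  have h1 : l2norm (conv d u) <= D * l2norm u by exact: l2norm_conv.
  have h2 := l2_CS lambda compact_L cu ccd.
  have h3 : complex.Re (eps%:C * l2dot u (conv d u)) <= eps * (l2norm u * l2norm (conv d u)).
    rewrite (le_trans (ler_norm _))// (le_trans (rnorm_Re _))// rnormM rnorm_real.
    by rewrite ger0_norm ?ler_wpM2l//; lra.
  have u0 := l2norm_ge0 lambda u; have v0 := l2norm_ge0 lambda (conv d u).
  rewrite exprMn.
  have : (eps * l2norm u + l2norm (conv d u)) ^+ 2 <= B ^+ 2 * l2norm u ^+ 2.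
    have eps0 : 0 <= eps by lra.
    rewrite -exprMn ler_pXn2r// ?nnegrE ?addr_ge0 ?mulr_ge0 ?(ltW B0)//.
    rewrite (@le_trans _ _ ((D + eps) * l2norm u))//.
      by rewrite mulrDl addrC lerD2r.
    by rewrite ler_wpM2r// /B; lra.
  by rewrite sqrrD; lra.
have T_contr u : ccont u -> l2norm (T u) <= q * l2norm u.
  move=> cu; have cAu := cA u cu; have ccd := ccont_conv lambda compact_L cd cu.
  rewrite -(@ler_pXn2r _ 2)// ?nnegrE ?mulr_ge0 ?l2norm_ge0 ?(ltW q0)//.
  rewrite l2norm_lin// exprMn q2 rnorm_real normrN ger0_norm ?(ltW t0)//.
  have h1 := A_sqr u cu.
  have h2 : complex.Re ((- t)%:C * l2dot (A u) u) <= - t * (e * l2norm u ^+ 2).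
    have -> : A u = (fun x => eps%:C * u x + conv d u x).
      by apply/funext => x; rewrite addrC.
    rewrite l2dot_linl// ReZ mulNr [- t * _]mulNr lerN2 ler_wpM2l ?(ltW t0)//.
    rewrite ReD ReZ -l2norm_sqr.
    by have := dpos u cu; rewrite /e; lra.
  have h3 : t ^+ 2 * l2norm (A u) ^+ 2 <= t * (e * l2norm u ^+ 2).
    rewrite -teq -mulrA expr2 -mulrA ler_wpM2l ?(ltW t0)//.
    rewrite mulrA -mulrA ler_wpM2l ?(ltW t0)// -exprMn.
    by rewrite ler_pXn2r ?nnegrE ?l2norm_ge0// mulr_ge0 ?l2norm_ge0// ltW.
  lra.
pose delta k := iter k T (fun x => t%:C * f x).
have deltaE k : right_invariant K (delta k).
  elim: k => [|k IH]; last exact: TE.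
  have [cf fK] := fE; split; first exact: ccontZ.
  by move=> x y Ky; rewrite /delta /= fK.
have cdelta k : ccont (delta k) by have [] := deltaE k.
pose C0 := l2norm (delta 0%N).
have C00 : 0 <= C0 := l2norm_ge0 _ _.
have delta2 k : l2norm (delta k) <= C0 * q ^+ k.
  elim: k => [|k IH]; first by rewrite mulr1.
  rewrite (le_trans (T_contr _ (cdelta k)))// exprS mulrCA.
  by rewrite ler_pM2l.
have [M M0 MP] := ccont_bounded compact_L (cdelta 0%N).
have qq : 0 < q - q ^+ 2.
  by rewrite expr2 -{1}[q]mulr1 -mulrBr mulr_gt0 // subr_gt0.
have rest0 : 0 <= t * D * C0 / (q - q ^+ 2).
  by apply: divr_ge0 (ltW qq); do 2 apply: mulr_ge0 => //; exact: ltW.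
(* The terms satisfy [|delta_(k+1)| <= q^2 |delta_k| + t D C0 q^k] for the uniform
   norm, so that [C1 q^k] bounds them once [q^2 C1 + t D C0 <= q C1]. *)
pose C1 := M + t * D * C0 / (q - q ^+ 2).
have C10 : 0 <= C1 by rewrite /C1; apply: addr_ge0 => //; exact: ltW.
have delta_sup k x : rnorm (delta k x) <= C1 * q ^+ k.
  elim: k x => [|k IH] x.
    by rewrite mulr1 (le_trans (MP x))// lerDl.
  have -> : delta k.+1 x = (1 - t * eps)%:C * delta k x - t%:C * conv d (delta k) x.
    rewrite [LHS]/(T (delta k) x) /T /A rmorphB rmorph1 rmorphM rmorphN; ring.
  rewrite (le_trans (rnormD _ _))// rnormN !rnormM !rnorm_real.
  rewrite !ger0_norm ?(ltW t0)//; last by rewrite subr_ge0 ltW.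
  have h1 := conv_sup compact_L haar_lambda x cd (cdelta k).
  have h2 : rnorm (conv d (delta k) x) <= D * (C0 * q ^+ k).
    by rewrite (le_trans h1)// ler_wpM2l.
  have h3 : (1 - t * eps) * rnorm (delta k x) <= q ^+ 2 * (C1 * q ^+ k).
    rewrite ler_pM ?rnorm_ge0 ?subr_ge0 ?(ltW teps1)//.
    by rewrite q2 lerD2l lerN2 ler_pM2l// /e; lra.
  have h4 : t * D * C0 <= C1 * (q - q ^+ 2).
    by rewrite -ler_pdivrMr// /C1 lerDr ltW.
  have := ler_wpM2r (exprn_ge0 k (ltW q0)) h4.
  have := ler_wpM2l (ltW t0) h2.
  by rewrite [q ^+ k.+1]exprS; lra.
pose w k x := \sum_(j < k) delta j x.
have wE k : right_invariant K (w k).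
  split; first by apply: ccont_sum => j; exact: cdelta.
  by move=> x y Ky; apply: eq_bigr => j _; have [_ ->] := deltaE j.
have wS k x : w k.+1 x = w k x + delta k x by rewrite /w big_ord_recr.
have q1' : 0 < 1 - q by rewrite subr_gt0.
have wle k n x : rnorm (w (k + n)%N x - w k x) <= C1 * (q ^+ k - q ^+ (k + n)) / (1 - q).
  elim: n => [|n IH]; first by rewrite addn0 !subrr rnorm0 mulr0 mul0r.
  rewrite addnS wS addrAC (le_trans (rnormD _ _))//.
  rewrite (le_trans (lerD IH (delta_sup _ _)))//.
  rewrite -[X in _ + X](mulfK (lt0r_neq0 q1')) -mulrDl ler_pM2r ?invr_gt0//.
  by rewrite exprS; lra.
pose r k := C1 * q ^+ k / (1 - q).
have r_ge0 k : 0 <= r k by rewrite divr_ge0 ?mulr_ge0 ?exprn_ge0 ?(ltW q0) ?(ltW q1').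
have wr k n x : rnorm (w (k + n)%N x - w k x) <= r k.
  rewrite (le_trans (wle _ _ _))// ler_pM2r ?invr_gt0// ler_wpM2l//.
  by rewrite lerBlDr lerDl exprn_ge0// ltW.
have wc m n x : rnorm (w m x - w n x) <= r m + r n.
  case: (leqP m n) => [/subnKC <-|/ltnW/subnKC <-].
    by rewrite rnormB (le_trans (wr _ _ _))// lerDl.
  by rewrite (le_trans (wr _ _ _))// lerDr.
have r_small e' : 0 < e' -> exists n, r n <= e'.
  move=> e'0; have [|n nP] := @expr_small _ q (C1 / (1 - q)) e' _ e'0.
    by rewrite (ltW q0).
  by exists n; rewrite /r mulrAC.
have [u uE ur] := right_invariant_limit wE wc r_small.
exists u => // x; apply/eqP; rewrite -subr_eq0; apply/eqP/rnorm_eq0.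
have tA k y : t%:C * A (w k) y = t%:C * f y - delta k y.
  have step j z : t%:C * A (delta j) z = delta j z - delta j.+1 z.
    by rewrite [delta j.+1 z]/(T (delta j) z) /T rmorphN; ring.
  have -> : A (w k) y = \sum_(j < k) A (delta j) y.
    rewrite [LHS]/A big_split /= -mulr_sumr; congr (_ + _).
    have := conv_sumr lambda compact_L (index_enum 'I_k) (fun j => cdelta j) cd.
    by move=> /(congr1 (fun h => h y)).
  rewrite mulr_sumr; under eq_bigr do rewrite step.
  rewrite (eq_bigr (fun j : 'I_k => - (delta j.+1 y - delta j y))); last first.
    by move=> j _; rewrite opprB.
  by rewrite sumrN -(big_mkord xpredT (fun j => delta j.+1 y - delta j y)) telescope_sumr// opprB.
have [cu _] := uE.
apply/ler_addgt0Pr => e1 e10; rewrite add0r.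
pose G := D + eps + (1 - q) / t.
have G0 : 0 < G by rewrite /G ltr_pwDr ?divr_gt0// addr_ge0//; lra.
have [|k kP] := r_small (e1 / G); first by rewrite divr_gt0.
have [cw _] := wE k.
have cuw : ccont (fun y => u y - w k y) by exact: ccontB.
have -> : A u x - f x = A (fun y => u y - w k y) x - t^-1%:C * delta k x.
  have : t%:C * (A u x - f x) = t%:C * A (fun y => u y - w k y) x - delta k x.
    have -> : A (fun y => u y - w k y) x = A u x - A (w k) x.
      rewrite /A; have -> : (fun y => u y - w k y) = (fun y => -1 * w k y + u y).
        by apply/funext => y; rewrite mulN1r addrC.
      by rewrite conv_linr//; ring.
    rewrite mulrBr [in RHS]mulrBr tA; ring.
  move=> /(congr1 (fun z => t^-1%:C * z)); rewrite mulrA -rmorphM mulVf ?gt_eqF// rmorph1 mul1r.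
  by move=> ->; rewrite mulrBr mulrA -rmorphM mulVf ?gt_eqF// rmorph1 mul1r.
have h1 : rnorm (conv d (fun y => u y - w k y) x) <= D * r k.
  rewrite (le_trans (conv_sup compact_L haar_lambda x cd cuw))// ler_wpM2l//.
  by apply: l2norm_le_sup.
have h2 : rnorm (eps%:C * (u x - w k x)) <= eps * r k.
  by rewrite rnormM rnorm_real ger0_norm ?ler_wpM2l//; lra.
have h3 : rnorm (t^-1%:C * delta k x) <= (1 - q) / t * r k.
  rewrite rnormM rnorm_real ger0_norm ?invr_ge0 ?(ltW t0)//.
  have -> : (1 - q) / t * r k = t^-1 * (C1 * q ^+ k).
    by rewrite /r; field; rewrite ?gt_eqF.
  by rewrite ler_pM2l ?invr_gt0.
rewrite (le_trans (rnormD _ _))// rnormN /A.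
have h4 := rnormD (conv d (fun y => u y - w k y) x) (eps%:C * (u x - w k x)).
have : G * r k <= e1 by rewrite mulrC -ler_pdivlMr.
rewrite /G; lra.
Qed.

End resolvent.

(** * Numerical ranges *)

Section semi_inner_products.
Variables (R : realType) (W : lmodType R[i]).
Local Notation C := R[i].

Record semi_inner (q : W -> W -> C) : Prop := SemiInner {
  semi_inner_lin : forall (a : C) x y z, q (a *: x + y) z = a * q x z + q y z;
  semi_inner_herm : forall x y, q x y = Num.conj (q y x);
  semi_inner_ge0 : forall x, 0 <= complex.Re (q x x) }.

Lemma semi_inner_CS q x y : semi_inner q ->
  rnorm (q x y) ^+ 2 <= complex.Re (q x x) * complex.Re (q y y).
Proof.
move=> [qlin qherm qge0]; rewrite mulrC; apply: discriminant => // c.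
have := qge0 (c *: x + y).
rewrite qlin (qherm x (c *: x + y)) (qherm y (c *: x + y)) !qlin (qherm y x).
move: (qge0 x) (qge0 y) (qherm x x) (qherm y y).
move: (q x x) (q y y) (q x y) => X Y Z _ _ hX hY.
rewrite rnorm_sqr !(ReD, ReM, ImD, ImM, Re_conj, Im_conj).
have : complex.Im X = 0 by have := congr1 (@complex.Im R) hX; rewrite Im_conj; lra.
have : complex.Im Y = 0 by have := congr1 (@complex.Im R) hY; rewrite Im_conj; lra.
move=> _ ->; lra.
Qed.

(** The infimum [m] of the numerical range of a self-adjoint [T] is an
    approximate eigenvalue.  If [m < - mu], then [A = T - m] is positive and has a
    bounded right inverse [S]; hence [|y|^2 = <y, A S y> = <A y, S y>] bounds
    [|y|] by a multiple of [|A y|], and [|A y|^2 <= (M - m) <A y, y>] by the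
    Cauchy-Schwarz inequality for the form [<A x, y>].  So [<A y, y>] is at least
    a positive multiple of [|y|^2], and [m] is not the infimum. *)
Lemma numerical_range_ge (q : W -> W -> C) (T : W -> W) (M mu : R) :
  semi_inner q -> (forall (a : C) x y, T (a *: x + y) = a *: T x + T y) ->
  (forall x y, q (T x) y = q x (T y)) -> 0 <= M ->
  (forall x, complex.Re (q (T x) (T x)) <= M ^+ 2 * complex.Re (q x x)) ->
  0 <= mu ->
  (forall eps, mu < eps -> exists (S : W -> W) (N : R),
     (forall x, complex.Re (q (S x) (S x)) <= N * complex.Re (q x x)) /\
     (forall x, T (S x) + eps%:C *: S x = x)) ->
  forall x, 0 <= complex.Re (q (T x) x) + mu * complex.Re (q x x).
Proof.
move=> qs Tlin Tsym M0 TM mu0 Tinv.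
have [qlin qherm qge0] := qs.
pose n x := complex.Re (q x x).
have Tb x : `|complex.Re (q (T x) x)| <= M * n x.
  rewrite (le_trans (rnorm_Re _))// -(@ler_pXn2r _ 2)// ?nnegrE ?rnorm_ge0 ?mulr_ge0//; last exact: qge0.
  rewrite (le_trans (semi_inner_CS _ _ qs))// exprMn -/(n x) [n x ^+ 2]expr2 mulrA.
  rewrite ler_wpM2r//; exact: qge0.
move=> x0; rewrite leNgt; apply/negP => x0neg.
pose E := [set complex.Re (q (T x) x) / n x | x in [set x | 0 < n x]].
have nx0 : 0 < n x0.
  rewrite lt_def qge0 andbT; apply/eqP => nx0.
  have := Tb x0; rewrite nx0 mulr0 normr_le0 => /eqP T0.
  by move: x0neg; rewrite -/(n x0) nx0 T0 mulr0 addr0 ltxx.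
have Einf : has_inf E.
  split; first by exists (complex.Re (q (T x0) x0) / n x0), x0.
  exists (- M) => _ [x /= nx <-]; rewrite ler_pdivlMr// mulNr.
  by have := Tb x; rewrite ler_norml => /andP[].
pose m := inf E.
have mlt : m < - mu.
  apply: (@le_lt_trans _ _ (complex.Re (q (T x0) x0) / n x0)).
    by apply: ge_inf; [case: Einf|exists x0].
  by rewrite ltr_pdivrMr// mulNr; move: x0neg; rewrite -/(n x0); lra.
pose eps := - m.
have eps_mu : mu < eps by rewrite /eps; lra.
have eps0 : 0 < eps by lra.
pose P x := complex.Re (q (T x) x) + eps * n x.
have P0 x : 0 <= P x.
  have [nx|nx] := eqVneq (n x) 0.
    by have := Tb x; rewrite /P nx !mulr0 addr0 normr_le0 => /eqP ->.
  have nxp : 0 < n x by rewrite lt_def nx qge0.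
  have : m <= complex.Re (q (T x) x) / n x.
    by apply: ge_inf; [case: Einf|exists x].
  by rewrite ler_pdivlMr// /P /eps; lra.
pose A x := T x + eps%:C *: x.
have qD x y z : q (x + y) z = q x z + q y z.
  by rewrite -[x]scale1r qlin mul1r scale1r.
have q0 z : q 0 z = 0.
  by have := qD 0 0 z; rewrite addr0 => /eqP; rewrite -subr_eq subrr => /eqP.
have qZ (a : C) x z : q (a *: x) z = a * q x z.
  by rewrite -[a *: x]addr0 qlin q0 addr0.
have qZr (a : C) x z : q z (a *: x) = Num.conj a * q z x.
  by rewrite qherm qZ rmorphM /= -qherm.
have qDr x y z : q z (x + y) = q z x + q z y.
  by rewrite qherm qD rmorphD /= -!qherm.
pose p x y := q (A x) y.
have Alin (a : C) x y : A (a *: x + y) = a *: A x + A y.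
  by rewrite /A Tlin !scalerDr !scalerA [eps%:C * a]mulrC addrACA.
have Asym x y : q (A x) y = q x (A y).
  by rewrite /A qD qDr Tsym qZ qZr conjC_realc.
have pP x : complex.Re (p x x) = P x.
  by rewrite /p /A qD qZ ReD ReZ.
have ps : semi_inner p.
  split; first by move=> a x y z; rewrite /p Alin qlin.
    by move=> x y; rewrite /p Asym qherm.
  by move=> x; rewrite pP.
have nA x : n (A x) <= (M + eps) * P x.
  have h := semi_inner_CS x (A x) ps.
  rewrite -[p x (A x)]/(q (A x) (A x)) !pP in h.
  have h1 : P (A x) <= (M + eps) * n (A x).
    by rewrite /P mulrDl lerD2r (le_trans (ler_norm _)).
  have h2 : n (A x) ^+ 2 <= P x * ((M + eps) * n (A x)).
    rewrite (le_trans _ (ler_wpM2l (P0 x) h1))// (le_trans _ h)//.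
    have := rnorm_Re (q (A x) (A x)); have := qge0 (A x).
    by move=> ?; rewrite ger0_norm// ler_pXn2r// ?nnegrE ?rnorm_ge0.
  have [->|nx] := eqVneq (n (A x)) 0.
    by rewrite mulr_ge0// addr_ge0// ltW.
  have nxp : 0 < n (A x) by rewrite lt_def nx qge0.
  rewrite -(ler_pM2r nxp) -expr2 (le_trans h2)//; lra.
have [S [N [SN AS]]] := Tinv eps eps_mu.
have N0 : 0 <= `|N| + 1 by rewrite addr_ge0.
have nle y : n y <= (`|N| + 1) * n (A y).
  have h := semi_inner_CS (A y) (S y) qs.
  rewrite Asym [A (S y)]AS -/(n y) -/(n (A y)) -/(n (S y)) in h.
  have h1 : n (S y) <= (`|N| + 1) * n y.
    rewrite (le_trans (SN y))// ler_wpM2r ?qge0//.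
    by rewrite (le_trans (ler_norm _))// lerDl.
  have h2 : n y ^+ 2 <= n (A y) * ((`|N| + 1) * n y).
    rewrite (le_trans _ (ler_wpM2l (qge0 (A y)) h1))// (le_trans _ h)//.
    have := rnorm_Re (q y y); have := qge0 y.
    by move=> ?; rewrite ger0_norm// ler_pXn2r// ?nnegrE ?rnorm_ge0.
  have [->|nx] := eqVneq (n y) 0; first by rewrite mulr_ge0//; exact: qge0.
  have nxp : 0 < n y by rewrite lt_def nx qge0.
  rewrite -(ler_pM2r nxp) -expr2 (le_trans h2)//; lra.
pose D := (`|N| + 1) * (M + eps).
have D0 : 0 < D.
  by apply: mulr_gt0; apply: ltr_pwDr.
have nP y : n y <= D * P y.
  by rewrite (le_trans (nle y))// /D -mulrA ler_wpM2l.
have : m + D^-1 <= m.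
  rewrite {2}/m; apply: lb_le_inf; first by case: Einf.
  move=> _ [y /= ny <-]; rewrite ler_pdivlMr//.
  have := nP y; rewrite -ler_pdivrMl// /P /eps; lra.
by rewrite gerDl leNgt invr_gt0 D0.
Qed.

End semi_inner_products.

(** * Hilbert spaces *)

Section hilbert_spaces.
Variables (R : realType) (V : hilbert R).
Local Notation C := R[i].
Implicit Types (x y z : V).

Lemma hdotC x y : hdot V x y = Num.conj (hdot V y x).
Proof. by rewrite hermC expr0 mul1r. Qed.

Lemma hdot_rnorm x : hdot V x x = (rnorm x ^+ 2)%:C.
Proof. by rewrite hdot_norm rnormE rmorphXn. Qed.

Lemma hdotDl x y z : hdot V (x + y) z = hdot V x z + hdot V y z.
Proof. by rewrite linearDl. Qed.
Lemma hdotDr x y z : hdot V z (x + y) = hdot V z x + hdot V z y.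
Proof. by rewrite linearDr. Qed.
Lemma hdotZl (a : C) x z : hdot V (a *: x) z = a * hdot V x z.
Proof. by rewrite linearZl_LR. Qed.
Lemma hdotZr (a : C) x z : hdot V z (a *: x) = Num.conj a * hdot V z x.
Proof. by rewrite hdotC hdotZl rmorphM /= -hdotC. Qed.
Lemma hdotBl x y z : hdot V (x - y) z = hdot V x z - hdot V y z.
Proof. by rewrite -scaleN1r hdotDl hdotZl mulN1r. Qed.
Lemma hdot0l z : hdot V 0 z = 0.
Proof. by rewrite linear0l. Qed.
Lemma hdot0r z : hdot V z 0 = 0.
Proof. by rewrite hdotC hdot0l rmorph0. Qed.
Lemma hdot_suml I (r : seq I) (F : I -> V) z :
  hdot V (\sum_(i <- r) F i) z = \sum_(i <- r) hdot V (F i) z.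
Proof.
by elim: r => [|i r IH]; rewrite ?big_nil ?hdot0l// !big_cons hdotDl IH.
Qed.
Lemma hdot_sumr I (r : seq I) (F : I -> V) z :
  hdot V z (\sum_(i <- r) F i) = \sum_(i <- r) hdot V z (F i).
Proof.
by elim: r => [|i r IH]; rewrite ?big_nil ?hdot0r// !big_cons hdotDr IH.
Qed.

Lemma hdot_semi_inner : semi_inner (hdot V).
Proof.
split=> [a x y z|x y|x]; first by rewrite hdotDl hdotZl.
  exact: hdotC.
by rewrite hdot_rnorm /= sqr_ge0.
Qed.

Lemma hdot_CS x y : rnorm (hdot V x y) <= rnorm x * rnorm y.
Proof.
rewrite -(@ler_pXn2r _ 2)// ?nnegrE ?rnorm_ge0 ?mulr_ge0 ?rnorm_ge0//.
by rewrite (le_trans (semi_inner_CS _ _ hdot_semi_inner))// !hdot_rnorm exprMn.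
Qed.

Lemma rnorm_sqrD x y :
  rnorm (x + y) ^+ 2 = rnorm x ^+ 2 + 2 * complex.Re (hdot V x y) + rnorm y ^+ 2.
Proof.
have n2 z : rnorm z ^+ 2 = complex.Re (hdot V z z) by rewrite hdot_rnorm.
by rewrite !n2 hdotDl !hdotDr !ReD (hdotC y x) Re_conj; lra.
Qed.

Lemma hdot_eq0 x : hdot V x x = 0 -> x = 0.
Proof.
rewrite hdot_rnorm => /(congr1 (@complex.Re R)) /= /eqP.
by rewrite sqrf_eq0 => /eqP x0; apply: rnorm_eq0; rewrite x0.
Qed.

Lemma hdot_ext x y : (forall z, hdot V x z = hdot V y z) -> x = y.
Proof.
move=> h; apply/eqP; rewrite -subr_eq0; apply/eqP/hdot_eq0.
by rewrite hdotBl h subrr.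
Qed.

Lemma continuous_bounded (U : normedModType C) (T : {linear V -> U}) :
  continuous T -> exists2 M : R, 0 < M & forall v, rnorm (T v) <= M * rnorm v.
Proof.
move=> cT; have /cvgf_rnormP /(_ 1 ltr01) := cT 0.
rewrite linear0 => /nbhs_ballP[e /gt0_Re[e0 eE] eP].
have d0 : 0 < complex.Re e / 2 by rewrite divr_gt0.
exists (complex.Re e / 2)^-1; first by rewrite invr_gt0.
move=> v; have [->|v0] := eqVneq v 0; first by rewrite linear0 !rnorm0 mulr0.
have rv : 0 < rnorm v.
  rewrite lt_def rnorm_ge0 andbT; apply: contra_neq v0 => rv.
  by apply: rnorm_eq0; rewrite rv.
have eP' y : rnorm y < complex.Re e -> rnorm (0 - T y) < 1.
  move=> h; apply: eP; rewrite -ball_normE /ball_ /= sub0r rnormE rnormN.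
  by rewrite [ltRHS]eE ltcR.
have c0 : 0 <= complex.Re e / 2 / rnorm v by rewrite !divr_ge0 ?rnorm_ge0 ?ltW.
have := eP' ((complex.Re e / 2 / rnorm v)%:C *: v).
rewrite rnormZ rnorm_real (ger0_norm c0) divfK ?gt_eqF//.
rewrite ltr_pdivrMr// ltr_pMr// ltr1n => /(_ isT).
rewrite sub0r rnormN linearZ /= rnormZ rnorm_real (ger0_norm c0) => /ltW.
by rewrite mulrAC ler_pdivrMr// mul1r -ler_pdivlMl//.
Qed.

End hilbert_spaces.

(** * Positivity of matrices of operators *)

Section positivity.
Variables (R : realType) (L : topGroupType).
Variable lambda : probability (borel L) R.
Hypotheses (compact_L : compact [set: L]) (haar_lambda : is_haar lambda).
Local Notation C := R[i].
Local Notation cint := (cintegral lambda).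
Local Notation conv := (convolution lambda).
Local Notation inv := (@involution R L).
Local Notation l2norm := (l2norm lambda).
Local Notation l2dot := (l2dot lambda).
Variable K : set L.
Hypothesis subgroup_K : is_closed_subgroup K.
Variables (V : hilbert R) (tau : (L -> C) -> {linear V -> V}).
Hypothesis rep_tau : is_star_rep lambda K tau.
Local Notation hecke := (hecke K).
Local Notation right_invariant := (right_invariant K).

Lemma hecke0 : hecke (fun _ : L => 0 : C).
Proof.
apply/heckeE => //; split=> //; split=> //; exact: (ccont_cst 0).
Qed.

Lemma tau0 v : tau (fun=> 0) v = 0.
Proof.
have := star_rep_linear rep_tau 1 hecke0 hecke0 v.
have -> : (fun g : L => 1 * 0 + 0 : C) = (fun=> 0).
  by apply/funext => x; rewrite mulr0 addr0.
by rewrite scale1r => /eqP; rewrite -subr_eq subrr => /eqP.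
Qed.

Lemma tauZ (a : C) f v : hecke f -> tau (fun x => a * f x) v = a *: tau f v.
Proof.
move=> fH; have := star_rep_linear rep_tau a fH hecke0 v.
rewrite tau0 addr0 => <-; congr (tau _ v); apply/funext => x.
by rewrite addr0.
Qed.

Lemma hecke_scale (a : C) f : hecke f -> hecke (fun x => a * f x).
Proof.
move=> fH; have := hecke_lin subgroup_K a fH hecke0.
by congr hecke; apply/funext => x; rewrite addr0.
Qed.

Lemma tau_sum I (r : seq I) (F : I -> L -> C) v : (forall i, hecke (F i)) ->
  hecke (fun x => \sum_(i <- r) F i x) /\
  tau (fun x => \sum_(i <- r) F i x) v = \sum_(i <- r) tau (F i) v.
Proof.
move=> FH; elim: r => [|i r [IH1 IH2]].
  have -> : (fun x => \sum_(i <- [::]) F i x) = (fun=> 0).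
    by apply/funext => x; rewrite big_nil.
  by rewrite big_nil tau0; split=> //; exact: hecke0.
have -> : (fun x => \sum_(j <- i :: r) F j x) =
    (fun x => 1 * F i x + \sum_(j <- r) F j x).
  by apply/funext => x; rewrite big_cons mul1r.
split; first exact: hecke_lin.
by rewrite (star_rep_linear rep_tau)// big_cons scale1r IH2.
Qed.

Lemma tau_adj f v w : hecke f -> hdot V (tau f v) w = hdot V v (tau (inv f) w).
Proof.
move=> fH; rewrite -(star_rep_star rep_tau); last exact: hecke_inv.
by rewrite invK.
Qed.

Lemma inv_inner f g : ccont f -> ccont g ->
  inv (conv (inv f) g) = conv (inv g) f.
Proof. by move=> cf cg; rewrite inv_conv ?invK//; exact: ccont_inv. Qed.

Section matrix_positivity.
Variables (n : nat) (f : 'I_n -> L -> C) (sigma mu : R).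
Hypotheses (mu0 : 0 <= mu) (fE : forall i, right_invariant (f i)).
(** The two cases of interest are [sigma = 1] with [mu = 0], which says that the
    matrix [tau (f_j^* f_i)] is positive, and [sigma = -1] with [mu] the square of
    the L2 norm of a single [f], which bounds [tau (f^* f)] from above. *)
Hypothesis f_pos : forall u, ccont u ->
  0 <= sigma * \sum_i l2norm (conv (inv (f i)) u) ^+ 2 + mu * l2norm u ^+ 2.

Let W := 'I_n -> V.
Let q (x y : W) : C := \sum_i hdot V (x i) (y i).
Let a j i := conv (inv (f j)) (f i).
Let T (x : W) : W := fun j => \sum_i sigma%:C *: tau (a j i) (x i).

Let aH j i : hecke (a j i).
Proof. exact: hecke_inner. Qed.

Let cf i : ccont (f i). Proof. by have [] := fE i. Qed.
Let cif i : ccont (inv (f i)). Proof. exact: ccont_inv. Qed.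

Let q_semi : semi_inner q.
Proof.
split.
- move=> b x y z; rewrite /q mulr_sumr -big_split; apply: eq_bigr => i _ /=.
  by rewrite hdotDl hdotZl.
- by move=> x y; rewrite /q rmorph_sum; apply: eq_bigr => i _; rewrite hdotC.
- move=> x; rewrite /q Re_sum sumr_ge0// => i _.
  by rewrite hdot_rnorm /= sqr_ge0.
Qed.

Let T_sym x y : q (T x) y = q x (T y).
Proof.
rewrite /q /T.
under eq_bigr do rewrite hdot_suml.
under [RHS]eq_bigr do rewrite hdot_sumr.
rewrite exchange_big; apply: eq_bigr => i _; apply: eq_bigr => j _.
rewrite hdotZl hdotZr conjC_realc tau_adj//; congr (_ * hdot V _ (tau _ _)).
exact: inv_inner.
Qed.

Let n2 (x : W) : complex.Re (q x x) = \sum_i rnorm (x i) ^+ 2.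
Proof.
by rewrite /q Re_sum; apply: eq_bigr => i _; rewrite hdot_rnorm.
Qed.

Let matrix_bounded (B : 'I_n -> 'I_n -> {linear V -> V}) :
  (forall j i, continuous (B j i)) -> exists2 M, 0 <= M &
  forall x : W, complex.Re (q (fun j => \sum_i B j i (x i)) (fun j => \sum_i B j i (x i)))
    <= M ^+ 2 * complex.Re (q x x).
Proof.
move=> cB.
have /choice[m mP] (p : 'I_n * 'I_n) : exists M : R, 0 < M /\
    forall v, rnorm (B p.1 p.2 v) <= M * rnorm v.
  by have [M M0 MP] := continuous_bounded (cB p.1 p.2); exists M.
pose S := \sum_p m p.
have S0 : 0 <= S by apply: sumr_ge0 => p _; have [/ltW] := mP p.
have mS p : m p <= S.
  rewrite /S (bigD1 p)//= lerDl sumr_ge0// => p' _.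
  by have [/ltW] := mP p'.
exists (S * n%:R * n%:R); first by rewrite !mulr_ge0.
move=> x.
have xi i : rnorm (x i) <= Num.sqrt (complex.Re (q x x)).
  rewrite -(@ler_pXn2r _ 2)// ?nnegrE ?rnorm_ge0 ?sqrtr_ge0//.
  rewrite sqr_sqrtr; last by case: q_semi.
  rewrite n2 (bigD1 i)//= lerDl sumr_ge0// => j _; exact: sqr_ge0.
have q0 : 0 <= complex.Re (q x x) by case: q_semi.
set N := Num.sqrt _ in xi.
have N0 : 0 <= N := sqrtr_ge0 _.
have yj j : rnorm (\sum_i B j i (x i)) <= S * n%:R * N.
  rewrite (le_trans (rnorm_sum _ _))//.
  rewrite (@le_trans _ _ (\sum_(i < n) S * N))//.
    apply: ler_sum => i _; have [_ mB] := mP (j, i).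
    rewrite (le_trans (mB _))// ler_pM ?rnorm_ge0//.
    by have [/ltW] := mP (j, i).
  by rewrite sumr_const card_ord mulrAC mulr_natr.
rewrite n2 (@le_trans _ _ (\sum_(j < n) (S * n%:R * N) ^+ 2))//.
  apply: ler_sum => j _; rewrite ler_pXn2r ?nnegrE ?rnorm_ge0//.
  by rewrite !mulr_ge0.
rewrite sumr_const card_ord -[leLHS]mulr_natr [in leRHS]exprMn.
have -> : complex.Re (q x x) = N ^+ 2 by rewrite sqr_sqrtr.
rewrite exprMn mulrAC ler_wpM2r ?sqr_ge0// ler_wpM2l ?sqr_ge0//.
have [->|n_gt0] := posnP n; first by rewrite expr0n.
by rewrite expr2 ler_peMr ?ler0n// ler1n.
Qed.

Let d x := \sum_i sigma%:C * conv (f i) (inv (f i)) x.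

Let cff i : ccont (conv (f i) (inv (f i))).
Proof. exact: ccont_conv. Qed.

Let cd : ccont d.
Proof. by apply: ccont_sum => i; exact: ccontZ. Qed.

Let conv_d u : ccont u ->
  conv d u = (fun x => \sum_i sigma%:C * conv (f i) (conv (inv (f i)) u) x).
Proof.
move=> cu; rewrite conv_sum//; last by move=> i; exact: ccontZ.
apply/funext => x; apply: eq_bigr => i _.
rewrite -convA//.
have := conv_linl lambda compact_L sigma%:C (cff i) (ccont_cst 0) cu.
move=> /(congr1 (fun h => h x)).
have -> : (fun y => sigma%:C * conv (f i) (inv (f i)) y + 0) =
    (fun y => sigma%:C * conv (f i) (inv (f i)) y).
  by apply/funext => y; rewrite addr0.
move=> ->; rewrite [conv (fun=> 0) u x](_ : _ = 0) ?addr0//.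
rewrite /convolution; transitivity (cint (fun=> 0)); last by rewrite cint_cst.
by congr cintegral; apply/funext => y; rewrite mul0r.
Qed.

Let d_pos u : ccont u ->
  0 <= complex.Re (l2dot (conv d u) u) + mu * l2norm u ^+ 2.
Proof.
move=> cu; rewrite conv_d//.
suff -> : l2dot (fun x => \sum_i sigma%:C * conv (f i) (conv (inv (f i)) u) x) u =
    sigma%:C * \sum_i (l2norm (conv (inv (f i)) u) ^+ 2)%:C.
  rewrite ReZ Re_sum; exact: f_pos.
have cfu i : ccont (conv (inv (f i)) u) by exact: ccont_conv.
have cffu i : ccont (conv (f i) (conv (inv (f i)) u)) by exact: ccont_conv.
have cuc : ccont (fun x => Num.conj (u x)) by exact: ccont_conj.
rewrite mulr_sumr.
transitivity (\sum_i cint (fun x => sigma%:C * conv (f i) (conv (inv (f i)) u) x * Num.conj (u x))).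
  rewrite -cint_sum//; last by move=> i; apply: ccontM => //; exact: ccontZ.
  by congr cintegral; apply/funext => x; rewrite mulr_suml.
apply: eq_bigr => i _.
rewrite l2norm_sqr -ge0_Re ?l2dot_ge0// -[in RHS](l2dot_adj compact_L haar_lambda)//.
rewrite -cintZ//; last exact: ccontM.
by congr cintegral; apply/funext => x; rewrite mulrA.
Qed.

(** Put [d = sigma \sum_i f_i f_i^*], solve [d w_i + eps w_i = f_i], and let [G] be
    the matrix [tau (f_j^* w_i)].  Although the [f_i] and [w_i] do not belong to the
    algebra, the products [f_j^* w_i] do, and
    [\sum_i sigma (f_j^* f_i) (f_i^* w_k) = f_j^* d w_k = f_j^* f_k - eps f_j^* w_k]
    says that [(T + eps) (1 - sigma G) = eps]. *)
Lemma matrix_positivity (x : 'I_n -> V) :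
  0 <= sigma * complex.Re (\sum_j \sum_i
      hdot V (tau (conv (inv (f j)) (f i)) (x i)) (x j))
    + mu * \sum_i rnorm (x i) ^+ 2.
Proof.
have [M M0 TM] := matrix_bounded (fun j i => star_rep_bounded rep_tau (aH j i)).
have Tlin (b : C) (y z : W) : T (b *: y + z) = b *: T y + T z.
  apply/funext => j; rewrite /T -[RHS]/(b *: T y j + T z j) /T.
  rewrite scaler_sumr -big_split; apply: eq_bigr => i _ /=.
  by rewrite linearP scalerDr !scalerA mulrC.
have TE (y : W) : T y = sigma%:C *: (fun j => \sum_i tau (a j i) (y i)).
  by apply/funext => j; rewrite /T -scaler_sumr.
have qZZ (b : R) (y : W) : complex.Re (q (b%:C *: y) (b%:C *: y)) =
    b ^+ 2 * complex.Re (q y y).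
  rewrite !n2 mulr_sumr; apply: eq_bigr => i _.
  rewrite -[(b%:C *: y) i]/(b%:C *: y i) rnormZ exprMn rnorm_real.
  by rewrite real_normK ?num_real.
have := @numerical_range_ge R W q T (`|sigma| * M) mu q_semi Tlin T_sym _ _ mu0 _ x.
rewrite n2.
have -> : complex.Re (q (T x) x) = sigma * complex.Re (\sum_j \sum_i
      hdot V (tau (conv (inv (f j)) (f i)) (x i)) (x j)).
  rewrite -ReZ mulr_sumr; congr complex.Re; apply: eq_bigr => j _.
  rewrite hdot_suml mulr_sumr; apply: eq_bigr => i _; by rewrite hdotZl.
apply.
- by rewrite mulr_ge0.
- move=> y; rewrite TE qZZ.
  have -> : (`|sigma| * M) ^+ 2 = sigma ^+ 2 * M ^+ 2.
    by rewrite exprMn real_normK ?num_real.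
  by rewrite -[leRHS]mulrA ler_wpM2l ?sqr_ge0.
- move=> eps mu_eps; have eps0 : 0 < eps by rewrite (le_lt_trans mu0).
  have /choice[w wP] i : exists w, right_invariant w /\
      forall y, conv d w y + eps%:C * w y = f i y.
    have [w wE wP] := resolvent compact_L haar_lambda cd mu0 mu_eps d_pos (fE i).
    by exists w.
  have wE i : right_invariant (w i) by have [] := wP i.
  have cw i : ccont (w i) by have [] := wE i.
  pose b j i := conv (inv (f j)) (w i).
  have bH j i : hecke (b j i) by exact: hecke_inner.
  pose G (y : W) : W := fun j => \sum_i tau (b j i) (y i).
  have [N N0 GN] := matrix_bounded (fun j i => star_rep_bounded rep_tau (bH j i)).
  pose S (y : W) : W := eps^-1%:C *: (y - sigma%:C *: G y).
  exists S, (eps^-1 ^+ 2 * (2 * (1 + sigma ^+ 2 * N ^+ 2))); split=> y.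
    rewrite qZZ -[leRHS]mulrA ler_wpM2l ?sqr_ge0//.
    have h1 := GN y; rewrite -/(G y) in h1.
    rewrite (@le_trans _ _ (2 * (complex.Re (q y y) + complex.Re (q (sigma%:C *: G y) (sigma%:C *: G y)))))//.
      rewrite !n2 -big_split mulr_sumr; apply: ler_sum => i _ /=.
      have r1 := rnormD (y i) (- (sigma%:C *: G y i)); rewrite rnormN in r1.
      rewrite -[(y - sigma%:C *: G y) i]/(y i - sigma%:C *: G y i).
      rewrite -[(sigma%:C *: G y) i]/(sigma%:C *: G y i).
      have r0 := rnorm_ge0 (y i - sigma%:C *: G y i).
      have := ler_pM r0 r0 r1 r1; rewrite -!expr2.
      have := sqr_ge0 (rnorm (y i) - rnorm (sigma%:C *: G y i)); lra.
    rewrite qZZ -[leRHS]mulrA ler_wpM2l// mulrDl mul1r lerD2l -mulrA ler_wpM2l ?sqr_ge0//.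
  have key j k v : \sum_i sigma%:C *: tau (a j i) (tau (b i k) v) =
      tau (a j k) v - eps%:C *: tau (b j k) v.
    have H1 i : hecke (conv (a j i) (b i k)).
      by apply: hecke_mul => //; exact: hecke_right.
    transitivity (tau (fun y => \sum_i sigma%:C * conv (a j i) (b i k) y) v).
      have [_ ->] := tau_sum (index_enum 'I_n) v (fun i => hecke_scale sigma%:C (H1 i)).
      by apply: eq_bigr => i _; rewrite tauZ// (star_rep_mul rep_tau).
    have -> : (fun y => \sum_i sigma%:C * conv (a j i) (b i k) y) =
        (fun y => (- eps)%:C * b j k y + a j k y).
      have -> : (fun y => \sum_i sigma%:C * conv (a j i) (b i k) y) =
          conv (inv (f j)) (conv d (w k)).
        have cfw i : ccont (conv (inv (f i)) (w k)) by exact: ccont_conv.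
        have cffw i : ccont (conv (f i) (conv (inv (f i)) (w k))) by exact: ccont_conv.
        rewrite conv_d// conv_sumr//; last by move=> i; exact: ccontZ.
        apply/funext => t; apply: eq_bigr => i _.
        rewrite /a /b convA//.
        have := conv_linr lambda compact_L sigma%:C (cif j) (cffw i) (ccont_cst 0).
        move=> /(congr1 (fun h => h t)).
        have -> : (fun y => sigma%:C * conv (f i) (conv (inv (f i)) (w k)) y + 0) =
            (fun y => sigma%:C * conv (f i) (conv (inv (f i)) (w k)) y).
          by apply/funext => z; rewrite addr0.
        move=> ->; rewrite [conv _ (fun=> 0) t](_ : _ = 0) ?addr0//.
        rewrite /convolution; transitivity (cint (fun=> 0)); last by rewrite cint_cst.
        by congr cintegral; apply/funext => z; rewrite mulr0.
      have -> : conv d (w k) = (fun y => (- eps)%:C * w k y + f k y).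
        apply/funext => t; have [_ /(_ t) <-] := wP k.
        by rewrite rmorphN; ring.
      by rewrite conv_linr.
    by rewrite (star_rep_linear rep_tau)// rmorphN scaleNr addrC.
  apply/funext => j.
  rewrite -[LHS]/(T (S y) j + eps%:C *: S y j).
  have -> : eps%:C *: S y j = y j - sigma%:C *: G y j.
    rewrite -[S y j]/(eps^-1%:C *: (y j - sigma%:C *: G y j)) scalerA -rmorphM.
    by rewrite mulfV ?gt_eqF// rmorph1 scale1r.
  suff -> : T (S y) j = sigma%:C *: G y j by rewrite addrC subrK.
  have Tlin0 (c : C) (z : W) : T (c *: z) = c *: T z.
    have T0 : T 0 = 0.
      have := Tlin 1 0 0; rewrite !scale1r addr0 => /eqP.
      by rewrite -subr_eq subrr => /eqP.
    by rewrite -[c *: z]addr0 Tlin T0 addr0.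
  have TG z : T (G z) j = \sum_k (tau (a j k) (z k) - eps%:C *: tau (b j k) (z k)).
    rewrite /T /G; under eq_bigr do rewrite linear_sum scaler_sumr.
    rewrite exchange_big; apply: eq_bigr => k _; exact: key.
  have -> : S y = eps^-1%:C *: ((- sigma)%:C *: G y + y).
    by rewrite /S rmorphN scaleNr addrC.
  rewrite Tlin0 Tlin -[LHS]/(eps^-1%:C *: ((- sigma)%:C *: T (G y) j + T y j)) TG.
  rewrite sumrB scalerBr rmorphN !scaleNr.
  have -> : T y j = sigma%:C *: \sum_k tau (a j k) (y k) by rewrite /T -scaler_sumr.
  rewrite opprK addrAC addNr add0r -scaler_sumr !scalerA.
  by congr (_ *: _); rewrite mulrAC -rmorphM mulVf ?gt_eqF// rmorph1 mul1r.
Qed.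

End matrix_positivity.

End positivity.

(** * The kernel of the induced representation *)

(** A continuous function is determined up to a small error by finitely many
    basic open sets and rational values on them.  There are countably many such
    data; the sequence [F] has one member of [S] for each of them that some
    member of [S] fits. *)
Lemma separable_continuous (R : realType) (L : ptopologicalType)
    (S : set (L -> R[i])) (f0 : L -> R[i]) :
  compact [set: L] -> @second_countable L -> (forall f, S f -> ccont f) -> S f0 ->
  exists F : nat -> L -> R[i], (forall n, S (F n)) /\
    forall f, S f -> forall e : R, 0 < e ->
      exists n, forall x, rnorm (f x - F n x) <= e.
Proof.
move=> compact_L [B /countable_injP[code codeI] [oB bB]] cS Sf0.
pose T : countType := (seq (nat * (rat * rat)) * nat)%type.
pose val (q : rat * rat) : R[i] := ratr q.1 +i* ratr q.2.
pose P (c : T) (f : L -> R[i]) := forall y, exists t U, [/\ t \in c.1, B U,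
  code U = t.1, U y & forall z, U z -> rnorm (f z - val t.2) <= c.2.+1%:R^-1].
pose G c := xget f0 [set f | S f /\ P c f].
have SG c : S (G c).
  by rewrite /G; case: xgetP => // f -> [].
exists (fun n => if unpickle n is Some c then G c else f0); split.
  by move=> n; case: unpickle => [c|].
move=> f Sf e e0.
have [m me] : exists m : nat, m.+1%:R^-1 <= e / 2 :> R.
  have b0 : 0 <= 2 / e by rewrite divr_ge0// ltW.
  exists (Num.bound (2 / e)); rewrite invf_ple ?posrE ?divr_gt0// invf_div ltW//.
  by rewrite (lt_trans (archi_boundP b0))// ltr_nat.
pose d : R := m.+1%:R^-1 / 2.
have d0 : 0 < d by rewrite divr_gt0 ?invr_gt0.
have dd : d + d = m.+1%:R^-1 by rewrite /d -splitr.
have /ccontP cf := cS f Sf.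
have /choice[U UP] x : exists U, [/\ B U, U x & forall z, U z -> rnorm (f x - f z) < d].
  have [U /= [BU Ux] Uf] := bB x _ (cf x d d0).
  by exists U; split.
have /choice[q qP] x : exists q, rnorm (f x - val q) < d by exact: rat_approx.
have nU x : nbhs x (U x).
  by have [BU Ux _] := UP x; apply: open_nbhs_nbhs; split => //; exact: oB.
have [s sP] := compact_finite_cover compact_L nU.
pose c : T := ([seq (code (U x), q x) | x <- s], m).
have fval x z : U x z -> rnorm (f z - val (q x)) <= m.+1%:R^-1.
  move=> Uz; have [_ _ /(_ z Uz) h] := UP x; have := qP x.
  have := rnorm_distD (f x) (f z) (val (q x)).
  rewrite [rnorm (f z - f x)]rnormB -dd; lra.
have Pf : P c f.
  move=> y; have [x xs Uy] := sP y; exists (code (U x), q x), (U x).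
  have [BU _ _] := UP x; split=> //; first exact: map_f.
  by move=> z; exact: fval.
have : exists h, [set h | S h /\ P c h] h by exists f.
move=> /(xgetPex f0)[_]; rewrite -/(G c) => PG.
exists (pickle c); rewrite pickleK => y.
have [t [U' [/mapP[x xs ->] BU' /= codeU Uy]]] := PG y.
have EU : U' = U x.
  by apply: codeI => //; rewrite inE //; have [] := UP x.
move=> /(_ y Uy); rewrite EU in Uy; have := fval x y Uy.
have := rnorm_distD (val (q x)) (f y) (G c y).
rewrite [rnorm (val _ - _)]rnormB; have := me; rewrite -dd; lra.
Qed.

Section representation_kernel.
Variables (R : realType) (L : topGroupType).
Variable lambda : probability (borel L) R.
Hypotheses (compact_L : compact [set: L]) (haar_lambda : is_haar lambda).
Hypothesis countable_L : @second_countable L.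
Local Notation C := R[i].
Local Notation conv := (convolution lambda).
Local Notation inv := (@involution R L).
Local Notation l2norm := (l2norm lambda).
Variable K : set L.
Hypothesis subgroup_K : is_closed_subgroup K.
Variables (V : hilbert R) (tau : (L -> C) -> {linear V -> V}).
Hypothesis rep_tau : is_star_rep lambda K tau.
Local Notation right_invariant := (right_invariant K).

(** This bound makes the vectors of the representation depend continuously on
    [f], and thereby yields strong continuity and separability. *)
Lemma tau_inner_le f v : right_invariant f ->
  complex.Re (hdot V (tau (conv (inv f) f) v) v) <= l2norm f ^+ 2 * rnorm v ^+ 2.
Proof.
move=> fE; have [cf _] := fE; have cif := ccont_inv cf.
have := @matrix_positivity _ _ _ compact_L haar_lambda _ subgroup_K _ _ rep_tau
  1 (fun=> f) (-1) (l2norm f ^+ 2) (sqr_ge0 _) (fun=> fE) _ (fun=> v).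
rewrite !big_ord1 mulN1r addrC subr_ge0; apply => u cu.
rewrite big_ord1 mulN1r addrC subr_ge0 -exprMn ler_pXn2r ?nnegrE ?mulr_ge0 ?l2norm_ge0//.
by rewrite -(l2norm_inv compact_L haar_lambda cf) l2norm_conv.
Qed.

(** The pair of [f] and [v] stands for the vector [rho(f) v] of the
    representation to be constructed, in which [V] is the space of [K]-fixed
    vectors.  As [v] is fixed, [f] may be averaged over [K] on the right. *)
Definition induction_index : Type := {f : L -> C | right_invariant f} * V.

(** Whatever [rho] is, this has to be the inner product of [rho(f) v] and
    [rho(g) w]. *)
Definition induction_fun (x y : induction_index) : C :=
  hdot V (tau (conv (inv (sval y.1)) (sval x.1)) x.2) y.2.

Let E (x : induction_index) : right_invariant (sval x.1) := svalP x.1.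
Let cE (x : induction_index) : ccont (sval x.1).
Proof. by have [] := E x. Qed.

Lemma induction_herm x y : induction_fun x y = Num.conj (induction_fun y x).
Proof.
rewrite /induction_fun -hdotC (tau_adj subgroup_K rep_tau); last exact: hecke_inner.
by rewrite inv_inner.
Qed.

Lemma induction_psd (s : seq (C * induction_index)) :
  0 <= \sum_(p <- s) \sum_(q <- s) p.1 * Num.conj q.1 * induction_fun p.2 q.2.
Proof.
set z := (X in 0 <= X).
have zreal : z = Num.conj z.
  rewrite /z rmorph_sum [LHS]exchange_big /=; apply: eq_bigr => q _.
  rewrite rmorph_sum /=; apply: eq_bigr => p _.
  by rewrite !rmorphM /= conjCK -induction_herm [_ * p.1]mulrC.
have zim : complex.Im z = 0.
  by have := congr1 (@complex.Im R) zreal; rewrite Im_conj; lra.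
rewrite lecE zim eqxx /=.
pose t := in_tuple s.
have := @matrix_positivity _ _ _ compact_L haar_lambda _ subgroup_K _ _ rep_tau
  (size s) (fun i => sval (tnth t i).2.1) 1 0 (lexx _) (fun i => E _) _
  (fun i => (tnth t i).1 *: (tnth t i).2.2).
rewrite mul1r mul0r addr0.
set z' := (X in complex.Re X); have -> : z = z'.
  rewrite /z big_tnth exchange_big /z' /=.
  rewrite big_tnth; apply: eq_bigr => j _; rewrite -/t.
  apply: eq_bigr => i _.
  by rewrite [tau _ _]linearZ /= hdotZl hdotZr mulrA.
apply => u cu; rewrite mul1r mul0r addr0.
by apply: sumr_ge0 => i _; exact: sqr_ge0.
Qed.

Definition induction_kernel : psd_kernel R induction_index :=
  PsdKernel induction_herm induction_psd.

Let kappa (x : induction_index) : rkhs induction_kernel :=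
  rkhs_section induction_kernel [:: (1, x)].

Let kappaE x y : kappa x y = induction_fun x y.
Proof. by rewrite /= /section big_seq1 mul1r. Qed.

Let kappa_norm x : rnorm (kappa x) <= l2norm (sval x.1) * rnorm x.2.
Proof.
rewrite -(@ler_pXn2r _ 2)// ?nnegrE ?rnorm_ge0 ?mulr_ge0 ?l2norm_ge0 ?rnorm_ge0//.
rewrite rkhs_rnormE rkhs_norm_sqr rdot_section pairing_section /gram !big_seq1.
by rewrite rmorph1 !mul1r exprMn; exact: tau_inner_le.
Qed.

Lemma induction_fun_linl (a : C) f g (fE : right_invariant f) (gE : right_invariant g)
    (h : right_invariant (fun x => a * f x + g x)) v y :
  induction_fun (exist _ _ h, v) y =
  a * induction_fun (exist _ _ fE, v) y + induction_fun (exist _ _ gE, v) y.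
Proof.
have [cf _] := fE; have [cg _] := gE.
rewrite /induction_fun /= conv_linr//; last exact: ccont_inv.
rewrite (star_rep_linear rep_tau); try exact: hecke_inner.
by rewrite hdotDl hdotZl.
Qed.

Lemma induction_fun_linr (a : C) f v w y :
  induction_fun (f, a *: v + w) y =
  a * induction_fun (f, v) y + induction_fun (f, w) y.
Proof. by rewrite /induction_fun /= linearP hdotDl hdotZl. Qed.

Lemma induction_separable : exists D : nat -> induction_index,
  forall x (e : R), 0 < e -> exists n,
    complex.Re (induction_kernel x x - induction_kernel x (D n)
      - induction_kernel (D n) x + induction_kernel (D n) (D n)) <= e.
Proof.
have [S [/countable_injP[code codeI] dS]] := hilbert_separable V.
have E0 : right_invariant (fun _ : L => 0 : C) by split=> //; exact: ccont_cst.
have [F [FE Fdense]] := separable_continuous compact_L countable_L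
  (fun f (fE : right_invariant f) => proj1 fE) E0.
pose vec n : V := xget 0 [set v | S v /\ code v = n].
have vecP v : S v -> vec (code v) = v.
  move=> Sv; have : exists u, [set u | S u /\ code u = code v] u by exists v.
  by move=> /(xgetPex 0)[Sv' h]; apply: codeI => //; rewrite inE.
pose D n : induction_index := if unpickle n is Some p
  then (exist _ _ (FE p.1), vec p.2) else (exist _ _ E0, 0).
exists D => -[[f fE] v] e e0.
pose r := Num.sqrt e; have r0 : 0 < r by rewrite sqrtr_gt0.
have v1 : 0 < rnorm v + 1 by rewrite ltr_pwDr ?rnorm_ge0.
have [|n nP] := Fdense f fE (r / 2 / (rnorm v + 1)); first by rewrite !divr_gt0.
set g := F n in nP; have gE : right_invariant g := FE n.
have [cf _] := fE; have [cg _] := gE.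
have g1 : 0 < l2norm g + 1 by rewrite ltr_pwDr ?l2norm_ge0.
have [|w Sw wP] := (dense_rnormP S).1 dS v (r / 2 / (l2norm g + 1)).
  by rewrite !divr_gt0.
exists (pickle (n, code w)); rewrite /D pickleK /= vecP//.
set x := (exist _ f fE, v) : induction_index; set y := (exist _ g _, w) : induction_index.
suff h : rnorm (kappa x - kappa y) <= r.
  have : rnorm (kappa x - kappa y) ^+ 2 <= e.
    by rewrite -(sqr_sqrtr (ltW e0)) ler_pXn2r ?nnegrE ?rnorm_ge0// ltW.
  rewrite rkhs_rnormE rkhs_norm_sqr.
  rewrite -(scaleN1r (kappa y)) rdotDl !rdotDr !rdotZl !rdotZr.
  rewrite !rdot_section /pairing !big_seq1 rmorph1 !mul1r !kappaE.
  by rewrite rmorphN rmorph1 !mulN1r opprK addrA.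
have hE : right_invariant (fun x => -1 * g x + f x) by exact: right_invariant_lin.
pose x1 : induction_index := (exist _ _ hE, v).
pose x2 : induction_index := (exist _ g gE, -1 *: w + v).
have -> : kappa x - kappa y = kappa x1 + kappa x2.
  apply/val_inj/funext => t.
  rewrite -[LHS]/(kappa x t - kappa y t) -[RHS]/(kappa x1 t + kappa x2 t).
  rewrite !kappaE (induction_fun_linl gE fE) induction_fun_linr /x.
  have -> : induction_fun y t = induction_fun (exist _ g gE, w) t by [].
  ring.
rewrite (le_trans (rnormD _ _))// [r]splitr lerD//.
  rewrite (le_trans (kappa_norm _))//=.
  rewrite (@le_trans _ _ (r / 2 / (rnorm v + 1) * rnorm v))//.
    rewrite ler_wpM2r ?rnorm_ge0//; apply: l2norm_le_sup => //.
    - by have [] := hE.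
    - by rewrite !divr_ge0// ltW.
    - by move=> z; rewrite mulN1r addrC.
  by rewrite mulrAC ler_pdivrMr// ler_pM2l ?divr_gt0// lerDl.
rewrite (le_trans (kappa_norm _))//= scaleN1r addrC.
rewrite (@le_trans _ _ (l2norm g * (r / 2 / (l2norm g + 1))))//.
  by rewrite ler_wpM2l ?l2norm_ge0// ltW.
by rewrite mulrA ler_pdivrMr// mulrC ler_pM2l ?divr_gt0// lerDl.
Qed.

End representation_kernel.

(** * Total families and isometries *)

Section complete_spaces.
Variables (R : realType) (V : completeNormedModType R[i]).

(** The analogue of [disc_completeness] for balls. *)
Lemma vector_completeness J (z : J -> V) (r : J -> R) :
  (forall i j, rnorm (z i - z j) <= r i + r j) ->
  (forall e, 0 < e -> exists j, r j <= e) ->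
  exists v, forall j, rnorm (v - z j) <= r j.
Proof.
move=> zr r0.
pose F : set_system V := [set A | exists2 e, 0 < e & forall j, r j <= e -> A (z j)].
have FF : ProperFilter F.
  apply: Build_ProperFilter_ex.
    by move=> A [e e0 Ae]; have [j rj] := r0 e e0; exists (z j); exact: Ae.
  split.
  - by exists 1.
  - move=> A B [e1 e10 A1] [e2 e20 B2]; exists (Num.min e1 e2).
      by rewrite lt_min e10.
    by move=> j; rewrite le_min => /andP[j1 j2]; split; [exact: A1|exact: B2].
  - by move=> A B AB [e e0 Ae]; exists e => // j /Ae /AB.
have /cauchy_cvg/cvg_ex[v Fv] : cauchy F.
  apply/cauchyP => e /gt0_Re[e0 eE].
  have [|j rj] := r0 (complex.Re e / 3); first by rewrite divr_gt0.
  exists (z j), (complex.Re e / 3); first by rewrite divr_gt0.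
  move=> i ri; rewrite -ball_normE /ball_ /= rnormE [ltRHS]eE ltcR.
  by have := zr j i; lra.
exists v => j; apply: (@ler_small _ _ _ 2) => e e0.
have /cvg_rnormP /(_ e e0) [d d0 vd] := Fv.
have [|i] := r0 (Num.min d e); first by rewrite lt_min d0.
rewrite le_min => /andP[rd re]; have := vd i rd => /=.
have := zr i j; have := rnorm_distD (z i) v (z j); lra.
Qed.

End complete_spaces.

Section total_families.
Variables (R : realType) (X : Type) (V : hilbert R).
Local Notation C := R[i].

Definition total (a : X -> V) :=
  forall v (e : R), 0 < e -> exists s, rnorm (v - comb a s) <= e.

Lemma total_functional (a : X -> V) (D : V -> C) (M : R) : total a ->
  (forall (c : C) v w, D (c *: v + w) = c * D v + D w) ->
  (forall v, rnorm (D v) <= M * rnorm v) -> (forall x, D (a x) = 0) ->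
  forall v, D v = 0.
Proof.
move=> atot Dlin DM Da v.
have D0 : D 0 = 0.
  have := Dlin 1 0 0; rewrite scaler0 addr0 mul1r => /eqP.
  by rewrite -subr_eq subrr => /eqP.
have Ds s : D (comb a s) = 0.
  elim: s => [|p s IH]; first by rewrite /comb big_nil.
  by rewrite /comb big_cons Dlin Da mulr0 add0r.
apply: rnorm_eq0; apply: (@ler_small _ _ _ `|M|) => e e0; rewrite add0r.
have [s sP] := atot v e e0.
have -> : v = 1 *: (v - comb a s) + comb a s by rewrite scale1r subrK.
rewrite Dlin Ds addr0 mul1r (le_trans (DM _))//.
rewrite (@le_trans _ _ (`|M| * rnorm (v - comb a s)))//.
  by rewrite ler_wpM2r ?rnorm_ge0// ler_norm.
by rewrite ler_wpM2l.
Qed.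

Lemma total_eq (a : X -> V) v w : total a ->
  (forall x, hdot V v (a x) = hdot V w (a x)) -> v = w.
Proof.
move=> atot h; apply: hdot_ext => z.
apply/eqP; rewrite -subr_eq0 -hdotBl hdotC; apply/eqP.
rewrite (@total_functional a (fun z => hdot V z (v - w)) (rnorm (v - w)))//.
- by rewrite rmorph0.
- by move=> c x y; rewrite hdotDl hdotZl.
- by move=> x; rewrite mulrC hdot_CS.
- by move=> x; rewrite hdotC hdotBl h subrr rmorph0.
Qed.

Lemma total_linear_eq (U : hilbert R) (a : X -> V) (S T : {linear V -> U}) (M N : R) :
  total a -> (forall v, rnorm (S v) <= M * rnorm v) ->
  (forall v, rnorm (T v) <= N * rnorm v) -> (forall x, S (a x) = T (a x)) ->
  forall v, S v = T v.
Proof.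
move=> atot SM TN ST v; apply: hdot_ext => z.
apply/eqP; rewrite -subr_eq0 -hdotBl; apply/eqP.
apply: (@total_functional a (fun v => hdot U (S v - T v) z) ((M + N) * rnorm z) atot).
- move=> c x y; have -> : S (c *: x + y) = c *: S x + S y by exact: linearP.
  have -> : T (c *: x + y) = c *: T x + T y by exact: linearP.
  by rewrite opprD addrACA -scalerBr hdotDl hdotZl.
- move=> x; rewrite (le_trans (hdot_CS _ _))// mulrAC ler_wpM2r ?rnorm_ge0//.
  by rewrite (le_trans (rnormD _ _))// rnormN mulrDl lerD.
- by move=> x; rewrite ST subrr hdot0l.
Qed.

(** The projection theorem: a minimizing sequence of linear combinations
    converges to a vector whose defect is orthogonal to the family. *)
Lemma total_orthogonal (a : X -> V) :
  (forall v, (forall x, hdot V v (a x) = 0) -> v = 0) -> total a.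
Proof.
move=> aorth v.
pose E := [set rnorm (v - comb a s) ^+ 2 | s in [set: seq (C * X)]].
have Einf : has_inf E.
  split; first by exists (rnorm (v - comb a [::]) ^+ 2), [::].
  by exists 0 => _ [s _ <-]; exact: sqr_ge0.
pose d := inf E.
have dle s : d <= rnorm (v - comb a s) ^+ 2.
  by apply: ge_inf; [case: Einf|exists s].
pose J := {j : seq (C * X) * R | 0 < j.2 /\ rnorm (v - comb a j.1) ^+ 2 <= d + j.2 ^+ 2}.
have Jex (e : R) : 0 < e -> exists j : J, (sval j).2 = e.
  move=> e0; have [|_ [s _ <-] sP] := inf_adherent (eps := e ^+ 2) _ Einf.
    by rewrite exprn_gt0.
  by exists (exist _ (s, e) (conj e0 (ltW sP))).
have half s t : comb a (scalec (2^-1) (s ++ t)) = 2^-1 *: (comb a s + comb a t).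
  by rewrite comb_scale comb_cat.
have par (x y : V) : rnorm (x - y) ^+ 2 + rnorm (x + y) ^+ 2 =
    2 * rnorm x ^+ 2 + 2 * rnorm y ^+ 2.
  have := rnorm_sqrD x (- y); have := rnorm_sqrD x y.
  by rewrite rnormN -scaleN1r hdotZr rmorphN rmorph1 mulN1r ReN; lra.
have [||p pP] := @vector_completeness R V J (fun j => comb a (sval j).1)
    (fun j => 2 * (sval j).2).
- move=> [[s e1] /= [e10 sP]] [[t e2] /= [e20 tP]].
  have e120 : 0 <= 2 * e1 + 2 * e2 by lra.
  rewrite -(@ler_pXn2r _ 2)// ?nnegrE ?rnorm_ge0//.
  have := par (v - comb a s) (v - comb a t).
  have -> : v - comb a s - (v - comb a t) = - (comb a s - comb a t).
    by rewrite opprB [RHS]opprB addrC addrA subrK.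
  have -> : v - comb a s + (v - comb a t) =
      2 *: (v - comb a (scalec (2^-1) (s ++ t))).
    rewrite half scalerBr scalerA divff ?scale1r ?pnatr_eq0//.
    by rewrite addrACA -opprD -mulr2n scaler_nat.
  rewrite rnormN rnormZ exprMn.
  have -> : rnorm (2 : C) = 2 by rewrite -[2 : C](rmorph_nat (real_complex R)) rnorm_real normr_nat.
  have := dle (scalec (2^-1) (s ++ t)).
  have : 0 < e1 * e2 by rewrite mulr_gt0.
  have := sqr_ge0 e1; have := sqr_ge0 e2.
  by move: sP tP; lra.
- move=> e e0; have [|j jE] := Jex (e / 2); first by rewrite divr_gt0.
  by exists j; rewrite jE mulrC divfK.
suff pv : v = p.
  move=> e e0; have [|j jE] := Jex (e / 2); first by rewrite divr_gt0.
  exists (sval j).1; have := pP j; rewrite -pv jE => /le_trans; apply.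
  by rewrite mulrC divfK.
apply/eqP; rewrite -subr_eq0; apply/eqP/aorth => x; apply: rnorm_eq0.
apply: (@ler_small _ _ _ (3 * rnorm (a x))) => e e0; rewrite add0r.
have [j jE] := Jex e e0.
have pj := pP j; case: j jE pj => -[s e'] /= [_ sP] e'E; rewrite e'E in sP *.
move=> ps.
have h1 : rnorm (hdot V (v - comb a s) (a x)) <= e * rnorm (a x).
  rewrite -(@ler_pXn2r _ 2)// ?nnegrE ?rnorm_ge0 ?mulr_ge0 ?rnorm_ge0 ?(ltW e0)//.
  rewrite exprMn; apply: discriminant; first exact: sqr_ge0.
  move=> c.
  have := dle (s ++ [:: (- Num.conj c, x)]).
  rewrite comb_cat comb1 opprD addrA scaleNr opprK rnorm_sqrD.
  rewrite hdotZr conjCK rnormZ rnorm_conj exprMn; move: sP; lra.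
have h2 : rnorm (hdot V (comb a s - p) (a x)) <= 2 * e * rnorm (a x).
  rewrite (le_trans (hdot_CS _ _))// ler_wpM2r ?rnorm_ge0//.
  by rewrite rnormB.
have -> : v - p = (v - comb a s) + (comb a s - p) by rewrite addrA subrK.
rewrite hdotDl (le_trans (rnormD _ _))//; move: h1 h2; lra.
Qed.

End total_families.

Section isometries.
Variables (R : realType) (V H : hilbert R).
Local Notation C := R[i].

Lemma hdot_comb (X : Type) (U : hilbert R) (a : X -> U) (s t : seq (C * X)) :
  hdot U (comb a s) (comb a t) =
  \sum_(p <- s) \sum_(q <- t) p.1 * (Num.conj q.1 * hdot U (a p.2) (a q.2)).
Proof.
rewrite /comb hdot_suml; apply: eq_bigr => p _.
by rewrite hdot_sumr; apply: eq_bigr => q _; rewrite hdotZl hdotZr.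
Qed.

(** The Gram matrix determines the distances between linear combinations, so
    that combinations of the [a x] which converge correspond to combinations of
    the [b x] which converge. *)
Lemma isometry_extension (X : Type) (a : X -> V) (b : X -> H) : total a ->
  (forall x y, hdot V (a x) (a y) = hdot H (b x) (b y)) ->
  exists U : {linear V -> H}, (forall x, U (a x) = b x) /\
    forall v w, hdot H (U v) (U w) = hdot V v w.
Proof.
move=> atot ab.
have combE s t : rnorm (comb b s - comb b t) = rnorm (comb a s - comb a t).
  have minus (W : lmodType C) (f : X -> W) : comb f s - comb f t = comb f (s ++ scalec (-1) t).
    by rewrite comb_cat comb_scale scaleN1r.
  rewrite !minus; apply/eqP; rewrite -(@eqrXn2 _ 2)// ?rnorm_ge0//; apply/eqP.
  have n2 (U : hilbert R) (x : U) : rnorm x ^+ 2 = complex.Re (hdot U x x).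
    by rewrite hdot_rnorm.
  rewrite !n2 !hdot_comb; congr complex.Re.
  by apply: eq_bigr => p _; apply: eq_bigr => q _; rewrite ab.
have /choice[U UP] v : exists u, forall s, rnorm (u - comb b s) <= rnorm (v - comb a s).
  apply: vector_completeness => [s t|e e0]; last exact: atot.
  by rewrite combE (le_trans (rnorm_distD v _ _))// rnormB.
have Ulin : linear U.
  move=> c v w; apply/eqP; rewrite -subr_eq0; apply/eqP/rnorm_eq0.
  apply: (@ler_small _ _ _ (2 * (rnorm c + 1))) => e e0; rewrite add0r.
  have [s sP] := atot v e e0; have [t tP] := atot w e e0.
  have h1 := UP (c *: v + w) (scalec c s ++ t).
  rewrite !comb_cat !comb_scale [in leRHS]opprD addrACA -scalerBr in h1.
  have h2 := rnormD (c *: (v - comb a s)) (w - comb a t).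
  have h3 := rnormD (c *: (U v - comb b s)) (U w - comb b t).
  have h4 := rnorm_distD (c *: comb b s + comb b t) (U (c *: v + w)) (c *: U v + U w).
  have h5 : rnorm (c *: comb b s + comb b t - (c *: U v + U w)) =
      rnorm (c *: (U v - comb b s) + (U w - comb b t)).
    by rewrite rnormB scalerBr opprD addrACA.
  rewrite !rnormZ in h2 h3.
  have := ler_wpM2l (rnorm_ge0 c) (le_trans (UP v s) sP).
  have := ler_wpM2l (rnorm_ge0 c) sP.
  have := le_trans (UP w t) tP; lra.
pose U' : {linear V -> H} := HB.pack U (GRing.isLinear.Build C V H *:%R U Ulin).
have U'P v s : rnorm (U' v - comb b s) <= rnorm (v - comb a s) := UP v s.
exists U'; split.
  move=> x; apply/eqP; rewrite -subr_eq0; apply/eqP/rnorm_eq0.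
  by have := U'P (a x) [:: (1, x)]; rewrite !comb1 !scale1r subrr rnorm0.
have Un v : rnorm (U' v) = rnorm v.
  have combn s : rnorm (comb b s) = rnorm (comb a s).
    by have := combE s [::]; rewrite /comb !big_nil !subr0.
  apply/eqP; rewrite eq_le; apply/andP; split.
    apply: (@ler_small _ _ _ 2) => e e0; have [s sP] := atot v e e0.
    have := rnorm_leD (U' v) (comb b s); have := U'P v s; rewrite combn.
    by have := rnorm_leD (comb a s) v; rewrite [rnorm (comb a s - v)]rnormB; lra.
  apply: (@ler_small _ _ _ 2) => e e0; have [s sP] := atot v e e0.
  have := rnorm_leD (comb b s) (U' v); have := U'P v s; rewrite combn rnormB.
  by have := rnorm_leD v (comb a s); lra.
have URe v w : complex.Re (hdot H (U' v) (U' w)) = complex.Re (hdot V v w).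
  have := rnorm_sqrD (U' v) (U' w); rewrite -linearD !Un rnorm_sqrD; lra.
move=> v w; apply: complexP; first exact: URe.
have := URe v ('i *: w); rewrite linearZ !hdotZr !ReM Re_conj Im_conj /=; lra.
Qed.

Lemma isometry_rnorm (U : {linear V -> H}) :
  (forall v w, hdot H (U v) (U w) = hdot V v w) -> forall v, rnorm (U v) = rnorm v.
Proof.
move=> Uiso v; apply/eqP; rewrite -(@eqrXn2 _ 2)// ?rnorm_ge0//; apply/eqP.
by apply: complexI; rewrite -!hdot_rnorm Uiso.
Qed.

Lemma isometry_closed_range (U : {linear V -> H}) (h : H) :
  (forall v w, hdot H (U v) (U w) = hdot V v w) ->
  (forall e, 0 < e -> exists v, rnorm (h - U v) <= e) -> exists v, U v = h.
Proof.
move=> /isometry_rnorm Un hU.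
have [|v vP] := @vector_completeness R V V id (fun v => rnorm (h - U v)) _ hU.
  by move=> v w; rewrite -Un linearB (le_trans (rnorm_distD h _ _))// rnormB.
exists v; apply/eqP; rewrite -subr_eq0; apply/eqP/rnorm_eq0.
apply: (@ler_small _ _ _ 2) => e e0; rewrite add0r; have [w wP] := hU e e0.
have := vP w; rewrite -Un linearB.
by have := rnorm_distD (U w) (U v) h; rewrite [rnorm (U w - h)]rnormB; lra.
Qed.

End isometries.

(** * The induced representation *)

Section positive_integrals.
Variables (R : realType) (L : topGroupType).
Variable lambda : probability (borel L) R.
Hypotheses (compact_L : compact [set: L]) (haar_lambda : is_haar lambda).
Local Notation cint := (cintegral lambda).

Lemma cint_Re_ge0 (f : L -> R[i]) : (forall x, 0 <= complex.Re (f x)) ->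
  0 <= complex.Re (cint f).
Proof. by move=> f0; apply: Rintegral_ge0 => x _; exact: f0. Qed.

(** Finitely many translates of [h] add up to a function bounded below by a
    positive constant, so that the integral cannot vanish. *)
Lemma cint_gt0 (h : L -> R) : continuous h -> (forall x, 0 <= h x) -> 0 < h 1%g ->
  0 < complex.Re (cint (fun x => (h x)%:C)).
Proof.
move=> ch h0 h1; have cc := ccont_real ch.
set I := complex.Re _.
have I0 : 0 <= I by apply: cint_Re_ge0 => x; exact: h0.
have h2 : 0 < h 1%g / 2 by rewrite divr_gt0.
have nN x : nbhs x [set y | h 1%g / 2 < h (x^-1 * y)%g].
  have chx : continuous (fun y => h (x^-1 * y)%g).
    by move=> y; apply: continuous_comp; [exact: mulg_continuousl|exact: ch].
  have /cvgrPdist_lt /(_ _ h2) := chx x; apply: filterS => y /=.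
  rewrite mulVg => /(le_lt_trans (ler_norm _)); lra.
have [s sP] := compact_finite_cover compact_L nN.
have cF x : ccont (fun y => (h (x^-1 * y)%g)%:C : R[i]).
  exact: (ccont_comp cc (@mulg_continuousl L x^-1%g)).
have : 0 <= complex.Re (cint (fun y => \sum_(x <- s) (h (x^-1 * y)%g)%:C
    + (- (h 1%g / 2))%:C)).
  apply: cint_Re_ge0 => y; have [x xs xy] := sP y.
  rewrite ReD Re_sum /= subr_ge0 (le_trans (ltW xy))//.
  by rewrite (big_rem x)//= lerDl sumr_ge0.
rewrite cintD//; [|exact: ccont_sum|exact: ccont_cst].
rewrite cint_cst// cint_sum// ReD Re_sum.
rewrite (eq_bigr (fun=> I)); last first.
  move=> x _; have := cint_left compact_L haar_lambda x^-1%g cc.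
  by move=> /(congr1 (@complex.Re R)).
rewrite subr_ge0 => hs; rewrite lt_def I0 andbT.
by apply/eqP => c0; move: hs; rewrite c0 big1_eq /=; lra.
Qed.

End positive_integrals.

Section induction.
Variables (R : realType) (L : topGroupType).
Variable lambda : probability (borel L) R.
Hypotheses (compact_L : compact [set: L]) (haar_lambda : is_haar lambda).
Local Notation C := R[i].
Local Notation cint := (cintegral lambda).
Local Notation conv := (convolution lambda).
Local Notation inv := (@involution R L).
Local Notation l2norm := (l2norm lambda).
Variable K : set L.
Hypothesis subgroup_K : is_closed_subgroup K.
Variables (V : hilbert R) (tau : (L -> C) -> {linear V -> V}).
Hypothesis rep_tau : is_star_rep lambda K tau.
Hypothesis nondegenerate_tau : nondegenerate_rep K tau.
Local Notation hecke := (hecke K).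
Local Notation right_invariant := (right_invariant K).
(** Here [kap f v] stands for [rho(f) v]. *)
Variables (H : hilbert R) (kap : (L -> C) -> V -> H).
Hypothesis kap_dot : forall f g v w, right_invariant f -> right_invariant g ->
  hdot H (kap f v) (kap g w) = hdot V (tau (conv (inv g) f) v) w.
Let E := {f : L -> C | right_invariant f}.
Let kapX (x : E * V) : H := kap (sval x.1) x.2.
Hypothesis kap_total : total kapX.

Let translate (g : L) (f : L -> C) x := f (g^-1 * x)%g.

Let right_invariant_translate g (f : L -> C) : right_invariant f -> right_invariant (translate g f).
Proof.
move=> [cf fK]; split; first exact: (ccont_comp cf (@mulg_continuousl L g^-1%g)).
by move=> x k Kk; rewrite /translate mulgA fK.
Qed.

Let E_ccont (f : L -> C) : right_invariant f -> ccont f. Proof. by case. Qed.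

Let kap_lin (a : C) (f g : L -> C) v : right_invariant f -> right_invariant g ->
  kap (fun x => a * f x + g x) v = a *: kap f v + kap g v.
Proof.
move=> fE gE; have [cf _] := fE; have [cg _] := gE.
apply: (total_eq kap_total) => -[[h hE] w]; rewrite /kapX /=.
have [ch _] := hE; have cih := ccont_inv ch.
rewrite hdotDl hdotZl !kap_dot//; last exact: right_invariant_lin.
rewrite conv_linr// (star_rep_linear rep_tau); try exact: hecke_inner.
by rewrite hdotDl hdotZl.
Qed.

Let kap_linr (a : C) (f : L -> C) v w : right_invariant f ->
  kap f (a *: v + w) = a *: kap f v + kap f w.
Proof.
move=> fE; apply: (total_eq kap_total) => -[[h hE] u]; rewrite /kapX /=.
by rewrite hdotDl hdotZl !kap_dot// linearP hdotDl hdotZl.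
Qed.

Let kap_norm (f : L -> C) v : right_invariant f -> rnorm (kap f v) <= l2norm f * rnorm v.
Proof.
move=> fE; rewrite -(@ler_pXn2r _ 2)// ?nnegrE ?rnorm_ge0 ?mulr_ge0 ?l2norm_ge0 ?rnorm_ge0//.
have -> : rnorm (kap f v) ^+ 2 = complex.Re (hdot H (kap f v) (kap f v)).
  by rewrite hdot_rnorm.
by rewrite kap_dot// exprMn; exact: (tau_inner_le compact_L haar_lambda subgroup_K rep_tau).
Qed.

(** This is [rho(f) rho(h) v = rho(f * h) v] for [h] in the algebra, which acts on
    fixed vectors through [tau]. *)
Let kap_tau (f h : L -> C) v : right_invariant f -> hecke h -> kap (conv f h) v = kap f (tau h v).
Proof.
move=> fE hH; have [cf _] := fE; have hE := hecke_right subgroup_K hH.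
have ch := E_ccont hE.
have fhE : right_invariant (conv f h) by exact: right_invariant_conv.
apply: (total_eq kap_total) => -[[g gE] w]; rewrite /kapX /=.
have [cg _] := gE; have cig := ccont_inv cg.
rewrite !kap_dot// -convA// (star_rep_mul rep_tau)//.
exact: hecke_inner.
Qed.

Let ccont_translate_uncurried (f : L -> C) : ccont f ->
  ccont (fun p : L * L => translate p.1 f p.2).
Proof. exact: ccont_mulVg. Qed.

(** This is [rho(f) rho(u) v = rho(f * u) v] in weak form. *)
Let kap_conv (f u : L -> C) v (w : H) : ccont f -> right_invariant u ->
  cint (fun g => f g * hdot H (kap (translate g u) v) w) = hdot H (kap (conv f u) v) w.
Proof.
move=> cf uE; have [cu _] := uE.
apply: (@integral_exchange _ _ lambda compact_L f (fun g => translate g u) right_invariant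
   (fun h => hdot H (kap h v) w) (rnorm v * rnorm w)) => //.
- exact: ccont_translate_uncurried.
- by move=> g; exact: right_invariant_translate.
- exact: (right_invariant_conv lambda compact_L cf uE).
- by move=> a g h; exact: right_invariant_lin.
- by move=> a g h gE hE; rewrite kap_lin// hdotDl hdotZl.
- by rewrite mulr_ge0 ?rnorm_ge0.
- move=> h c hE c0 hc; rewrite (le_trans (hdot_CS _ _))//.
  rewrite [leRHS]mulrAC ler_wpM2r ?rnorm_ge0// (le_trans (kap_norm _ hE))//.
  rewrite mulrC ler_wpM2l ?rnorm_ge0//; apply: l2norm_le_sup => //; exact: E_ccont.
Qed.

Let HE := {f : L -> C | hecke f}.

(** Nondegeneracy: a vector orthogonal to the image of every [tau f] is killed by
    every [tau f]. *)
Let tau_total : total (fun x : HE * V => tau (sval x.1) x.2).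
Proof.
apply: total_orthogonal => v vP; apply: nondegenerate_tau => f fH.
apply: hdot_ext => w; rewrite hdot0l.
rewrite (tau_adj subgroup_K rep_tau)//.
exact: (vP (exist _ _ (hecke_inv subgroup_K fH), w)).
Qed.

(** The embedding of [V] sends [tau f v] to [rho(f) v]. *)
Let U_ex : exists U : {linear V -> H},
  (forall f v, hecke f -> U (tau f v) = kap f v) /\
  forall v w, hdot H (U v) (U w) = hdot V v w.
Proof.
have [|U [Uk Uiso]] := @isometry_extension R V H (HE * V)
  (fun x => tau (sval x.1) x.2) (fun x => kap (sval x.1) x.2) tau_total.
  move=> [[f fH] v] [[g gH] w] /=.
  have fE := hecke_right subgroup_K fH; have gE := hecke_right subgroup_K gH.
  rewrite kap_dot// (star_rep_mul rep_tau)//; last exact: hecke_inv.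
  by rewrite (star_rep_star rep_tau).
by exists U; split=> // f v fH; exact: (Uk (exist _ f fH, v)).
Qed.

Let rho_ex g : exists T : {linear H -> H},
  (forall f v, right_invariant f -> T (kap f v) = kap (translate g f) v) /\
  forall v w, hdot H (T v) (T w) = hdot H v w.
Proof.
have [|T [Tk Tiso]] := @isometry_extension R H H (E * V) kapX
  (fun x => kap (translate g (sval x.1)) x.2) kap_total.
  move=> [[f fE] v] [[h hE] w]; rewrite /kapX /=.
  have [cf _] := fE; have [ch _] := hE.
  rewrite !kap_dot//; try exact: right_invariant_translate.
  congr (hdot V (tau _ v) w); apply/funext => y.
  have ci : ccont (fun z => inv h z * f (z^-1 * y)%g).
    apply: ccontM; first exact: ccont_inv.
    apply: (ccont_comp cf); apply: continuous_mulg; last by move=> z; exact: cvg_cst.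
    by apply: continuous_invg => z; exact: cvg_id.
  rewrite /convolution -(cint_right compact_L haar_lambda g ci).
  congr cintegral; apply/funext => z.
  by rewrite /involution /translate invgM mulgA.
by exists T; split=> // f v fE; exact: (Tk (exist _ f fE, v)).
Qed.

Section operators.
Variables (U : {linear V -> H}) (rho : L -> {linear H -> H}).
Hypothesis Uk : forall f v, hecke f -> U (tau f v) = kap f v.
Hypothesis Uiso : forall v w, hdot H (U v) (U w) = hdot V v w.
Hypothesis rhok : forall g f v, right_invariant f ->
  rho g (kap f v) = kap (translate g f) v.
Hypothesis rhoiso : forall g v w, hdot H (rho g v) (rho g w) = hdot H v w.

Let Un := isometry_rnorm Uiso.
Let rhon g := isometry_rnorm (rhoiso g).

Let eqH (S T : {linear H -> H}) : (forall v, rnorm (S v) = rnorm v) ->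
  (forall v, rnorm (T v) = rnorm v) ->
  (forall f v, right_invariant f -> S (kap f v) = T (kap f v)) -> forall v, S v = T v.
Proof.
move=> Sn Tn ST; apply: (@total_linear_eq _ _ _ _ _ _ _ 1 1 kap_total).
- by move=> v; rewrite mul1r Sn.
- by move=> v; rewrite mul1r Tn.
- by move=> [[f fE] v]; exact: ST.
Qed.

Let rho1 v : rho 1%g v = v.
Proof.
apply: (@eqH (rho 1%g) idfun _ _ _ v) => // f w fE; rewrite rhok//=.
by congr kap; apply/funext => x; rewrite /translate invg1 mul1g.
Qed.

Let rhoM g h v : rho (g * h)%g v = rho g (rho h v).
Proof.
apply: (@eqH (rho (g * h)%g) (rho g \o rho h) _ _ _ v) => //.
  by move=> w /=; rewrite !rhon.
move=> f w fE /=; rewrite !rhok//; last exact: right_invariant_translate.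
by congr kap; apply/funext => x; rewrite /translate invgM mulgA.
Qed.

Let kap_cont f v g (e : R) : right_invariant f -> 0 < e ->
  \forall g' \near g, rnorm (kap (translate g f) v - kap (translate g' f) v) < e.
Proof.
move=> fE e0; have [cf _] := fE.
have v1 : 0 < rnorm v + 1 by rewrite ltr_pwDr ?rnorm_ge0.
have e1 : 0 < e / (rnorm v + 1) by rewrite divr_gt0.
have := @ccont_uniform R L compact_L L (fun h => translate h f)
  (ccont_translate_uncurried cf) g _ e1.
apply: filterS => g' gg'.
have gE := right_invariant_translate g fE.
have gE' := right_invariant_translate g' fE.
have dE := right_invariant_lin (-1) gE' gE.
have -> : kap (translate g f) v - kap (translate g' f) v =
    kap (fun x => -1 * translate g' f x + translate g f x) v.
  by rewrite kap_lin// scaleN1r addrC.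
rewrite (le_lt_trans (kap_norm _ dE))//.
rewrite (@le_lt_trans _ _ (e / (rnorm v + 1) * rnorm v))//.
  rewrite ler_wpM2r ?rnorm_ge0//; apply: l2norm_le_sup; [done|by case: dE|exact: ltW|].
  by move=> x; rewrite mulN1r addrC; exact/ltW/gg'.
by rewrite mulrAC ltr_pdivrMr// ltr_pM2l// ltrDl.
Qed.

Let rho_cont v g (e : R) : 0 < e ->
  \forall g' \near g, rnorm (rho g v - rho g' v) < e.
Proof.
have comb_cont s (e' : R) : 0 < e' ->
    \forall g' \near g, rnorm (rho g (comb kapX s) - rho g' (comb kapX s)) < e'.
  elim: s e' => [|[a [[f fE] w]] s IH] e' e'0.
    by near=> g'; rewrite /comb big_nil !raddf0 addr0 rnorm0.
  have a1 : 0 < rnorm a + 1 by rewrite ltr_pwDr ?rnorm_ge0.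
  have h1 := kap_cont w g fE (e := e' / 2 / (rnorm a + 1)).
  have e'2 : 0 < e' / 2 by rewrite divr_gt0.
  near=> g'.
  have -> : comb kapX ((a, (exist _ f fE, w)) :: s) = a *: kap f w + comb kapX s.
    by rewrite /comb big_cons.
  have -> : rho g (a *: kap f w + comb kapX s) = a *: rho g (kap f w) + rho g (comb kapX s).
    exact: linearP.
  have -> : rho g' (a *: kap f w + comb kapX s) = a *: rho g' (kap f w) + rho g' (comb kapX s).
    exact: linearP.
  rewrite opprD addrACA -scalerBr (le_lt_trans (rnormD _ _))// [e']splitr ltrD//.
    rewrite rnormZ !rhok//.
    rewrite (@le_lt_trans _ _ (rnorm a * (e' / 2 / (rnorm a + 1))))//.
      rewrite ler_wpM2l ?rnorm_ge0// ltW//; near: g'; apply: h1.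
      by rewrite divr_gt0.
    by rewrite mulrA ltr_pdivrMr// mulrC ltr_pM2l// ltrDl.
  by near: g'; exact: IH.
move=> e0; have e3 : 0 < e / 3 by rewrite divr_gt0.
have [s sP] := kap_total v e3.
have := comb_cont s _ e3; apply: filterS => g' gg'.
have h1 : rnorm (rho g v - rho g (comb kapX s)) <= e / 3 by rewrite -linearB rhon.
have h2 : rnorm (rho g' (comb kapX s) - rho g' v) <= e / 3.
  by rewrite -linearB rhon rnormB.
have := rnorm_distD (rho g (comb kapX s)) (rho g v) (rho g' v).
have := rnorm_distD (rho g' (comb kapX s)) (rho g (comb kapX s)) (rho g' v).
lra.
Unshelve. all: by end_near. Qed.

Let coef_cont v w : ccont (fun g => hdot H (rho g v) w).
Proof.
apply/ccontP => g e e0; have w1 : 0 < rnorm w + 1 by rewrite ltr_pwDr ?rnorm_ge0.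
have e1 : 0 < e / (rnorm w + 1) by rewrite divr_gt0.
have := rho_cont v g e1; apply: filterS => g' gg'.
rewrite -hdotBl (le_lt_trans (hdot_CS _ _))//.
rewrite (@le_lt_trans _ _ (e / (rnorm w + 1) * rnorm w))//.
  by rewrite ler_wpM2r ?rnorm_ge0// ltW.
by rewrite mulrAC ltr_pdivrMr// ltr_pM2l// ltrDl.
Qed.

Let kap_fixed f v : hecke f -> fixed_vectors rho K (kap f v).
Proof.
move=> fH k Kk; have fE := hecke_right subgroup_K fH.
rewrite rhok//; congr kap; apply/funext => x; rewrite /translate.
by have [_ K1 _ KV] := subgroup_K; have /heckeE[//|_ ->//] := fH; exact: KV.
Qed.

Let U_fixed v : fixed_vectors rho K (U v).
Proof.
move=> k Kk; apply: (@total_linear_eq _ _ _ _ _ (rho k \o U) U 1 1 tau_total).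
- by move=> w /=; rewrite rhon Un mul1r.
- by move=> w; rewrite Un mul1r.
- by move=> [[f fH] w] /=; rewrite Uk//; exact: kap_fixed.
Qed.

Let rho_unitary : is_unitary_rep rho.
Proof.
split => // v g; apply/cvgf_rnormP => e e0; exact: rho_cont.
Qed.

(** A vector orthogonal to all [rho(g) rho(h) v] with [h] in the algebra is, after
    integration against [f], orthogonal to [rho(f) rho(h) v = rho(f) tau(h) v], and
    the [tau(h) v] span a dense subspace. *)
Let rho_cyclic : cyclic_fixed_vectors rho K.
Proof.
pose a (x : L * (HE * V)) : H := rho x.1 (kap (sval x.2.1) x.2.2).
have atot : total a.
  apply: total_orthogonal => xi xiP.
  have xi0 f v : right_invariant f -> hdot H (kap f v) xi = 0.
    move=> fE; have [cf _] := fE.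
    apply: (@total_functional _ _ _ _ (fun v => hdot H (kap f v) xi)
      (l2norm f * rnorm xi) tau_total).
    - by move=> c w w'; rewrite kap_linr// hdotDl hdotZl.
    - move=> w; rewrite (le_trans (hdot_CS _ _))// [leRHS]mulrAC.
      by rewrite ler_wpM2r ?rnorm_ge0// kap_norm.
    - move=> [[h hH] w] /=; have hE := hecke_right subgroup_K hH.
      rewrite -kap_tau// -kap_conv//.
      transitivity (cint (fun=> 0)); last by rewrite cint_cst.
      congr cintegral; apply/funext => g.
      have := xiP (g, (exist _ h hH, w)); rewrite /a /= rhok// hdotC => /eqP.
      by rewrite conjC_eq0 => /eqP ->; rewrite mulr0.
  apply: (total_eq kap_total) => -[[f fE] v].
  by rewrite hdot0l hdotC /kapX /= xi0// rmorph0.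
apply/dense_rnormP => v e e0; have [|s sP] := atot v (e / 2).
  by rewrite divr_gt0.
exists (comb a s); last by rewrite (le_lt_trans sP)// ltr_pdivrMr// ltr_pMr// ltr1n.
exists (size s), (fun i => (tnth (in_tuple s) i).1),
  (fun i => a (tnth (in_tuple s) i).2); split; last by rewrite /comb big_tnth.
move=> i; case: (tnth _ i).2 => g [[f fH] w].
by exists g => //; exists (kap f w) => //; exact: kap_fixed.
Qed.

(** A fixed vector [xi] is close to its averages [rho(eps) xi], where [eps] is
    supported where [rho(g) xi] is close to [xi].  This [eps] is bi-invariant since
    [xi] is fixed.  Approximating [xi] by combinations of [rho(f) v], the averages
    become combinations of [rho(eps * f) v], which lie in the range of [U] as
    [eps * f] belongs to the algebra; and this range is closed. *)
Let U_range : range U = fixed_vectors rho K.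
Proof.
apply/seteqP; split=> [_ [v _ <-]|xi xiK]; first exact: U_fixed.
suff : exists v, U v = xi by move=> [v <-]; exists v.
apply: (isometry_closed_range Uiso) => e0 e00.
pose e := e0 / 2; have e_gt0 : 0 < e by rewrite divr_gt0.
pose phi g : R := Num.max 0 (e - rnorm (rho g xi - xi)).
have phi0 g : 0 <= phi g by rewrite le_max lexx.
have phi1 : 0 < phi 1%g by rewrite /phi rho1 subrr rnorm0 subr0 lt_max e_gt0 orbT.
have norm_cont : continuous (fun g => e - rnorm (rho g xi - xi)).
  move=> g; apply/cvgrPdist_lt => d d0.
  have := rho_cont xi g d0; apply: filterS => g'; apply: le_lt_trans.
  rewrite opprB addrC addrA addrNK.
  have := rnorm_distD (rho g xi) (rho g' xi) xi.
  have := rnorm_distD (rho g' xi) (rho g xi) xi.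
  rewrite [rnorm (rho g' xi - rho g xi)]rnormB => h1 h2.
  by rewrite ler_norml; apply/andP; split; move: h1 h2; lra.
have phi_cont : continuous phi.
  move=> g; apply: (@continuous_max R L (cst 0)); [exact: cvg_cst|exact: norm_cont].
pose eps g : C := (phi g)%:C.
have ceps : ccont eps by exact: ccont_real.
have epsK k1 k2 g : K k1 -> K k2 -> eps (k1 * g * k2)%g = eps g.
  move=> Kk1 Kk2; rewrite /eps /phi; congr (Num.max 0 (e - _))%:C.
  rewrite !rhoM (xiK _ Kk2) -{2}(xiK _ Kk1).
  by rewrite -linearB rhon.
have epsH : hecke eps by split=> //; exact/ccontE.
pose c0 := complex.Re (cint eps).
have c00 : 0 < c0 by exact: cint_gt0.
have [s sP] := kap_total xi e_gt0.
pose zeta : H := c0^-1%:C *: \sum_(p <- s) p.1 *: kap (conv eps (sval p.2.1)) p.2.2.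
have epsf f : right_invariant f -> hecke (conv eps f).
  by move=> fE; exact: hecke_mul.
have [v vE] : exists v, U v = zeta.
  exists (c0^-1%:C *: \sum_(p <- s) p.1 *: tau (conv eps (sval p.2.1)) p.2.2).
  rewrite linearZ linear_sum; congr (_ *: _); apply: eq_bigr => -[a [[f fE] w]] _ /=.
  by rewrite linearZ /= Uk//; exact: epsf.
exists v; rewrite vE.
have cint_eps : cint eps = c0%:C.
  by apply: ge0_Re; apply: cint_ge0 => g; rewrite /eps ler0c.
have zetaE w : c0%:C * hdot H (zeta - xi) w =
    cint (fun g => eps g * hdot H (rho g (comb kapX s) - xi) w).
  have -> : (fun g => eps g * hdot H (rho g (comb kapX s) - xi) w) =
     (fun g => (- hdot H xi w) * eps g +
         \sum_(p <- s) eps g * (p.1 * hdot H (rho g (kapX p.2)) w)).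
    apply/funext => g; rewrite hdotBl mulrBr addrC mulNr [eps g * hdot H xi w]mulrC.
    congr (_ + _); rewrite /comb linear_sum hdot_suml mulr_sumr.
    by apply: eq_bigr => p _; rewrite linearZ hdotZl.
  have cp (p : C * (E * V)) : ccont (fun g => eps g * (p.1 * hdot H (rho g (kapX p.2)) w)).
    by apply: ccontM => //; exact: ccontZ.
  rewrite cint_lin//; last exact: ccont_sum.
  rewrite cint_sum// cint_eps hdotBl mulrBr addrC mulNr [c0%:C * hdot H xi w]mulrC.
  congr (_ + _); rewrite /zeta hdotZl mulrA -rmorphM divff ?gt_eqF// rmorph1 mul1r.
  rewrite hdot_suml; apply: eq_bigr => -[a [[f fE] u]] _.
  rewrite hdotZl /= -kap_conv// -cintZ//; last first.
    apply: ccontM => //; have := coef_cont (kap f u) w.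
    by congr ccont; apply/funext => g; rewrite rhok.
  by congr cintegral; apply/funext => g; rewrite /kapX /= rhok// mulrCA.
have bound w : c0 * complex.Re (hdot H (zeta - xi) w) <= c0 * (2 * e * rnorm w).
  have cG : ccont (fun g => eps g * hdot H (rho g (comb kapX s) - xi) w).
    apply: ccontM => //; have := ccontB (coef_cont (comb kapX s) w) (ccont_cst (hdot H xi w)).
    by congr ccont; apply/funext => g; rewrite hdotBl.
  have -> : c0 * complex.Re (hdot H (zeta - xi) w) =
      complex.Re (cint (fun g => eps g * hdot H (rho g (comb kapX s) - xi) w)).
    by rewrite -zetaE ReZ.
  have : 0 <= complex.Re (cint (fun g => (2 * e * rnorm w)%:C * eps g +
       (-1 * (eps g * hdot H (rho g (comb kapX s) - xi) w)))).
    apply: cint_Re_ge0 => g; rewrite ReD ReZ mulN1r ReN ReZ subr_ge0 /= mulrC.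
    have [p0|p0] := leP (phi g) 0.
      have -> : phi g = 0 by apply/eqP; rewrite eq_le p0 phi0.
      by rewrite !mulr0.
    rewrite ler_pM2r//; move: p0; rewrite /phi lt_max ltxx /= subr_gt0 => near_xi.
    rewrite (le_trans (ler_norm _))// (le_trans (rnorm_Re _))//.
    rewrite (le_trans (hdot_CS _ _))// ler_wpM2r ?rnorm_ge0//.
    have h1 : rnorm (rho g (comb kapX s) - rho g xi) <= e.
      by rewrite -linearB rhon rnormB.
    have := rnorm_distD (rho g xi) (rho g (comb kapX s)) xi; lra.
  rewrite cintD//; [|exact: ccontZ|exact: ccontZ].
  by rewrite !cintZ// ReD ReZ mulN1r ReN subr_ge0 mulrC.
have := bound (zeta - xi); rewrite ler_pM2l// hdot_rnorm /= rnormB.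
have -> : 2 * e = e0 by rewrite /e mulrC divfK.
have [->|z0] := eqVneq (rnorm (xi - zeta)) 0; first by move=> _; exact: ltW.
by rewrite expr2 ler_pM2r// lt_def z0 rnorm_ge0.
Unshelve. all: by end_near. Qed.

Let U_intertwines f : hecke f ->
  forall v, U (tau f v) = int_rep lambda rho f (U v).
Proof.
move=> fH v; symmetry; apply: int_repE => w.
have cf := hecke_ccont subgroup_K fH.
have [M M0 MP] := ccont_bounded compact_L cf.
have [N N0 NP] := continuous_bounded (star_rep_bounded rep_tau fH).
apply/eqP; rewrite -subr_eq0; apply/eqP.
have cfu v' : ccont (fun g => f g * hdot H (rho g (U v')) w).
  by apply: ccontM => //; exact: coef_cont.
apply: (@total_functional _ _ _ _ (fun v => hdot H (U (tau f v)) w -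
  cint (fun g => f g * hdot H (rho g (U v)) w)) ((N + 2 * M) * rnorm w) tau_total).
* move=> c v1 v2.
  have -> : cint (fun g => f g * hdot H (rho g (U (c *: v1 + v2))) w) =
      c * cint (fun g => f g * hdot H (rho g (U v1)) w) +
      cint (fun g => f g * hdot H (rho g (U v2)) w).
    rewrite -cint_lin//; congr cintegral; apply/funext => g.
    have -> : rho g (U (c *: v1 + v2)) = c *: rho g (U v1) + rho g (U v2).
      by have -> : U (c *: v1 + v2) = c *: U v1 + U v2; exact: linearP.
    by rewrite hdotDl hdotZl; ring.
  have -> : U (tau f (c *: v1 + v2)) = c *: U (tau f v1) + U (tau f v2).
    by have -> : tau f (c *: v1 + v2) = c *: tau f v1 + tau f v2; exact: linearP.
  by rewrite hdotDl hdotZl; ring.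
* move=> v1; rewrite (le_trans (rnormD _ _))// rnormN.
  have h1 : rnorm (hdot H (U (tau f v1)) w) <= N * rnorm v1 * rnorm w.
    by rewrite (le_trans (hdot_CS _ _))// Un ler_wpM2r ?rnorm_ge0.
  have h2 : rnorm (cint (fun g => f g * hdot H (rho g (U v1)) w)) <=
      2 * (M * (rnorm v1 * rnorm w)).
    apply: cint_le => //; first by rewrite !mulr_ge0 ?rnorm_ge0 ?(ltW M0).
    move=> g; rewrite rnormM ler_pM ?rnorm_ge0//.
    by rewrite (le_trans (hdot_CS _ _))// rhon Un.
  by move: h1 h2; lra.
* move=> [[h hH] u] /=; have hE := hecke_right subgroup_K hH.
  rewrite -(star_rep_mul rep_tau)// !Uk//; last exact: hecke_mul.
  rewrite -kap_conv//; apply/eqP; rewrite subr_eq0; apply/eqP.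
  by congr cintegral; apply/funext => g; rewrite rhok.
Qed.

Lemma induction_properties :
  [/\ is_unitary_rep rho, cyclic_fixed_vectors rho K & equiv_Res lambda K tau rho].
Proof.
split; [exact: rho_unitary|exact: rho_cyclic|exists U; split].
- exact: Uiso.
- exact: U_range.
- exact: U_intertwines.
Qed.

End operators.

Theorem induced_representation : exists rho : L -> {linear H -> H},
  [/\ is_unitary_rep rho, cyclic_fixed_vectors rho K & equiv_Res lambda K tau rho].
Proof.
have [U [Uk Uiso]] := U_ex; have /choice[rho rhoP] := rho_ex.
exists rho; apply: (induction_properties Uk Uiso) => g.
  by have [h _] := rhoP g; exact: h.
by have [_ h] := rhoP g; exact: h.
Qed.

End induction.

Theorem proposition2p3 (R : realType) (L : topGroupType)
    (hausdorff_L : hausdorff_space L) (compact_L : compact [set: L])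
    (countable_L : @second_countable L)
    (lambda : probability (borel L) R) (haar_lambda : is_haar lambda)
    (K : set L) (subgroup_K : is_closed_subgroup K)
    (V : hilbert R) (tau : (L -> R[i]) -> {linear V -> V})
    (rep_tau : is_star_rep lambda K tau)
    (nondegenerate_tau : nondegenerate_rep K tau) :
  exists (H : hilbert R) (rho : L -> {linear H -> H}),
    [/\ is_unitary_rep rho, cyclic_fixed_vectors rho K
      & equiv_Res lambda K tau rho].
Proof.
have [D D_dense] := induction_separable compact_L haar_lambda countable_L
  subgroup_K rep_tau.
have [H [k [k_dot k_dense]]] := kernel_hilbert D_dense.
(* Extension by 0 to all functions spares carrying proofs of invariance. *)
pose kap f v : H := if pselect (right_invariant K f) is left fE
  then k (exist _ f fE, v) else 0.
have kapE (x : {f : L -> R[i] | right_invariant K f} * V) : kap (sval x.1) x.2 = k x.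
  case: x => -[f fE] v; rewrite /kap /=; case: pselect => // fE'.
  by congr (k (exist _ f _, v)); exact: Prop_irrelevance.
exists H; apply: (@induced_representation R L lambda compact_L haar_lambda K
  subgroup_K V tau rep_tau nondegenerate_tau H kap).
  move=> f g v w fE gE.
  have := k_dot (exist _ f fE, v) (exist _ g gE, w).
  by rewrite -!kapE.
move=> h e e0; have [s sP] := k_dense h e e0.
exists s; rewrite (_ : comb _ s = comb k s)//.
by apply: eq_bigr => p _; rewrite kapE.
Qed.
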